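(* Let $E$ be a smooth manifold, $m\ge 1$, and let $r\geq 1$, $k\ge 0$ and $0\le s\le m-1$ be integers. Then the operator $P$ is a pseudo-homotopy operator for $d_{\mathrm T}$: for every $\Phi\in\Omega^{r,s}_k$, \[ \bigl(\tau^{(r+1)(k+1)-1,\,(r+1)k}\bigr)^{*}\, d_{\mathrm T}P\,\Phi \;+\; P\,d_{\mathrm T}\Phi \;=\;\bigl(\tau^{(r+1)(k+1)-1,\,k}\bigr)^{*}\Phi \qquad\text{in }\Omega^{r,s}_{(r+1)(k+1)-1}. \] This formula includes the case $s=0$, where $P^j_{(0)}=0$ (so $P\Phi=0$) by convention, and the case $s>0$, $k=0$, where $P^j_{(s)}=0$ (so $P\Phi=0$ and $d_{\mathrm T}P\Phi=0$). Consequently, for $r\ge1$, each homogeneous variational complex is globally exact modulo pullbacks: if $0\le s\le m-1$ and $\Phi\in\Omega^{r,s}_k$ satisfies $d_{\mathrm T}\Phi=0$, then \[ d_{\mathrm T}(P\Phi)=\bigl(\tau^{(r+1)k,\,k}\bigr)^{*}\Phi \] (so that $\Phi=0$ if $s=0$ or $k=0$), while exactness at the last two nonzero terms $\Omega^{r,m}_{\bullet}$ and $\Omega^{r,m}_{\bullet}/d_{\mathrm T}(\Omega^{r,m-1}_{\bullet-1})$ holds by definition of the quotient.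
   Context: Frame bundles. $E$ is a smooth manifold of dimension $n$ with local coordinates $(u^\alpha)$. For $k\ge0$, $\mathcal F^k=\mathcal F^k_{(m)}E$ is the manifold of $k$-jets $j^k_0\gamma$ at $0\in\mathbf R^m$ of immersions $\gamma$ from a neighbourhood of $0$ in $\mathbf R^m$ to $E$ (for $k=0$, $\mathcal F^0=E$). It has local coordinates $(u^\alpha_I)$, $I\in\mathbf N^m$ a multi-index with $0\le|I|\le k$, where $u^\alpha_I(j^k_0\gamma)=\partial^{|I|}(u^\alpha\circ\gamma)/\partial t^I(0)$. For $l\le k$, $\tau^{k,l}:\mathcal F^k\to\mathcal F^l$ is the projection. $1_i$ is the multi-index with $1$ in position $i$ and $0$ elsewhere; $I(i)$ is the $i$-th entry of $I$; $I!=\prod_i I(i)!$. Scalar operators. $\Omega^r_k$ is the space of scalar differential $r$-forms on $\mathcal F^k$. The total derivative $d_i:\Omega^r_k\to\Omega^r_{k+1}$ ($1\le i\le m$) is the degree-zero derivation along $(\tau^{k+1,k})^*$, commuting with $d$, given on functions by $d_if=\sum_{|I|=0}^k u^\alpha_{I+1_i}\,\partial f/\partial u^\alpha_I$ (so $d_i(du^\alpha_I)=du^\alpha_{I+1_i}$). The vertical endomorphism $S^i$ is the globally defined type $(1,1)$ tensor field on $\mathcal F^k$ given in coordinates by $S^i=\sum_{|I|=0}^{k-1}(I(i)+1)\frac{\partial}{\partial u^\alpha_{I+1_i}}\otimes du^\alpha_I$ (zero if $k=0$); it acts on 1-forms by $S^i\theta=\theta\circ S^i$, on functions by $0$, and is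 extended to $r$-forms as a derivation of degree zero. The $d_i$ commute with each other and the $S^i$ commute with each other; for a multi-index $J$, $d_J=\prod_i(d_i)^{J(i)}$ and $S^J=\prod_i(S^i)^{J(i)}$. Repeated indices are summed. Vector-valued forms. $\Omega^{r,s}_k=\Omega^r_k\otimes\bigwedge^s\mathbf R^{m*}$, with $dt^1,\dots,dt^m$ the standard basis of $\mathbf R^{m*}$; pullbacks act on the first factor. The total exterior derivative $d_{\mathrm T}:\Omega^{r,s}_k\to\Omega^{r,s+1}_{k+1}$ is defined by $d_{\mathrm T}(\theta\otimes w)=d_i\theta\otimes(dt^i\wedge w)$ and linearity; $d_{\mathrm T}^2=0$. The operator $P$. For $r\ge1$, $s\geq 1$, $P:\Omega^{r,s}_k\to\Omega^{r,s-1}_{(r+1)k-1}$ is defined as follows. Write $\Phi=\phi_{i_1\cdots i_s}\otimes(dt^{i_1}\wedge\cdots\wedge dt^{i_s})$ (sum over all indices) with scalar $r$-forms $\phi_{i_1\cdots i_s}$ completely skew-symmetric in the indices. Then \[ P(\Phi)=s\,P^j_{(s)}(\phi_{j i_2\cdots i_s})\otimes(dt^{i_2}\wedge\cdots\wedge dt^{i_s}), \quad P^j_{(s)}=\sum_{|J|=0}^{rk-1}\frac{(-1)^{|J|}(m-s)!\,|J|!}{r^{|J|+1}(m-s+|J|+1)!\,J!}\,d_JS^{J+1_j}, \] each term being pulled back to $\mathcal F^{(r+1)k-1}$. For $s=0$ one sets $P=0$; for $k=0$ the sum is empty and $P=0$. Homogeneous variational complexes ($r\ge1$). For $1\le r\le\dim\mathcal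 F^k$: \[0\to\Omega^{r,0}_k\to\Omega^{r,1}_{k+1}\to\cdots\to\Omega^{r,m}_{k+m}\to\Omega^{r,m}_{k+m}/d_{\mathrm T}(\Omega^{r,m-1}_{k+m-1})\to0;\] for $s\ge1$: $0\to\Omega^{r,s}_0\to\Omega^{r,s+1}_1\to\cdots\to\Omega^{r,m}_{m-s}\to\Omega^{r,m}_{m-s}/d_{\mathrm T}(\Omega^{r,m-1}_{m-s-1})\to0$; and for $r>\dim\mathcal F^{k-1}$ (so that $\Omega^{r,s-1}_{k-1}=0$): $\Omega^{r,s}_k\to\Omega^{r,s+1}_{k+1}\to\cdots\to\Omega^{r,m}_{k+m-s}\to\Omega^{r,m}_{k+m-s}/d_{\mathrm T}(\Omega^{r,m-1}_{k+m-s-1})\to0$ (in this last case injectivity of the first map is not claimed). All maps except the quotient projections are $d_{\mathrm T}$.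
   Formalization: F^0 is taken to be the set of 0-jets of immersions, which is E when m ≤ dim E but empty when m > dim E; with F^0 = E the claim ''Φ = 0 if s = 0 or k = 0'' fails for m > dim E (e.g. E = R, m = 2, k = 0, Φ = dx), since F^1 is then empty. *)

(* Defs.v *)
From HB Require Import structures.
From mathcomp Require Import all_boot all_order all_fingroup all_algebra.
From mathcomp Require Import all_classical all_reals all_analysis.
Set Implicit Arguments. Unset Strict Implicit. Unset Printing Implicit Defensive.
Import Order.TTheory GRing.Theory Num.Theory.
Import numFieldNormedType.Exports.
Local Open Scope classical_set_scope.
Local Open Scope ring_scope.

Section Smooth.
Context {R : realType} {V W : normedModType R}.

(* [O] is always an open set of a finite-dimensional [V] below, so that
   requiring all directional derivatives to be of class [j] gives the usual
   notion of a map of class C^(j+1). *)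
Fixpoint class_C (j : nat) (O : set V) (f : V -> W) : Prop :=
  if j is j'.+1
  then (forall x, O x -> differentiable f x) /\
       (forall w, class_C j' O (fun x => 'D_w f x))
  else forall x, O x -> {for x, continuous f}.

Definition smooth_on (O : set V) (f : V -> W) := forall j, class_C j O f.

Definition smooth_at (x : V) (f : V -> W) :=
  exists2 O : set V, open_nbhs x O & smooth_on O f.

End Smooth.

(* A set of points (a subset of [T]) presented by charts with values in [V]. *)
Record charts (T V : Type) := Charts {
  cidx : Type;
  cdom : cidx -> set T;
  cmap : cidx -> T -> V }.

(* The change of coordinates from chart [a] to chart [b]; it is only meaningful
   on the image of the intersection of the two domains. *)
Definition transition (T : Type) (V : zmodType) (C : charts T V) (a b : cidx C)
    (u : V) : V :=
  xget 0 [set w | exists p,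
    [/\ cdom a p, cdom b p, cmap a p = u & cmap b p = w]].

Record smooth_manifold (R : realType) (n : nat) (E : topologicalType)
    (A : charts E 'rV[R]_n) : Prop := SmoothManifold {
  sm_hausdorff : hausdorff_space E;
  sm_countable : @second_countable E;
  sm_cover : forall p : E, exists a : cidx A, cdom a p;
  sm_dom_open : forall a : cidx A, open (cdom a);
  sm_inj : forall a : cidx A, {in cdom a &, injective (cmap a)};
  sm_continuous : forall (a : cidx A) (p : E), cdom a p ->
    {for p, continuous (cmap a)};
  sm_open_map : forall (a : cidx A) (B : set E), open B -> B `<=` cdom a ->
    open (cmap a @` B);
  sm_transition : forall a b : cidx A,
    smooth_on (cmap a @` (cdom a `&` cdom b)) (transition a b) }.

Section MultiIndex.
Variable m : nat.
Implicit Types I : {ffun 'I_m -> nat}.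

Definition mdeg I : nat := (\sum_i I i)%N.
Definition mfact I : nat := (\prod_i (I i)`!)%N.
Definition madd1 I (i : 'I_m) : {ffun 'I_m -> nat} :=
  [ffun j => (I j + (j == i))%N].

(* The list in which each [i] is repeated [I i] times. *)
Definition mseq I : seq 'I_m := flatten [seq nseq (I i) i | i <- enum 'I_m].

(* The finite type of multi-indices of length at most [k]. *)
Definition mindex (k : nat) :=
  {I : {ffun 'I_m -> 'I_k.+1} | (\sum_i I i <= k)%N}.

Definition mval k (I : mindex k) : {ffun 'I_m -> nat} :=
  [ffun i => nat_of_ord (val I i)].

End MultiIndex.

(* The space of coordinates (u^alpha_I), 0 <= |I| <= k; a tangent vector to the
   bundle of k-jets is also given, in a chart, by an element of this space. *)
Notation jcoords R n m k := 'M[R]_(n, #|{: mindex m k}|).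

Section Coordinates.
Context {R : realType} {n m : nat}.

(* u^alpha_I, for an arbitrary multi-index I; it is 0 if |I| > k. *)
Definition jentry k (u : jcoords R n m k) (al : 'I_n) (I : {ffun 'I_m -> nat})
  : R := \sum_(c : mindex m k | mval c == I) u al (enum_rank c).

(* tau^{k,l} in coordinates, for l <= k; it is linear and therefore also gives
   the action of its differential on tangent vectors. *)
Definition jtrunc k l (u : jcoords R n m k) : jcoords R n m l :=
  \matrix_(al, c) jentry u al (mval (enum_val c)).

(* The map (v^alpha_I) |-> (v^alpha_{I + 1_i}). *)
Definition jshift k (i : 'I_m) (v : jcoords R n m k.+1) : jcoords R n m k :=
  \matrix_(al, c) jentry v al (madd1 (mval (enum_val c)) i).

(* The endomorphism S^i of tangent vectors: its component on d/du^alpha_{I + 1_i}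
   is (I(i) + 1) v^alpha_I, and its components on d/du^alpha_K with K(i) = 0
   vanish. *)
Definition vertS k (i : 'I_m) (v : jcoords R n m k) : jcoords R n m k :=
  \matrix_(al, c)
    \sum_(I : mindex m k | madd1 (mval I) i == mval (enum_val c))
      (mval I i).+1%:R * v al (enum_rank I).

(* d_i f = \sum u^alpha_{I + 1_i} df/du^alpha_I *)
Definition total_deriv_fun k (i : 'I_m) (f : jcoords R n m k -> R)
    (u : jcoords R n m k.+1) : R :=
  \sum_al \sum_(I : mindex m k)
    jentry u al (madd1 (mval I) i)
      * 'D_(delta_mx al (enum_rank I)) f (jtrunc k u).

End Coordinates.

Definition subst_at (r : nat) (V : Type) (v : 'I_r -> V) (l : 'I_r) (w : V)
  : 'I_r -> V := fun j => if j == l then w else v j.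

Section Forms.
Context {R : realType} {V : normedModType R} {T : Type}.
Variables (C : charts T V) (r : nat).

(* A differential r-form given by its local expressions: one r-linear function
   of tangent vectors for each chart and each value of the coordinates.  Only
   the values at coordinates of points of the domain of the chart matter. *)
Definition local_forms := cidx C -> V -> ('I_r -> V) -> R.

Record is_form (w : local_forms) : Prop := IsForm {
  form_linear : forall (a : cidx C) p, cdom a p ->
    forall (v : 'I_r -> V) (l : 'I_r) (x : R) (y z : V),
    w a (cmap a p) (subst_at v l (x *: y + z)) =
    x * w a (cmap a p) (subst_at v l y) + w a (cmap a p) (subst_at v l z);
  form_alternating : forall (a : cidx C) p, cdom a p ->
    forall (v : 'I_r -> V) (j l : 'I_r), j != l -> v j = v l ->
    w a (cmap a p) v = 0;
  form_smooth : forall (a : cidx C) (v : 'I_r -> V),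
    smooth_on (cmap a @` cdom a) (fun u => w a u v);
  form_compat : forall (a b : cidx C) p, cdom a p -> cdom b p ->
    forall v : 'I_r -> V,
    w a (cmap a p) v =
    w b (cmap b p) (fun l => 'd (transition a b) (cmap a p) (v l)) }.

Definition form_eq (w w' : local_forms) :=
  forall (a : cidx C) p (v : 'I_r -> V), cdom a p ->
    w a (cmap a p) v = w' a (cmap a p) v.

End Forms.

Section FrameBundles.
Context {R : realType} {n : nat} {E : topologicalType}.
Variables (A : charts E 'rV[R]_n) (m : nat).

(* gamma is an immersion on a neighbourhood of 0; its values away from 0 are
   irrelevant. *)
Definition immersion_near0 (gamma : 'rV[R]_m -> E) : Prop :=
  \forall t \near (0 : 'rV[R]_m), {for t, continuous gamma} /\
    forall a : cidx A, cdom a (gamma t) ->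
      smooth_at t (cmap a \o gamma) /\
      injective ('d (cmap a \o gamma) t : 'rV[R]_m -> 'rV[R]_n).

Definition partial (I : {ffun 'I_m -> nat}) (f : 'rV[R]_m -> R)
  : 'rV[R]_m -> R :=
  foldr (fun i (g : 'rV[R]_m -> R) t => 'D_('e_i) g t) f (mseq I).

Definition jet_coords (a : cidx A) (k : nat) (gamma : 'rV[R]_m -> E)
  : jcoords R n m k :=
  \matrix_(al, c) partial (mval (enum_val c)) (fun t => cmap a (gamma t) 0 al) 0.

Definition same_jet (k : nat) (gamma delta : 'rV[R]_m -> E) : Prop :=
  gamma 0 = delta 0 /\
  forall a : cidx A, cdom a (gamma 0) ->
    jet_coords a k gamma = jet_coords a k delta.

(* The k-jet at 0 of an immersion, as an equivalence class. *)
Definition jet (k : nat) (gamma : 'rV[R]_m -> E) : set ('rV[R]_m -> E) :=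
  [set delta | immersion_near0 delta /\ same_jet k gamma delta].

(* F^k with the charts (u^alpha_I) induced by the charts of E. *)
Definition frame_bundle (k : nat)
  : charts (set ('rV[R]_m -> E)) (jcoords R n m k) :=
  {| cidx := cidx A;
     cdom := fun a => [set J | exists gamma,
       [/\ immersion_near0 gamma, cdom a (gamma 0) & J = jet k gamma]];
     cmap := fun a J => xget 0 [set u | exists gamma,
       [/\ immersion_near0 gamma, J = jet k gamma
         & u = jet_coords a k gamma]] |}.

Section ScalarForms.
Variable r : nat.

Definition sform (k : nat) := local_forms (frame_bundle k) r.

(* Pull-back by tau^{k,l}, for l <= k. *)
Definition pull k l (w : sform l) : sform k :=
  fun a u v => w a (jtrunc l u) (fun j => jtrunc l (v j)).
Arguments pull k {l} w.

(* The total derivative d_i.  As a derivation with d_i (du^alpha_I) =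
   du^alpha_{I + 1_i}, it differentiates the coefficients of w and replaces in
   turn each factor du^alpha_I by du^alpha_{I + 1_i}, that is, v_l by its
   shift in the l-th argument. *)
Definition total_deriv (i : 'I_m) k (w : sform k) : sform k.+1 :=
  fun a u v =>
    total_deriv_fun i (fun x => w a x (fun j => jtrunc k (v j))) u
    + \sum_(l < r) w a (jtrunc k u)
        (subst_at (fun j => jtrunc k (v j)) l (jshift i (v l))).
Arguments total_deriv i {k} w.

(* S^i extended from 1-forms as a derivation (hence 0 if r = 0). *)
Definition vert (i : 'I_m) k (w : sform k) : sform k :=
  fun a u v => \sum_(l < r) w a u (subst_at v l (vertS i (v l))).
Arguments vert i {k} w.

Fixpoint total_seq (s : seq 'I_m) k (w : sform k) : sform (size s + k) :=
  match s return sform (size s + k) with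
  | [::] => w
  | i :: s' => total_deriv i (@total_seq s' k w)
  end.
Arguments total_seq s {k} w.

Definition total_mi (J : {ffun 'I_m -> nat}) k (w : sform k) :=
  total_seq (mseq J) w.
Arguments total_mi J {k} w.

Definition vert_mi (J : {ffun 'I_m -> nat}) k (w : sform k) : sform k :=
  foldr (fun i w' => vert i w') w (mseq J).
Arguments vert_mi J {k} w.

Definition Pcoef (s : nat) (J : {ffun 'I_m -> nat}) : R :=
  ((-1) ^+ mdeg J * ((m - s)`! * (mdeg J)`!)%:R)
  / (r%:R ^+ (mdeg J).+1 * ((m - s + mdeg J + 1)`! * mfact J)%:R).

Definition Pj (s : nat) (j : 'I_m) k (w : sform k) : sform (r.+1 * k).-1 :=
  fun a u v =>
    \sum_(J : mindex m (r * k).-1 | (mdeg (mval J) < r * k)%N)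
      Pcoef s (mval J)
        * pull _ (total_mi (mval J) (vert_mi (madd1 (mval J) j) w)) a u v.
Arguments Pj s j {k} w.

(* A vector-valued form phi_{i_1...i_s} (x) dt^{i_1} /\ ... /\ dt^{i_s}
   is represented by its coefficients phi, completely skew-symmetric in the
   indices (and therefore unique). *)
Definition vform (s k : nat) := s.-tuple 'I_m -> sform k.

Definition act_tuple s (i : s.-tuple 'I_m) (sg : 'S_s) : s.-tuple 'I_m :=
  [tuple tnth i (sg l) | l < s].

Definition vform_eq s k (Phi Psi : vform s k) :=
  forall i, form_eq (Phi i) (Psi i).

Definition vzero s k : vform s k := fun _ _ _ _ => 0.
Arguments vzero : clear implicits.
Definition vadd s k (Phi Psi : vform s k) : vform s k :=
  fun i a u v => Phi i a u v + Psi i a u v.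
Arguments vadd {s k} Phi Psi.
Definition vsub s k (Phi Psi : vform s k) : vform s k :=
  fun i a u v => Phi i a u v - Psi i a u v.
Arguments vsub {s k} Phi Psi.
Definition vpull s k l (Phi : vform s l) : vform s k :=
  fun i => pull k (Phi i).
Arguments vpull {s} k {l} Phi.

(* Omega^{r,s}_k *)
Definition is_vform s k (Phi : vform s k) : Prop :=
  (forall i, is_form (Phi i)) /\
  (forall i (sg : 'S_s),
     form_eq (Phi (act_tuple i sg)) (fun a u v => (-1) ^+ sg * Phi i a u v)).

(* The skew-symmetric coefficients of phi_{i_1...i_s} (x) dt^{i_1} /\ ... /\
   dt^{i_s}, for an arbitrary family phi. *)
Definition skew_part s k (phi : vform s k) : vform s k :=
  fun i a u v =>
    (s`!%:R)^-1 * \sum_(sg : 'S_s) (-1) ^+ sg * phi (act_tuple i sg) a u v.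
Arguments skew_part {s k} phi.

(* d_T Phi = d_{i_0} phi_{i_1...i_s} (x) dt^{i_0} /\ dt^{i_1} /\ ... *)
Definition dT s k (Phi : vform s k) : vform s.+1 k.+1 :=
  skew_part (fun i : s.+1.-tuple 'I_m =>
    total_deriv (thead i) (Phi [tuple of behead i])).
Arguments dT {s k} Phi.

(* For k = 0 the index (r + 1) k - 1 is truncated to 0, and P Phi = 0. *)
Definition opP s k : vform s k -> vform s.-1 (r.+1 * k).-1 :=
  match s return vform s k -> vform s.-1 (r.+1 * k).-1 with
  | 0 => fun _ => vzero 0%N _
  | s'.+1 => fun Phi i a u v =>
      s'.+1%:R * \sum_(j < m) Pj s'.+1 j (Phi [tuple of j :: i]) a u v
  end.
Arguments opP {s k} Phi.

(* d_T P Phi, as an element of Omega^{r,s}_{(r+1)k}.  It is 0 if s = 0; if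
   s > 0 and k > 0 the pull-back below is the identity, as ((r+1)k-1)+1 =
   (r+1)k; if k = 0 then P Phi = 0 and the result is 0. *)
Definition dTP s k : vform s k -> vform s (r.+1 * k) :=
  match s return vform s k -> vform s (r.+1 * k) with
  | 0 => fun _ => vzero 0%N _
  | s'.+1 => fun Phi => vpull (r.+1 * k) (dT (opP Phi))
  end.
Arguments dTP {s k} Phi.

(* The class of Phi in Omega^{r,s+1}_{k+1} / d_T (Omega^{r,s}_k), and the
   quotient itself. *)
Definition qclass s k (Phi : vform s.+1 k.+1) : set (vform s.+1 k.+1) :=
  [set Psi | is_vform Psi /\
     exists2 Theta : vform s k, is_vform Theta
       & vform_eq (vsub Psi Phi) (dT Theta)].
Arguments qclass {s k} Phi.

Definition dT_quotient s k : set (set (vform s.+1 k.+1)) :=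
  [set qclass Phi | Phi in [set Phi | is_vform Phi]].

End ScalarForms.
End FrameBundles.

Arguments vzero {R n E} A m r s k.
Arguments vpull {R n E A m r s} k {l} Phi.
Arguments pull {R n E A m r} k {l} w.
Arguments dT_quotient {R n E} A m r s k.

(* Main.v *)
Require Import Defs.
From HB Require Import structures.
From mathcomp Require Import all_boot all_order all_fingroup all_algebra.
From mathcomp Require Import all_classical all_reals all_analysis.
From mathcomp Require Import ring lra zify.
Set Implicit Arguments. Unset Strict Implicit. Unset Printing Implicit Defensive.
Import Order.TTheory GRing.Theory Num.Theory.
Import numFieldNormedType.Exports.
Local Open Scope classical_set_scope.
Local Open Scope ring_scope.

(** Everything is evaluated along curves.  Let g be the expression in a chart of
an immersion, defined on an open set O of parameters t, and let xi_1, ..., xi_r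
be vector fields along it, that is, smooth maps from O to R^n.  An r-form w on
the bundle of k-jets has a value [ev w a g xi t] on the k-jet of g at t and on
the tangent vectors given by the k-jets of xi_1, ..., xi_r at t.  As every point
and every tangent vector of the bundle arise in this way, w is determined by
these values ([form_eq_evf]).  They are functions u of (xi, t) in which k has
disappeared:
- pull-backs do not change them ([ev_pull]);
- d_i w gives the partial derivative D_i u in t_i ([ev_total]); this is Leibniz'
  rule for a multilinear function of jets;
- S^i w gives S_i u = sum_l u(.., x_i xi_l, ..) - r t_i u, where x_i multiplies
  a vector field by the i-th coordinate of the parameter ([ev_vert]).
Hence the D_i commute, the S_i commute and, because of the factor t_i,
S_i D_j = D_j S_i + r delta_ij ([SD]).  The same description shows that d_i w and
S^i w are again forms ([form_total], [form_vert]): a change of chart psi replaces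
g by psi o g and xi by dpsi(g) xi, since the differential of the change of
coordinates of the jet bundle maps the k-jet of xi to that of dpsi(g) xi
([frame_transition_push], [ev_change]).

The rest is algebra.  Put p = m - s, Q_n = sum_(|J| = n) (n! / J!) D_J S^J and
b_n(p) = (-1)^n p! / (r^(n+1) (p+n+1)!), so that P^j_(s) = sum_n b_n(p) Q_n S_j
([Popr_multinomial]).  On forms of order k this sum stops, as products of more
than r k of the S_i vanish ([vert_nilpotent]).  The recursion
Q_(n+1) = sum_i D_i Q_n S_i gives Q_n D_i = D_i Q_n + r n D_i Q_(n-1) ([QD]), and
two recurrences for the b_n turn this into
- sum_j P^j_(s+1) D_j = 1 + r s B ([sum_PD]),
- P^j_(s+1) D_i - D_i P^j_(s) = r delta_ij B ([comm_PD]),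
where B = sum_n b_n(p-1) Q_n.  For skew-symmetric coefficients, d_T Phi has the
component of indices i_0, ..., i_s equal to 1/(s+1) times the sum over l of
(-1)^l D_(i_l) Phi_(i_0..i_s without i_l) ([evf_dT]).  So in P d_T Phi the new
index j either is the index of the derivative, which gives the first identity, or
is not; the s terms of the second kind cancel d_T P Phi and, by the second
identity, leave - r B Phi each ([homotopy]). *)

(** * Maps of class C^j *)

Section Calculus.
Context {R : realType}.
Implicit Types U V W : normedModType R.

Lemma open_near_eq V (T : Type) (O : set V) (f g : V -> T) x :
  open O -> O x -> (forall y, O y -> f y = g y) -> \near x, f x = g x.
Proof. by move=> oO Ox fg; near=> y; apply: fg; near: y; exact: open_nbhs_nbhs. Unshelve. all: by end_near. Qed.

Lemma near_eq_differentiable V W (f g : V -> W) x :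
  (\near x, f x = g x) -> differentiable f x -> differentiable g x.
Proof.
move=> fg df.
have E : g \o shift x = cst (g x) + 'd f x +o_ (0 : V) id.
  have gx : g x = f x by rewrite (nbhs_singleton fg).
  apply/eqaddoP => e e0.
  have [_ /eqaddoP/(_ e e0)] := (diff_locallyP x f).1 df.
  have fg0 : \forall y \near (0 : V), f (y + x) = g (y + x).
    by move: fg; rewrite (near_shift 0) subr0.
  by apply: filterS2 fg0 => y /= E; rewrite !fctE /= gx E.
have cd : continuous ('d f x) by exact: diff_continuous.
by apply/diff_locallyP; rewrite (diff_unique cd E).
Qed.

Lemma class_C_diff V W j (O : set V) (f : V -> W) x :
  class_C j.+1 O f -> O x -> differentiable f x.
Proof. by move=> [] + _ => /[apply]. Qed.

Lemma class_CS V W j (O : set V) (f : V -> W) : class_C j.+1 O f <->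
  (forall x, O x -> differentiable f x) /\ (forall w, class_C j O ('D_w f)).
Proof. by []. Qed.

Lemma class_C_eq V W j (O : set V) (f g : V -> W) : open O ->
  (forall x, O x -> f x = g x) -> class_C j O f -> class_C j O g.
Proof.
move=> oO; elim: j f g => [|j IH] f g fg /=.
  move=> cf x Ox; have := cf x Ox; rewrite /prop_for /continuous_at -(fg x Ox) => h.
  by apply: (cvg_trans _ h); apply: near_eq_cvg; apply: open_near_eq oO Ox fg.
move=> [df cf]; split=> [x Ox|w].
  by apply: near_eq_differentiable (df x Ox); exact: open_near_eq oO Ox fg.
apply: IH (cf w) => x Ox; apply: near_eq_derive; exact: open_near_eq oO Ox fg.
Qed.

Lemma class_C_sub V W j (O O' : set V) (f : V -> W) :
  O' `<=` O -> class_C j O f -> class_C j O' f.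
Proof.
move=> sO; elim: j f => [|j IH] f /=; first by move=> cf x /sO; exact: cf.
by move=> [df cf]; split=> [x /sO|w]; [exact: df|exact: IH].
Qed.

Lemma class_C_pred V W j (O : set V) (f : V -> W) :
  class_C j.+1 O f -> class_C j O f.
Proof.
elim: j f => [|j IH] f [df cf].
  by move=> x Ox; exact/differentiable_continuous/df.
by split=> // w; apply: IH.
Qed.

Lemma class_C_cst V W j (O : set V) (c : W) : class_C j O (fun _ => c).
Proof.
elim: j c => [|j IH] c /=; first by move=> x _; exact: cvg_cst.
split=> [x _|w]; first exact: differentiable_cst.
suff -> : (fun x => 'D_w (fun _ : V => c) x) = fun _ => 0 by exact: IH.
by apply/funext => x; exact: derive_cst.
Qed.

Lemma class_C_add V W j (O : set V) (f g : V -> W) : open O ->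
  class_C j O f -> class_C j O g -> class_C j O (fun x => f x + g x).
Proof.
move=> oO; elim: j f g => [|j IH] f g /=.
  by move=> cf cg x Ox; apply: cvgD; [exact: cf|exact: cg].
move=> [df cf] [dg cg]; split=> [x Ox|w].
  by apply: differentiableD; [exact: df|exact: dg].
apply: (@class_C_eq _ _ _ _ (fun x => 'D_w f x + 'D_w g x)) => // [x Ox|].
  by rewrite -deriveD //; apply: diff_derivable; [exact: df|exact: dg].
by apply: IH; [exact: cf|exact: cg].
Qed.

Lemma class_C_lin V W W' j (O : set V) (f : V -> W) (L : {linear W -> W'}) :
  open O -> continuous L -> class_C j O f -> class_C j O (fun x => L (f x)).
Proof.
move=> oO cL; elim: j f => [|j IH] f /=.
  move=> cf x Ox.
  by apply: (@continuous_comp _ _ _ f L); [exact: cf|exact: cL].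
move=> [df cf]; split=> [x Ox|w].
  apply: (@differentiable_comp _ _ _ _ f L); first exact: df.
  exact: linear_differentiable.
apply: (@class_C_eq _ _ _ _ (fun x => L ('D_w f x))) => // [x Ox|]; last first.
  by apply: IH; exact: cf.
have dL y : differentiable L y by exact: linear_differentiable.
have dfx := df x Ox.
rewrite !deriveE //; last exact: (@differentiable_comp _ _ _ _ f L).
by rewrite (@diff_comp _ _ _ _ f L) //= (diff_lin _ cL).
Qed.

Lemma derive_prelin U V W (f : V -> W) (L : {linear U -> V}) (c : V) w x :
  'D_w (fun x => f (L x + c)) x = 'D_(L w) f (L x + c).
Proof.
rewrite /derive; suff -> : (fun h : R => h^-1 *: (((fun x => f (L x + c)) \o shift x) (h *: w) - f (L x + c))) =
  (fun h => h^-1 *: ((f \o shift (L x + c)) (h *: L w) - f (L x + c))) by [].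
by apply/funext => h /=; rewrite linearP addrA.
Qed.

Lemma class_C_preaff U V W j (O : set V) (O' : set U) (f : V -> W)
    (L : {linear U -> V}) (c : V) : continuous L ->
  (forall x, O' x -> O (L x + c)) -> class_C j O f ->
  class_C j O' (fun x => f (L x + c)).
Proof.
move=> cL OO.
have dA x : differentiable (fun x => L x + c) x.
  apply: (@differentiableD _ _ _ L (fun _ => c)); last exact: differentiable_cst.
  exact: linear_differentiable.
elim: j f => [|j IH] f /=.
  move=> cf x Ox; apply: (@continuous_comp _ _ _ (fun x => L x + c) f).
    by apply: differentiable_continuous; exact: dA.
  exact/cf/OO.
move=> [df cf]; split=> [x Ox|w].
  by apply: (@differentiable_comp _ _ _ _ (fun x => L x + c) f) => //; exact/df/OO.
suff -> : (fun x => 'D_w (fun x => f (L x + c)) x) = fun x => 'D_(L w) f (L x + c).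
  exact: (IH _ (cf _)).
by apply/funext => x; exact: derive_prelin.
Qed.

Lemma class_C_mul V j (O : set V) (f g : V -> R) : open O ->
  class_C j O f -> class_C j O g -> class_C j O (fun x => f x * g x).
Proof.
move=> oO; elim: j f g => [|j IH] f g.
  by move=> cf cg x Ox; apply: cvgM; [exact: cf|exact: cg].
move=> cf' cg'; move: (cf') (cg') => /class_CS[df cf] /class_CS[dg cg].
split=> [x Ox|w].
  by apply: differentiableM; [exact: df|exact: dg].
apply: (@class_C_eq _ _ _ _ (fun x => f x * 'D_w g x + g x * 'D_w f x)) => // [x Ox|].
  rewrite (@deriveM _ _ f g x w) //; first exact: diff_derivable (df x Ox).
  exact: diff_derivable (dg x Ox).
by apply: class_C_add => //; apply: IH => //; apply: class_C_pred.
Qed.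

Lemma class_C_sum V W (I : Type) (s : seq I) (P : pred I) j (O : set V) (f : I -> V -> W) :
  open O -> (forall i, P i -> class_C j O (f i)) ->
  class_C j O (fun x => \sum_(i <- s | P i) f i x).
Proof.
move=> oO cf; elim: s => [|a s IH].
  suff -> : (fun x => \sum_(i <- [::] | P i) f i x) = fun _ => 0 by exact: class_C_cst.
  by apply/funext => x; rewrite big_nil.
suff -> : (fun x => \sum_(i <- a :: s | P i) f i x) =
    fun x => (if P a then f a x else 0) + \sum_(i <- s | P i) f i x.
  by apply: class_C_add => //; case Pa : (P a); [exact: cf|exact: class_C_cst].
by apply/funext => x; rewrite big_cons; case: ifP; rewrite ?add0r.
Qed.

Lemma linear_mx_continuous (p q : nat) W (L : {linear 'M[R]_(p, q) -> W}) :
  continuous L.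
Proof.
have -> : (L : _ -> _) = fun M => \sum_i \sum_j M i j *: L (delta_mx i j).
  apply/funext => M; rewrite {1}(matrix_sum_delta M) linear_sum; apply: eq_bigr => i _.
  by rewrite linear_sum; apply: eq_bigr => j _; rewrite linearZ_LR.
move=> M; apply: differentiable_continuous.
suff H : forall (s : seq 'I_p) (s' : seq 'I_q), differentiable
  (fun M : 'M[R]_(p, q) => \sum_(i <- s) \sum_(j <- s') M i j *: L (delta_mx i j)) M by exact: H.
have dsum (I : Type) (s : seq I) (f : I -> 'M[R]_(p, q) -> W) :
    (forall i, differentiable (f i) M) -> differentiable (fun M => \sum_(i <- s) f i M) M.
  move=> df; elim: s => [|a s IH].
    suff -> : (fun M => \sum_(i <- [::]) f i M) = fun _ => 0 by exact: differentiable_cst.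
    by apply/funext => x; rewrite big_nil.
  suff -> : (fun M => \sum_(i <- a :: s) f i M) = f a +  (fun x => \sum_(i <- s) f i x).
    by apply: differentiableD.
  by apply/funext => x; rewrite big_cons.
move=> s s'; apply: (dsum) => i; apply: (dsum) => j.
by apply: differentiableZl; exact: differentiable_coord.
Qed.

Lemma derive_coord V (p q : nat) (f : V -> 'M[R]_(p, q)) x w a b :
  differentiable f x -> 'D_w (fun x => f x a b) x = 'D_w f x a b.
Proof.
by move=> df; rewrite derive_mx ?mxE //; exact: diff_derivable.
Qed.

Lemma class_C_coord V (p q : nat) j (O : set V) (f : V -> 'M[R]_(p, q)) a b :
  open O -> class_C j O f -> class_C j O (fun x => f x a b).
Proof.
move=> oO; elim: j f => [|j IH] f.
  move=> cf x Ox; apply: (@continuous_comp _ _ _ f (fun M : 'M[R]_(p, q) => M a b)).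
    exact: cf.
  exact: coord_continuous.
move=> /class_CS[df cf]; apply/class_CS; split=> [x Ox|w].
  apply: (@differentiable_comp _ _ _ _ f (fun M : 'M[R]_(p, q) => M a b)); first exact: df.
  exact: differentiable_coord.
apply: (@class_C_eq _ _ _ _ (fun x => 'D_w f x a b)) (IH _ (cf w)) => // x Ox.
by rewrite derive_coord //; exact: df.
Qed.

Definition scalel W (c : W) (k : R) := k *: c.

Lemma scalel_is_linear W (c : W) : linear (scalel c).
Proof. by move=> a M N; rewrite /scalel scalerDl scalerA. Qed.

HB.instance Definition _ W (c : W) :=
  GRing.isLinear.Build R R W _ (scalel c) (scalel_is_linear c).

Lemma class_C_mx V (p q : nat) j (O : set V) (f : V -> 'M[R]_(p, q)) :
  open O -> (forall a b, class_C j O (fun x => f x a b)) -> class_C j O f.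
Proof.
move=> oO cf.
rewrite (_ : f = fun x => \sum_a \sum_b f x a b *: delta_mx a b); last first.
  by apply/funext => x; exact: matrix_sum_delta.
apply: class_C_sum => // a _; apply: class_C_sum => // b _.
apply: (@class_C_lin _ _ _ _ _ (fun x => f x a b) (scalel (delta_mx a b))) => //.
exact: scalel_continuous.
Qed.

Lemma derive_dir_sum (p q : nat) W (f : 'M[R]_(p, q) -> W) x (v : 'M[R]_(p, q)) :
  differentiable f x -> 'D_v f x = \sum_a \sum_b v a b *: 'D_(delta_mx a b) f x.
Proof.
move=> df; rewrite deriveE // {1}(matrix_sum_delta v) linear_sum; apply: eq_bigr => a _.
by rewrite linear_sum; apply: eq_bigr => b _; rewrite linearZ_LR /= deriveE.
Qed.

Lemma derive_comp U V W (g : U -> V) (f : V -> W) x w :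
  differentiable g x -> differentiable f (g x) ->
  'D_w (fun x => f (g x)) x = 'D_('D_w g x) f (g x).
Proof.
move=> dg df; rewrite !deriveE //; last exact: (@differentiable_comp _ _ _ _ g f).
by rewrite (@diff_comp _ _ _ _ g f).
Qed.

(** The chain rule is written with partial derivatives of f, so that the
induction only meets sums, products and compositions with the same g. *)
Lemma class_C_comp U (p q : nat) j (O : set U) (O' : set 'M[R]_(p, q))
    (g : U -> 'M[R]_(p, q)) (f : 'M[R]_(p, q) -> R) : open O ->
  (forall x, O x -> O' (g x)) -> class_C j O g -> class_C j O' f ->
  class_C j O (fun x => f (g x)).
Proof.
move=> oO OO; elim: j g f OO => [|j IH] g f OO cg' cf'.
  move=> x Ox; apply: (@continuous_comp _ _ _ g f); first exact: cg'.
  exact/cf'/OO.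
have /class_CS[dg cg] := cg'; have /class_CS[df cf] := cf'; split=> [x Ox|w].
  by apply: (@differentiable_comp _ _ _ _ g f); [exact: dg|exact/df/OO].
apply: (@class_C_eq _ _ _ _ (fun x => \sum_a \sum_b 'D_w g x a b * 'D_(delta_mx a b) f (g x))) => // [x Ox|].
  rewrite (derive_comp _ (dg _ Ox) (df _ (OO _ Ox))).
  by rewrite derive_dir_sum //; exact/df/OO.
apply: class_C_sum => // a _; apply: class_C_sum => // b _.
apply: class_C_mul => //; first by apply: class_C_coord => //; exact: cg.
exact: (IH g _ OO (class_C_pred cg') (cf (delta_mx a b))).
Qed.

Lemma line_MVT V (f : V -> R) (y v : V) (h : R) : 0 < h ->
  (forall s, 0 <= s <= h -> differentiable f (y + s *: v)) ->
  exists2 s, 0 <= s <= h & f (y + h *: v) - f y = h * 'D_v f (y + s *: v).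
Proof.
move=> h0 df; pose A := fun s : R => s *: v + y.
have dA s : is_diff s A (fun k => k *: v).
  have E : (fun k : R => k *: v) + (fun _ => 0) = (fun k => k *: v).
    by apply/funext => k; rewrite fctE addr0.
  rewrite -[X in is_diff _ _ X]E; exact: is_diffD.
have dg s : 0 <= s <= h -> is_derive s 1 (f \o A) ('D_v f (y + s *: v)).
  move=> sh; have dfs := df s sh; rewrite addrC in dfs *.
  have dfA : differentiable (f \o A) s by apply: differentiable_comp.
  apply: DeriveDef; first exact: diff_derivable.
  rewrite deriveE // diff_comp // /= deriveE //; congr ('d _ _ _).
  by have [_ ->] := dA s; rewrite scale1r.
have [s sh E] : exists2 c, c \in `[0, h]%R & (f \o A) h - (f \o A) 0 = 'D_v f (y + c *: v) * (h - 0).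
  apply: MVT_segment (ltW h0) _ _ => [x|].
    by rewrite in_itv /= => /andP[/ltW x0 /ltW xh]; apply: dg; rewrite x0.
  apply: derivable_within_continuous => x; rewrite in_itv /= => xh.
  by have := dg x xh => -[].
exists s; first by move: sh; rewrite in_itv.
by move: E; rewrite /= /A scale0r add0r subr0 (addrC (h *: v)) => ->; rewrite mulrC.
Qed.

Lemma subr4 (a b c d : R) : a - b - (c - d) = a - c - (b - d).
Proof. by rewrite !opprB ![a - _ + _]addrACA (addrC (- b)). Qed.

(** The mean value theorem in the direction v for y |-> f (y + h w) - f y, then
in the direction w for D_v f. *)
Lemma second_MVT V (f : V -> R) (O : set V) (x v w : V) (h : R) : 0 < h ->
  class_C 2 O f ->
  (forall s t, 0 <= s <= h -> 0 <= t <= h -> O (x + s *: v + t *: w)) ->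
  exists s t, [/\ 0 <= s <= h, 0 <= t <= h &
   f (x + h *: v + h *: w) - f (x + h *: v) - (f (x + h *: w) - f x) =
   h * (h * 'D_w ('D_v f) (x + s *: v + t *: w))].
Proof.
move=> h0 /class_CS[df /(_ v)/class_CS[dDf _]] OO.
have hh : 0 <= h <= h by rewrite lexx ltW.
have h00 : 0 <= (0 : R) <= h by rewrite lexx ltW.
have dsh y : O (y + h *: w) -> differentiable (fun y => f (y + h *: w)) y.
  move=> Oy; apply: (@differentiable_comp _ _ _ _ (fun y => y + h *: w) f); last exact: df.
  apply: (@differentiableD _ _ _ idfun (fun _ => h *: w)); last exact: differentiable_cst.
  by have [] := is_diff_id y.
have [|s sh E] := @line_MVT V (fun y => f (y + h *: w) - f y) x v h h0.
  move=> s sh; apply: differentiableB; first by apply: dsh; exact: OO.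
  by apply: df; have := OO s 0 sh h00; rewrite scale0r addr0.
have [|t th E'] := @line_MVT V ('D_v f) (x + s *: v) w h h0.
  by move=> t th; apply: dDf; exact: OO.
exists s, t; split => //.
rewrite -E' E; congr (_ * _).
rewrite (@deriveB _ _ _ (fun y => f (y + h *: w)) f); last 2 first.
- by apply/diff_derivable/dsh; exact: OO.
- by apply/diff_derivable/df; have := OO s 0 sh h00; rewrite scale0r addr0.
by congr (_ - _); exact: (@derive_prelin _ _ _ f idfun).
Qed.

Lemma continuous_eq_near V (A B : V -> R) x :
  {for x, continuous A} -> {for x, continuous B} ->
  (forall d, 0 < d -> exists y y', [/\ ball x d y, ball x d y' & A y = B y']) ->
  A x = B x.
Proof.
move=> /cvgrPdist_lt cA /cvgrPdist_lt cB AB.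
apply/eqP/negPn/negP => neq.
pose e := `|A x - B x| / 2.
have e0 : 0 < e by rewrite /e divr_gt0 // normr_gt0 subr_eq0.
have /nbhs_ballP[d1 /= d10 H1] := cA _ e0.
have /nbhs_ballP[d2 /= d20 H2] := cB _ e0.
have d0 : 0 < Num.min d1 d2 by rewrite lt_min d10.
have m1 : Num.min d1 d2 <= d1 by rewrite ge_min lexx.
have m2 : Num.min d1 d2 <= d2 by rewrite ge_min lexx orbT.
have [y [y' [By By' E]]] := AB _ d0.
have h1 := H1 y (le_ball m1 By).
have h2 := H2 y' (le_ball m2 By').
have : `|A x - B x| < e + e.
  rewrite -(subrKA (A y)); apply: (le_lt_trans (ler_normD _ _)).
  by apply: ltrD => //; rewrite E distrC.
by rewrite -splitr ltxx.
Qed.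

(** By [second_MVT] in both orders, the second difference of f over a small
parallelogram is h^2 times a value of D_w D_v f and h^2 times a value of
D_v D_w f; both functions are continuous. *)
Lemma Schwarz V (f : V -> R) (O : set V) (x v w : V) : open O -> O x ->
  class_C 2 O f -> 'D_w ('D_v f) x = 'D_v ('D_w f) x.
Proof.
move=> oO Ox cf.
have cD u u' : {for x, continuous ('D_u ('D_u' f))}.
  by have /class_CS[_ /(_ u')/class_CS[_ /(_ u)]] := cf; apply.
apply: (@continuous_eq_near _ ('D_w ('D_v f)) ('D_v ('D_w f)) _ (cD _ _) (cD _ _)) => d' d'0.
have /nbhs_ballP[d'' /= d''0 Od] : nbhs x O by exact: open_nbhs_nbhs.
pose d := Num.min d' d''.
have d0 : 0 < d by rewrite lt_min d'0.
have m1 : d <= d' by rewrite ge_min lexx.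
have m2 : d <= d'' by rewrite ge_min lexx orbT.
(* The parallelogram of sides h v and h w at x lies in the ball of radius d. *)
pose h := d / 2 / (`|v| + `|w| + 1).
have M0 : 0 < `|v| + `|w| + 1 by rewrite ltr_wpDl // addr_ge0.
have h0 : 0 < h by rewrite /h !divr_gt0.
have HH a b s t : `|a| + `|b| + 1 = `|v| + `|w| + 1 ->
    0 <= s <= h -> 0 <= t <= h -> ball x d (x + s *: a + t *: b).
  move=> Eab /andP[s0 sh] /andP[t0 th]; rewrite -ball_normE /=.
  rewrite -addrA opprD addrA subrr sub0r normrN.
  apply: (le_lt_trans (ler_normD _ _)); rewrite !normrZ !ger0_norm //.
  apply: (@le_lt_trans _ _ (h * (`|a| + `|b| + 1))).
    rewrite !mulrDr mulr1; apply: ler_wpDr; first exact: ltW.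
    by apply: lerD; apply: ler_wpM2r.
  by rewrite Eab /h divfK ?gt_eqF // ltr_pdivrMr // ltr_pMr // ltr1n.
have HO y : ball x d y -> O y by move=> /(le_ball m2); exact: Od.
have HO' y : ball x d y -> ball x d' y by move=> /(le_ball m1).
have [|s [t [sh th E]]] := @second_MVT V f O x v w h h0 cf.
  by move=> s t sh th; exact: HO (HH v w s t erefl sh th).
have Ewv : `|w| + `|v| + 1 = `|v| + `|w| + 1 by rewrite (addrC `|w|).
have [|s' [t' [sh' th' E']]] := @second_MVT V f O x w v h h0 cf.
  by move=> s' t' sh' th'; exact: HO (HH w v s' t' Ewv sh' th').
exists (x + s *: v + t *: w), (x + s' *: w + t' *: v).
split; [exact: HO' (HH v w s t erefl sh th)|exact: HO' (HH w v s' t' Ewv sh' th')|].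
apply: (mulfI (lt0r_neq0 h0)); apply: (mulfI (lt0r_neq0 h0)).
apply: (etrans (esym E)); apply: etrans E'.
rewrite (addrAC x (h *: w)); exact: subr4.
Qed.

End Calculus.

(** * Smooth maps and partial derivatives *)

Opaque derive diff.

Section SmoothRules.
Context {R : realType}.
Implicit Types U V W : normedModType R.

Lemma smooth_eq V W (O : set V) (f g : V -> W) : open O ->
  (forall x, O x -> f x = g x) -> smooth_on O f -> smooth_on O g.
Proof. by move=> oO fg sf j; exact: (class_C_eq oO fg). Qed.

Lemma smooth_sub V W (O O' : set V) (f : V -> W) :
  O' `<=` O -> smooth_on O f -> smooth_on O' f.
Proof. by move=> sO sf j; exact: (class_C_sub sO). Qed.

Lemma smooth_diff V W (O : set V) (f : V -> W) x :
  smooth_on O f -> O x -> differentiable f x.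
Proof. by move=> sf; exact: (class_C_diff (sf 1%N)). Qed.

Lemma smooth_derive V W (O : set V) (f : V -> W) w :
  smooth_on O f -> smooth_on O ('D_w f).
Proof. by move=> sf j; have [_] := (class_CS j O f).1 (sf j.+1); exact. Qed.

Lemma smooth_cst V W (O : set V) (c : W) : smooth_on O (fun _ => c).
Proof. by move=> j; exact: class_C_cst. Qed.

Lemma smooth_add V W (O : set V) (f g : V -> W) : open O ->
  smooth_on O f -> smooth_on O g -> smooth_on O (fun x => f x + g x).
Proof. by move=> oO sf sg j; exact: class_C_add. Qed.

Lemma smooth_mul V (O : set V) (f g : V -> R) : open O ->
  smooth_on O f -> smooth_on O g -> smooth_on O (fun x => f x * g x).
Proof. by move=> oO sf sg j; exact: class_C_mul. Qed.

Lemma smooth_sum V W (I : Type) (s : seq I) (P : pred I) (O : set V)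
    (f : I -> V -> W) : open O -> (forall i, P i -> smooth_on O (f i)) ->
  smooth_on O (fun x => \sum_(i <- s | P i) f i x).
Proof. by move=> oO sf j; apply: class_C_sum => // i Pi; exact: sf. Qed.

Lemma smooth_coord V (p q : nat) (O : set V) (f : V -> 'M[R]_(p, q)) a b :
  open O -> smooth_on O f -> smooth_on O (fun x => f x a b).
Proof. by move=> oO sf j; exact: class_C_coord. Qed.

Lemma smooth_mx V (p q : nat) (O : set V) (f : V -> 'M[R]_(p, q)) :
  open O -> (forall a b, smooth_on O (fun x => f x a b)) -> smooth_on O f.
Proof. by move=> oO sf j; apply: class_C_mx => // a b; exact: sf. Qed.

Lemma smooth_comp U (p q : nat) (O : set U) (O' : set 'M[R]_(p, q))
    (g : U -> 'M[R]_(p, q)) (f : 'M[R]_(p, q) -> R) : open O ->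
  (forall x, O x -> O' (g x)) -> smooth_on O g -> smooth_on O' f ->
  smooth_on O (fun x => f (g x)).
Proof. by move=> oO OO sg sf j; exact: (@class_C_comp _ _ _ _ _ _ O'). Qed.

Lemma smooth_preaff U V W (O : set V) (O' : set U) (f : V -> W)
    (L : {linear U -> V}) (c : V) : continuous L ->
  (forall x, O' x -> O (L x + c)) -> smooth_on O f ->
  smooth_on O' (fun x => f (L x + c)).
Proof. by move=> cL OO sf j; exact: (class_C_preaff cL OO (sf j)). Qed.

Lemma smooth_prelin U V W (O : set V) (O' : set U) (f : V -> W)
    (L : {linear U -> V}) : continuous L ->
  (forall x, O' x -> O (L x)) -> smooth_on O f -> smooth_on O' (fun x => f (L x)).
Proof.
move=> cL OO sf; have -> : (fun x => f (L x)) = fun x => f (L x + 0).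
  by apply/funext => x; rewrite addr0.
by apply: (smooth_preaff cL _ sf) => x /OO; rewrite addr0.
Qed.

Lemma smooth_id V (O : set V) : smooth_on O (fun x : V => x).
Proof.
move=> [|j]; first by move=> x _; exact: cvg_id.
apply/class_CS; split=> [x _|w]; first by have [] := is_diff_id x.
suff -> : 'D_w (fun x : V => x) = fun _ => w by exact: class_C_cst.
by apply/funext => x; exact: derive_id.
Qed.

Lemma smooth_lin V W (O : set V) (L : {linear V -> W}) : continuous L -> smooth_on O L.
Proof.
by move=> cL; apply: (@smooth_prelin _ _ _ setT O id L) => //; exact: smooth_id.
Qed.

Lemma smooth_prod V (I : Type) (s : seq I) (O : set V) (f : I -> V -> R) :
  open O -> (forall i, smooth_on O (f i)) ->
  smooth_on O (fun x => \prod_(i <- s) f i x).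
Proof.
move=> oO sf; elim: s => [|a s IH].
  suff -> : (fun x => \prod_(i <- [::]) f i x) = fun _ => 1 by exact: smooth_cst.
  by apply/funext => x; rewrite big_nil.
suff -> : (fun x => \prod_(i <- a :: s) f i x) = fun x => f a x * \prod_(i <- s) f i x.
  exact: smooth_mul.
by apply/funext => x; rewrite big_cons.
Qed.

Lemma smooth_Schwarz V (f : V -> R) (O : set V) (x v w : V) : open O -> O x ->
  smooth_on O f -> 'D_w ('D_v f) x = 'D_v ('D_w f) x.
Proof. by move=> oO Ox sf; exact: (Schwarz _ _ oO Ox (sf 2%N)). Qed.

Lemma derive_on_eq V W (O : set V) (f g : V -> W) x w : open O -> O x ->
  (forall y, O y -> f y = g y) -> 'D_w f x = 'D_w g x.
Proof. by move=> oO Ox fg; apply: near_eq_derive; exact: open_near_eq oO Ox fg. Qed.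

Lemma derive_translate V W (f : V -> W) c w x :
  'D_w (fun x => f (x + c)) x = 'D_w f (x + c).
Proof. exact: (@derive_prelin _ _ _ _ f idfun). Qed.

End SmoothRules.

Section PartialDerivatives.
Context {R : realType} {m : nat}.
Implicit Types (f g : 'rV[R]_m -> R) (s : seq 'I_m) (O : set 'rV[R]_m).

Definition pd s f : 'rV[R]_m -> R :=
  foldr (fun i (g : 'rV[R]_m -> R) t => 'D_('e_i) g t) f s.

Lemma partialE (I : {ffun 'I_m -> nat}) f : partial I f = pd (mseq I) f.
Proof. by []. Qed.

Lemma pd_cons i s f : pd (i :: s) f = 'D_('e_i) (pd s f).
Proof. by []. Qed.

Lemma pd_rcons i s f : pd (rcons s i) f = pd s ('D_('e_i) f).
Proof. by rewrite /pd foldr_rcons. Qed.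

Lemma smooth_pd O s f : smooth_on O f -> smooth_on O (pd s f).
Proof. by move=> sf; elim: s => //= i s IH; exact: smooth_derive. Qed.

Lemma pd_eq O s f g t : open O -> O t -> (forall y, O y -> f y = g y) ->
  pd s f t = pd s g t.
Proof.
move=> oO Ot fg; elim: s t Ot => [|i s IH] t Ot /=; first exact: fg.
exact: (derive_on_eq _ oO Ot).
Qed.

Lemma pd_swap O i j s f t : open O -> O t -> smooth_on O f ->
  pd (i :: j :: s) f t = pd (j :: i :: s) f t.
Proof. by move=> oO Ot sf; apply: (smooth_Schwarz _ _ oO Ot); exact: smooth_pd. Qed.

Lemma pd_rem O i s f t : open O -> O t -> smooth_on O f -> i \in s ->
  pd s f t = pd (i :: rem i s) f t.
Proof.
move=> oO Ot sf; elim: s t Ot => [//|j s IH] t Ot; rewrite inE /= [j == i]eq_sym.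
have [<-//|neq] := eqVneq i j; move=> /= ins.
apply: (etrans _ (pd_swap j i (rem i s) oO Ot sf)).
by apply: (derive_on_eq _ oO Ot) => y Oy; exact: IH.
Qed.

Lemma pd_perm O s s' f t : open O -> O t -> smooth_on O f -> perm_eq s s' ->
  pd s f t = pd s' f t.
Proof.
move=> oO Ot sf; elim: s s' t Ot => [|i s IH] s' t Ot pss.
  by have := perm_size pss; case: s' {pss}.
have is' : i \in s' by rewrite -(perm_mem pss) mem_head.
rewrite (pd_rem oO Ot sf is') /=; apply: (derive_on_eq _ oO Ot) => y Oy.
apply: IH => //; rewrite -(perm_cons i); apply: perm_trans pss _.
exact: perm_to_rem.
Qed.

Lemma pd_translate s f c t : pd s (fun t => f (t + c)) t = pd s f (t + c).
Proof.
elim: s t => [|i s IH] t //=.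
rewrite -derive_translate; suff -> : pd s (fun t => f (t + c)) = fun t => pd s f (t + c) by [].
by apply/funext => y; exact: IH.
Qed.

Lemma pd_add O s f g t : open O -> O t -> smooth_on O f -> smooth_on O g ->
  pd s (fun t => f t + g t) t = pd s f t + pd s g t.
Proof.
move=> oO Ot sf sg; elim: s t Ot => [|i s IH] t Ot //=.
rewrite (derive_on_eq _ oO Ot IH) deriveD //.
  by apply/diff_derivable/(smooth_diff _ Ot); exact: smooth_pd.
by apply/diff_derivable/(smooth_diff _ Ot); exact: smooth_pd.
Qed.

Lemma pd_scale O s x f t : open O -> O t -> smooth_on O f ->
  pd s (fun t => x * f t) t = x * pd s f t.
Proof.
move=> oO Ot sf; elim: s t Ot => [|i s IH] t Ot //=.
rewrite (derive_on_eq _ oO Ot IH) (@deriveZ _ _ _ (pd s f)) //.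
by apply/diff_derivable/(smooth_diff _ Ot); exact: smooth_pd.
Qed.

Lemma pd_sum O (I : Type) (l : seq I) s (f : I -> 'rV[R]_m -> R) t :
  open O -> O t -> (forall i, smooth_on O (f i)) ->
  pd s (fun t => \sum_(i <- l) f i t) t = \sum_(i <- l) pd s (f i) t.
Proof.
move=> oO Ot sf; elim: l => [|a l IH].
  rewrite big_nil (@pd_eq O s _ (fun t => 0 * 0) t) //; last first.
    by move=> y _; rewrite big_nil mul0r.
  by rewrite (@pd_scale O s 0 (fun _ => 0)) ?mul0r //; exact: smooth_cst.
rewrite big_cons -IH -(@pd_add O) //; last exact: smooth_sum.
by apply: (@pd_eq O) => // y _; rewrite big_cons.
Qed.

Lemma smooth_coordm O (i : 'I_m) (c : R) : open O ->
  smooth_on O (fun t : 'rV[R]_m => t 0 i - c).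
Proof.
move=> oO; apply: smooth_add => //; last exact: smooth_cst.
by apply: smooth_coord => //; exact: smooth_id.
Qed.

Lemma derive_coordm (i j : 'I_m) (c : R) t :
  'D_('e_j) (fun t : 'rV[R]_m => t 0 i - c) t = (i == j)%:R.
Proof.
have dt : derivable (fun t : 'rV[R]_m => t 0 i) t 'e_j.
  exact/diff_derivable/differentiable_coord.
rewrite (@deriveB _ _ _ (fun t : 'rV[R]_m => t 0 i) (fun _ => c)) //.
rewrite (@derive_cst _ _ _ c) subr0.
rewrite (@derive_coord _ _ _ _ (fun t => t)); last by have [] := is_diff_id t.
by rewrite derive_id !mxE /=.
Qed.

Lemma pd_mulx O s i (c : R) f t : open O -> O t -> smooth_on O f ->
  pd s (fun t : 'rV[R]_m => (t 0 i - c) * f t) t =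
  (t 0 i - c) * pd s f t + (count_mem i s)%:R * pd (rem i s) f t.
Proof.
move=> oO Ot sf; elim: s t Ot => [|j s IH] t Ot; first by rewrite /= mul0r addr0.
rewrite pd_cons (derive_on_eq _ oO Ot IH).
have dpd s' : derivable (pd s' f) t 'e_j.
  by apply/diff_derivable/(smooth_diff _ Ot); exact: smooth_pd.
have dx : derivable (fun t : 'rV[R]_m => t 0 i - c) t 'e_j.
  by apply/diff_derivable/(smooth_diff _ Ot); exact: smooth_coordm.
rewrite (@deriveD _ _ _ (fun t : 'rV[R]_m => (t 0 i - c) * pd s f t)
   (fun t => (count_mem i s)%:R * pd (rem i s) f t)); last 2 first.
- exact: derivableM.
- exact: derivableZ.
rewrite (@deriveM _ _ (fun t : 'rV[R]_m => t 0 i - c) (pd s f)) //.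
rewrite (@deriveZ _ _ _ (pd (rem i s) f)) //.
rewrite derive_coordm -addrA; congr (_ + _) => /=.
rewrite eq_sym; have [->|neq] := eqVneq j i.
  rewrite -[_ *: _]/(_ * _) mulr1 add1n -natr1 mulrDl mul1r addrC; congr (_ + _).
  have [ins|nins] := boolP (i \in s).
    by congr (_ * _); rewrite (pd_rem oO Ot sf ins).
  by rewrite (count_memPn nins) scale0r mul0r.
by rewrite -[_ *: 0%:R]/(_ * 0) mulr0 add0r add0n.
Qed.

(** Contact of order k at t. *)
Definition agree k t f g := forall s, (size s <= k)%N -> pd s f t = pd s g t.

Lemma agree_pred k t f g : agree k.+1 t f g -> agree k t f g.
Proof. by move=> fg s sk; apply: fg; exact: leqW. Qed.

Lemma agree_derive k t f g i :
  agree k.+1 t f g -> agree k t ('D_('e_i) f) ('D_('e_i) g).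
Proof. by move=> fg s sk; rewrite -!pd_rcons fg // size_rcons. Qed.

Lemma agreeS k t f g : f t = g t ->
  (forall i, agree k t ('D_('e_i) f) ('D_('e_i) g)) -> agree k.+1 t f g.
Proof.
move=> fg0 fg s; elim/last_ind: s => [//|s i _].
by rewrite size_rcons ltnS !pd_rcons; exact: fg.
Qed.

Lemma agree_eq O k t f f' g g' : open O -> O t ->
  (forall y, O y -> f y = f' y) -> (forall y, O y -> g y = g' y) ->
  agree k t f g -> agree k t f' g'.
Proof.
by move=> oO Ot ff gg fg s sk; rewrite -(pd_eq s oO Ot ff) -(pd_eq s oO Ot gg) fg.
Qed.

Lemma agree_add O k t f f' g g' : open O -> O t -> smooth_on O f ->
  smooth_on O f' -> smooth_on O g -> smooth_on O g' ->
  agree k t f f' -> agree k t g g' ->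
  agree k t (fun y => f y + g y) (fun y => f' y + g' y).
Proof.
move=> oO Ot sf sf' sg sg' ff gg s sk.
by rewrite !(@pd_add O) // ff // gg.
Qed.

Lemma agree_sum O (I : Type) (l : seq I) k t (f g : I -> 'rV[R]_m -> R) :
  open O -> O t -> (forall i, smooth_on O (f i)) -> (forall i, smooth_on O (g i)) ->
  (forall i, agree k t (f i) (g i)) ->
  agree k t (fun y => \sum_(i <- l) f i y) (fun y => \sum_(i <- l) g i y).
Proof.
move=> oO Ot sf sg fg s sk; rewrite !(@pd_sum O) //.
by apply: eq_bigr => i _; exact: fg.
Qed.

Lemma agree_mul O k t f f' g g' : open O -> O t -> smooth_on O f ->
  smooth_on O f' -> smooth_on O g -> smooth_on O g' ->
  agree k t f f' -> agree k t g g' ->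
  agree k t (fun y => f y * g y) (fun y => f' y * g' y).
Proof.
move=> oO Ot; elim: k f f' g g' => [|k IH] f f' g g' sf sf' sg sg' ff gg.
  move=> [|//] _ /=.
  by have /= -> := ff [::] isT; have /= -> := gg [::] isT.
apply: agreeS => [|i].
  by have /= -> := ff [::] isT; have /= -> := gg [::] isT.
have E (h h' : 'rV[R]_m -> R) : smooth_on O h -> smooth_on O h' -> forall y, O y ->
    h y * 'D_('e_i) h' y + h' y * 'D_('e_i) h y = 'D_('e_i) (fun y => h y * h' y) y.
  move=> sh sh' y Oy; rewrite (@deriveM _ _ h h') //.
    exact/diff_derivable/(smooth_diff sh).
  exact/diff_derivable/(smooth_diff sh').
have sD (h : 'rV[R]_m -> R) : smooth_on O h -> smooth_on O ('D_('e_i) h) by exact: smooth_derive.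
apply: (agree_eq oO Ot (E f g sf sg) (E f' g' sf' sg')).
apply: (agree_add oO Ot); try by apply: smooth_mul => //; exact: sD.
  by apply: IH => //; try exact: sD; [exact: agree_pred|exact: agree_derive].
by apply: IH => //; try exact: sD; [exact: agree_pred|exact: agree_derive].
Qed.

(** The derivatives of h o g are sums of products of derivatives of g and of
partial derivatives of h composed with g, to which the induction hypothesis
applies. *)
Lemma agree_comp O (n : nat) (U : set 'rV[R]_n) k t (h : 'rV[R]_n -> R)
    (g g' : 'rV[R]_m -> 'rV[R]_n) : open O -> O t ->
  smooth_on O g -> smooth_on O g' -> smooth_on U h ->
  (forall y, O y -> U (g y)) -> (forall y, O y -> U (g' y)) ->
  (forall al, agree k t (fun y => g y 0 al) (fun y => g' y 0 al)) ->
  agree k t (fun y => h (g y)) (fun y => h (g' y)).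
Proof.
move=> oO Ot sg sg' + Ug Ug'; elim: k h => [|k IH] h sh gg.
  move=> [|//] _ /=; congr h; apply/rowP => al; exact: (gg al [::]).
apply: agreeS => [|i]; first by congr h; apply/rowP => al; exact: (gg al [::]).
have E (g1 : 'rV[R]_m -> 'rV[R]_n) : smooth_on O g1 -> (forall y, O y -> U (g1 y)) -> forall y, O y ->
    \sum_al 'D_('e_i) (fun y => g1 y 0 al) y * 'D_('e_al) h (g1 y) =
    'D_('e_i) (fun y => h (g1 y)) y.
  move=> sg1 Ug1 y Oy; have dg1 := smooth_diff sg1 Oy.
  have dh := smooth_diff sh (Ug1 y Oy).
  rewrite (derive_comp _ dg1 dh) (derive_dir_sum _ dh) big_ord1.
  by apply: eq_bigr => al _; rewrite derive_coord.
apply: (agree_eq oO Ot (E g sg Ug) (E g' sg' Ug')).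
have sD (g1 : 'rV[R]_m -> 'rV[R]_n) al : smooth_on O g1 -> smooth_on O ('D_('e_i) (fun y => g1 y 0 al)).
  by move=> sg1; apply: smooth_derive; exact: smooth_coord.
have sC (g1 : 'rV[R]_m -> 'rV[R]_n) al : smooth_on O g1 -> (forall y, O y -> U (g1 y)) -> smooth_on O (fun y => 'D_('e_al) h (g1 y)).
  move=> sg1 Ug1; apply: (@smooth_comp _ _ _ _ _ U g1 ('D_('e_al) h)) => //.
  exact: smooth_derive.
apply: (agree_sum _ oO Ot) => al.
- by apply: smooth_mul => //; [exact: sD|exact: sC].
- by apply: smooth_mul => //; [exact: sD|exact: sC].
apply: (agree_mul oO Ot); [exact: sD|exact: sD|exact: sC|exact: sC| |].
  by apply: agree_derive; exact: gg.
apply: (IH ('D_('e_al) h)); first exact: smooth_derive.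
by move=> al'; apply: agree_pred; exact: gg.
Qed.

(** The monomial t^I, for a list in which each i occurs I(i) times. *)
Definition monomial s (t : 'rV[R]_m) : R := \prod_(i <- s) t 0 i.

(** This is I! for the list of a multi-index I. *)
Fixpoint monomial_coef s : R :=
  if s is i :: s' then (count_mem i s').+1%:R * monomial_coef s' else 1.

Lemma monomial_coef_neq0 s : monomial_coef s != 0.
Proof. by elim: s => [|i s IH] /=; rewrite ?oner_neq0 // mulf_neq0 // pnatr_eq0. Qed.

Lemma smooth_monomial O s : open O -> smooth_on O (monomial s).
Proof.
move=> oO; apply: smooth_prod => // i.
by apply: smooth_coord => //; exact: smooth_id.
Qed.

Lemma pd_monomial s s' : pd s (monomial s') 0 = (perm_eq s s')%:R * monomial_coef s'.
Proof.
elim: s' s => [|i s' IH] s.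
  rewrite mulr1; case: s => [|j s]; first by rewrite /= /monomial big_nil.
  have -> : perm_eq (j :: s) [::] = false by apply/negbTE/negP => /perm_size.
  have E t : pd s (monomial [::]) t = \prod_(i <- s) 0.
    elim: s t => [|i s IHs] t; first by rewrite /= /monomial !big_nil.
    rewrite big_cons mul0r /=.
    suff -> : pd s (monomial [::]) = fun _ => \prod_(i <- s) 0 by exact: derive_cst.
    exact/funext.
  rewrite /=; suff -> : pd s (monomial [::]) = fun _ => \prod_(i <- s) 0 by exact: derive_cst.
  exact/funext.
have -> : pd s (monomial (i :: s')) 0 = pd s (fun t : 'rV[R]_m => (t 0 i - 0) * monomial s' t) 0.
  by apply: (@pd_eq setT) => //; [exact: openT|move=> y _; rewrite /monomial big_cons subr0].
rewrite (@pd_mulx setT); [|exact: openT|by []|by apply: smooth_monomial; exact: openT].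
rewrite mxE subrr mul0r add0r IH /=.
have [ins|nins] := boolP (i \in s); last first.
  rewrite (count_memPn nins) mul0r.
  case/boolP: (perm_eq s (i :: s')) => [/perm_mem/(_ i)|_]; last by rewrite mul0r.
  by rewrite mem_head (negbTE nins).
have -> : perm_eq s (i :: s') = perm_eq (rem i s) s'.
  by rewrite (permPl (perm_to_rem ins)) perm_cons.
case/boolP: (perm_eq (rem i s) s') => p; last by rewrite !mul0r mulr0.
rewrite !mul1r (seq.permP (perm_to_rem ins)) /= eqxx add1n; congr (_%:R * _).
by rewrite (seq.permP p).
Qed.

End PartialDerivatives.

(** * Multi-indices and jets of maps into R^n *)

Section MultiIndexLemmas.
Variable m : nat.
Implicit Types I J : {ffun 'I_m -> nat}.

Lemma count_mseq I i : count_mem i (mseq I) = I i.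
Proof.
rewrite /mseq count_flatten sumnE big_map.
rewrite big_map big_enum /= (bigD1 i) //= big1 ?addn0 => [|j ji].
  by rewrite count_nseq /= eqxx mul1n.
by rewrite count_nseq /= (negbTE ji).
Qed.

Lemma size_mseq I : size (mseq I) = mdeg I.
Proof.
rewrite /mseq size_flatten /shape -map_comp sumnE big_map big_enum /=.
by apply: eq_bigr => i _; rewrite size_nseq.
Qed.

Lemma perm_count (s s' : seq 'I_m) :
  (forall i, count_mem i s = count_mem i s') -> perm_eq s s'.
Proof. by move=> E; apply/allP => i _ /=; rewrite E. Qed.

Lemma perm_mseq (s : seq 'I_m) I :
  (forall i, count_mem i s = I i) -> perm_eq s (mseq I).
Proof. by move=> E; apply: perm_count => i; rewrite E count_mseq. Qed.

Lemma mseq_inj I J : perm_eq (mseq I) (mseq J) = (I == J).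
Proof.
apply/idP/eqP => [/seq.permP pIJ|-> //].
by apply/ffunP => i; rewrite -!count_mseq.
Qed.

Lemma mseq_madd1 I i : perm_eq (mseq (madd1 I i)) (i :: mseq I).
Proof.
apply: perm_count => j; rewrite count_mseq ffunE /= count_mseq addnC.
by rewrite eq_sym.
Qed.

Lemma mdeg_madd1 I i : mdeg (madd1 I i) = (mdeg I).+1.
Proof. by rewrite -!size_mseq (perm_size (mseq_madd1 I i)). Qed.

Lemma madd1_inj i : injective (fun I => madd1 I i).
Proof.
move=> I J /ffunP E; apply/ffunP => j.
by have := E j; rewrite !ffunE => /addIn.
Qed.

Lemma mval_inj k : injective (@mval m k).
Proof.
move=> I J /ffunP E; apply/val_inj/ffunP => i; apply/val_inj => /=.
by have := E i; rewrite !ffunE.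
Qed.

Lemma mdeg_mval k (c : mindex m k) : (mdeg (mval c) <= k)%N.
Proof.
have := valP c; rewrite /mdeg; congr (_ <= _)%N.
by apply: eq_bigr => i _; rewrite ffunE.
Qed.

Lemma mval_onto k I : (mdeg I <= k)%N -> exists c : mindex m k, mval c = I.
Proof.
move=> Ik; have Ii i : (I i < k.+1)%N.
  by rewrite ltnS; apply: leq_trans Ik; rewrite /mdeg (bigD1 i) //= leq_addr.
have H : (\sum_i [ffun i => Ordinal (Ii i)] i <= k)%N.
  by rewrite (eq_bigr I) // => i _; rewrite ffunE.
exists (exist _ [ffun i => Ordinal (Ii i)] H : mindex m k).
by apply/ffunP => i; rewrite !ffunE.
Qed.

End MultiIndexLemmas.

Section Jets.
Context {R : realType} {n m : nat}.
Implicit Types (f g xi : 'rV[R]_m -> 'rV[R]_n) (O : set 'rV[R]_m).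

Lemma jentryE k (u : jcoords R n m k) al (c : mindex m k) :
  jentry u al (mval c) = u al (enum_rank c).
Proof.
rewrite /jentry (big_pred1 c) // => c' /=.
by rewrite (inj_eq (@mval_inj _ _)).
Qed.

Lemma jentry_large k (u : jcoords R n m k) al I : (k < mdeg I)%N -> jentry u al I = 0.
Proof.
move=> kI; rewrite /jentry big1 // => c /eqP cI.
by move: kI; rewrite -cI ltnNge mdeg_mval.
Qed.

Lemma jentry_linear k al I x (u v : jcoords R n m k) :
  jentry (x *: u + v) al I = x * jentry u al I + jentry v al I.
Proof.
rewrite /jentry mulr_sumr -big_split /=; apply: eq_bigr => c _.
by rewrite !mxE.
Qed.

Lemma jcoordsP k (u v : jcoords R n m k) :
  (forall al I, (mdeg I <= k)%N -> jentry u al I = jentry v al I) -> u = v.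
Proof.
move=> E; apply/matrixP => al c.
by have := E al (mval (enum_val c)) (mdeg_mval _); rewrite !jentryE enum_valK.
Qed.

Lemma jentry_mx k (F : 'I_n -> {ffun 'I_m -> nat} -> R) al I : (mdeg I <= k)%N ->
  jentry (\matrix_(al, c) F al (mval (enum_val c)) : jcoords R n m k) al I = F al I.
Proof.
by move=> /(@mval_onto _ _ _)[c <-]; rewrite jentryE mxE enum_rankK.
Qed.

Lemma jentry_trunc k l (u : jcoords R n m k) al I : (mdeg I <= l)%N ->
  jentry (jtrunc l u) al I = jentry u al I.
Proof. exact: jentry_mx. Qed.

Lemma jentry_vertS_add k i (u : jcoords R n m k) al I : (mdeg I < k)%N ->
  jentry (vertS i u) al (madd1 I i) = (I i).+1%:R * jentry u al I.
Proof.
move=> Ik.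
have -> : jentry (vertS i u) al (madd1 I i) =
    \sum_(J : mindex m k | madd1 (mval J) i == madd1 I i)
      (mval J i).+1%:R * u al (enum_rank J).
  by apply: (jentry_mx (fun al K => \sum_(J : mindex m k | madd1 (mval J) i == K)
      (mval J i).+1%:R * u al (enum_rank J))); rewrite mdeg_madd1.
have [c cI] := mval_onto (ltnW Ik); rewrite -cI (big_pred1 c) ?jentryE // => c' /=.
by rewrite (inj_eq (@madd1_inj _ _)) (inj_eq (@mval_inj _ _)).
Qed.

Lemma jentry_vertS0 k i (u : jcoords R n m k) al I : (mdeg I <= k)%N -> I i = 0%N ->
  jentry (vertS i u) al I = 0.
Proof.
move=> Ik Ii.
have -> : jentry (vertS i u) al I =
    \sum_(J : mindex m k | madd1 (mval J) i == I)
      (mval J i).+1%:R * u al (enum_rank J).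
  exact: (jentry_mx (fun al K => \sum_(J : mindex m k | madd1 (mval J) i == K)
      (mval J i).+1%:R * u al (enum_rank J))).
rewrite big1 // => c /eqP /ffunP /(_ i); rewrite !ffunE eqxx Ii addn1.
by [].
Qed.

Lemma jtrunc_linear k l x (u v : jcoords R n m k) :
  jtrunc l (x *: u + v) = x *: jtrunc l u + jtrunc l v.
Proof. by apply/matrixP => al c; rewrite !mxE jentry_linear. Qed.

Lemma vertS_linear k i x (u v : jcoords R n m k) :
  vertS i (x *: u + v) = x *: vertS i u + vertS i v.
Proof.
apply/matrixP => al c; rewrite !mxE mulr_sumr -big_split /=; apply: eq_bigr => I _.
by rewrite !mxE mulrDr mulrCA.
Qed.

(** The k-jet of f at t, for maps between numerical spaces.  It serves both for
points of the jet bundle and for tangent vectors to it. *)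
Definition Jk k f t : jcoords R n m k :=
  \matrix_(al, c) partial (mval (enum_val c)) (fun t => f t 0 al) t.

Lemma jentry_Jk k f t al I : (mdeg I <= k)%N ->
  jentry (Jk k f t) al I = pd (mseq I) (fun t => f t 0 al) t.
Proof. exact: (jentry_mx (fun al I => partial I (fun t => f t 0 al) t)). Qed.

Lemma JkP k f g t : Jk k f t = Jk k g t <->
  forall al I, (mdeg I <= k)%N ->
    pd (mseq I) (fun t => f t 0 al) t = pd (mseq I) (fun t => g t 0 al) t.
Proof.
split=> [E al I Ik|E]; first by rewrite -(jentry_Jk f t al Ik) -(jentry_Jk g t al Ik) E.
by apply: jcoordsP => al I Ik; rewrite !jentry_Jk // E.
Qed.

Lemma Jk_agree O k f g t : open O -> O t -> smooth_on O f -> smooth_on O g ->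
  Jk k f t = Jk k g t <->
  forall al, agree k t (fun t => f t 0 al) (fun t => g t 0 al).
Proof.
move=> oO Ot sf sg; split=> [/JkP E al s sk|E]; last first.
  by apply/JkP => al I Ik; apply: E; rewrite size_mseq.
pose I := [ffun i => count_mem i s].
have pI : perm_eq s (mseq I) by apply: perm_mseq => i; rewrite ffunE.
rewrite !(pd_perm oO Ot _ pI); try exact: smooth_coord.
by apply: E; rewrite -size_mseq -(perm_size pI).
Qed.

Lemma Jk_eq O k f g t : open O -> O t -> (forall y, O y -> f y = g y) ->
  Jk k f t = Jk k g t.
Proof.
by move=> oO Ot fg; apply/JkP => al I _; apply: (pd_eq _ oO Ot) => y /fg ->.
Qed.

Lemma Jk_translate k f c t : Jk k (fun t => f (t + c)) t = Jk k f (t + c).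
Proof. by apply/matrixP => al I; rewrite !mxE !partialE (pd_translate _ (fun t => f t 0 al)). Qed.

Lemma jtrunc_Jk k l f t : (l <= k)%N -> jtrunc l (Jk k f t) = Jk l f t.
Proof.
move=> lk; apply: jcoordsP => al I Il.
by rewrite jentry_trunc // !jentry_Jk //; exact: leq_trans Il lk.
Qed.

Lemma Jk_linear O k x f g t : open O -> O t -> smooth_on O f -> smooth_on O g ->
  Jk k (fun t => x *: f t + g t) t = x *: Jk k f t + Jk k g t.
Proof.
move=> oO Ot sf sg; apply: jcoordsP => al I Ik.
have sc h := @smooth_coord _ _ _ _ O h 0 al oO.
rewrite jentry_linear !jentry_Jk // -(@pd_scale _ _ O) ?sc //; last exact: sc.
rewrite -(@pd_add _ _ O) //; [|by apply: smooth_mul => //; [exact: smooth_cst|exact: sc]|exact: sc].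
by apply: (@pd_eq _ _ O) => // y _; rewrite !mxE.
Qed.

Lemma smooth_scalem O (k : 'rV[R]_m -> R) f : open O -> smooth_on O k ->
  smooth_on O f -> smooth_on O (fun t => k t *: f t).
Proof.
move=> oO sk sf; apply: smooth_mx => // a b.
apply: (@smooth_eq _ _ _ _ (fun t => k t * f t a b)) => // [x _|].
  by rewrite mxE.
by apply: smooth_mul => //; exact: smooth_coord.
Qed.

(** At t, the derivative of index I of (y_i - t_i) f is I(i) times the derivative
of index I - 1_i of f: in k-jets at t, multiplication by y_i - t_i is S^i. *)
Lemma vertS_Jk O k i f t : open O -> O t -> smooth_on O f ->
  vertS i (Jk k f t) = Jk k (fun y : 'rV[R]_m => (y 0 i - t 0 i) *: f y) t.
Proof.
move=> oO Ot sf; apply: jcoordsP => al I Ik.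
have sc := @smooth_coord _ _ _ _ O f 0 al oO sf.
rewrite jentry_Jk //.
rewrite (@pd_eq _ _ O _ _ (fun y : 'rV[R]_m => (y 0 i - t 0 i) * f y 0 al)) //; last first.
  by move=> y _; rewrite mxE.
rewrite (pd_mulx _ _ _ oO Ot sc) subrr mul0r add0r count_mseq.
have [I0|I0] := posnP (I i).
  by rewrite I0 mul0r jentry_vertS0.
pose J : {ffun 'I_m -> nat} := [ffun j => (I j - (j == i))%N].
have EI : I = madd1 J i.
  apply/ffunP => j; rewrite !ffunE subnK //.
  by case: eqP => [->|].
have Jk' : (mdeg J < k)%N by rewrite -(mdeg_madd1 J i) -EI.
rewrite {1}EI jentry_vertS_add // jentry_Jk; last exact: ltnW.
have -> : (J i).+1 = I i by rewrite ffunE eqxx subn1 prednK.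
congr (_ * _); apply: (pd_perm oO Ot sc); rewrite -(perm_cons i).
have iI : i \in mseq I by rewrite -has_pred1 has_count count_mseq.
rewrite -(permPr (perm_to_rem iI)) EI perm_sym.
exact: mseq_madd1.
Qed.

Lemma smooth_Jk O k f : open O -> smooth_on O f -> smooth_on O (Jk k f).
Proof.
move=> oO sf; apply: smooth_mx => // al c.
apply: (@smooth_eq _ _ _ _ (pd (mseq (mval (enum_val c))) (fun t => f t 0 al))) => //.
  by move=> x _; rewrite mxE.
by apply: smooth_pd; exact: smooth_coord.
Qed.

Lemma derive_Jk O k i f t : open O -> O t -> smooth_on O f ->
  'D_('e_i) (Jk k f) t = jshift i (Jk k.+1 f t).
Proof.
move=> oO Ot sf; apply/matrixP => al c.
have sc := @smooth_coord _ _ _ _ O f 0 al oO sf.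
rewrite -derive_coord; last exact: (smooth_diff (smooth_Jk k oO sf) Ot).
rewrite mxE jentry_Jk; last by rewrite mdeg_madd1 ltnS mdeg_mval.
rewrite (pd_perm oO Ot sc (mseq_madd1 _ _)) pd_cons.
by apply: (derive_on_eq _ oO Ot) => y Oy; rewrite mxE.
Qed.

(** The polynomial map with prescribed derivatives at 0. *)
Definition jet_poly k (v : jcoords R n m k) (t : 'rV[R]_m) : 'rV[R]_n :=
  \row_al \sum_(c : mindex m k)
    v al (enum_rank c) * ((@monomial_coef R m (mseq (mval c)))^-1 * monomial (mseq (mval c)) t).

Lemma smooth_jet_poly O k (v : jcoords R n m k) : open O -> smooth_on O (jet_poly v).
Proof.
move=> oO; apply: smooth_mx => // a al.
apply: (@smooth_eq _ _ _ _ (fun t => \sum_(c : mindex m k)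
    v al (enum_rank c) * ((@monomial_coef R m (mseq (mval c)))^-1 * monomial (mseq (mval c)) t))) => //.
  by move=> x _; rewrite mxE.
apply: smooth_sum => // c _; apply: smooth_mul => //; first exact: smooth_cst.
by apply: smooth_mul => //; [exact: smooth_cst|exact: smooth_monomial].
Qed.

Lemma Jk_jet_poly k (v : jcoords R n m k) : Jk k (jet_poly v) 0 = v.
Proof.
apply: jcoordsP => al I Ik; rewrite jentry_Jk //.
have oT : open (setT : set 'rV[R]_m) by exact: openT.
have sm c : smooth_on setT (fun t => (@monomial_coef R m (mseq (mval c)))^-1 * monomial (mseq (@mval m k c)) t).
  by apply: smooth_mul => //; [exact: smooth_cst|exact: smooth_monomial].
rewrite (@pd_eq _ _ setT _ _ (fun t => \sum_(c : mindex m k)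
    v al (enum_rank c) * ((@monomial_coef R m (mseq (mval c)))^-1 * monomial (mseq (mval c)) t))) //; last first.
  by move=> y _; rewrite mxE.
rewrite (@pd_sum _ _ setT) //; last first.
  by move=> c; apply: smooth_mul => //; exact: smooth_cst.
have [c cI] := mval_onto Ik; rewrite -cI jentryE (bigD1 c) //= big1 ?addr0 => [|c' c'c].
  rewrite (@pd_scale _ _ setT) // (@pd_scale _ _ setT) //; last exact: smooth_monomial.
  by rewrite pd_monomial perm_refl mul1r mulVf ?mulr1 // monomial_coef_neq0.
rewrite (@pd_scale _ _ setT) // (@pd_scale _ _ setT) //; last exact: smooth_monomial.
by rewrite pd_monomial mseq_inj (inj_eq (@mval_inj _ _)) eq_sym (negbTE c'c) mul0r !mulr0.
Qed.

Lemma jet_poly_linear k x (u v : jcoords R n m k) t :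
  jet_poly (x *: u + v) t = x *: jet_poly u t + jet_poly v t.
Proof.
apply/rowP => al; rewrite !mxE mulr_sumr -big_split /=; apply: eq_bigr => c _.
by rewrite !mxE mulrDl mulrA.
Qed.

End Jets.

(** * Products and immersions into a manifold *)

Section Products.
Context {R : realType}.
Implicit Types U V W : normedModType R.

Definition pairl U V (u : U) : U * V := (u, 0).
Definition pairr U V (v : V) : U * V := (0, v).

Lemma pairl_is_linear U V : linear (@pairl U V).
Proof. by move=> a x y; rewrite /pairl; congr pair; rewrite /= scaler0 addr0. Qed.
Lemma pairr_is_linear U V : linear (@pairr U V).
Proof. by move=> a x y; rewrite /pairr; congr pair; rewrite /= scaler0 addr0. Qed.

HB.instance Definition _ U V :=
  GRing.isLinear.Build R U (U * V)%type _ (@pairl U V) (@pairl_is_linear U V).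
HB.instance Definition _ U V :=
  GRing.isLinear.Build R V (U * V)%type _ (@pairr U V) (@pairr_is_linear U V).

Lemma pairl_continuous U V : continuous (@pairl U V).
Proof. by move=> x; apply: cvg_pair; [exact: cvg_id|exact: cvg_cst]. Qed.
Lemma pairr_continuous U V : continuous (@pairr U V).
Proof. by move=> x; apply: cvg_pair; [exact: cvg_cst|exact: cvg_id]. Qed.

Lemma fst_continuous U V : continuous (@fst U V).
Proof. by move=> x; exact: cvg_fst. Qed.
Lemma snd_continuous U V : continuous (@snd U V).
Proof. by move=> x; exact: cvg_snd. Qed.

Lemma shift_continuous V (c : V) : continuous (fun x : V => x + c).
Proof.
move=> x; apply: differentiable_continuous.
apply: (@differentiableD _ _ _ idfun (fun _ => c)); last exact: differentiable_cst.
by have [] := is_diff_id x.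
Qed.

Lemma open_prod U V (A : set U) (B : set V) : open A -> open B ->
  open [set x : U * V | A x.1 /\ B x.2].
Proof.
move=> oA oB; apply: (@openI _ [set x : U * V | A x.1] [set x : U * V | B x.2]).
  by apply: (@open_comp _ _ (@fst U V)) => // x _; exact: fst_continuous.
by apply: (@open_comp _ _ (@snd U V)) => // x _; exact: snd_continuous.
Qed.

Lemma open_prod_sub U V (O : set (U * V)) u v : open O -> O (u, v) ->
  exists A B, [/\ open A, A u, open B, B v & forall x y, A x -> B y -> O (x, y)].
Proof.
move=> oO Ouv; have : nbhs (u, v) O by exact: open_nbhs_nbhs.
move=> [[A B] /= [nA nB] AB]; exists A°, B°; split.
- exact: open_interior.
- exact: nA.
- exact: open_interior.
- exact: nB.
- move=> x y /interior_subset Ax /interior_subset By.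
  exact: (AB (x, y)).
Qed.

Lemma derive_slicel U V W (H : U * V -> W) w u v :
  'D_w (fun u => H (u, v)) u = 'D_(pairl V w) H (u, v).
Proof.
have E (x : U) : (x, v) = pairl V x + (0, v) by rewrite /pairl; congr pair; rewrite /= ?addr0 ?add0r.
have -> : (fun u => H (u, v)) = (fun u => H (pairl V u + (0, v))).
  by apply/funext => x; rewrite -E.
by rewrite (@derive_prelin _ _ _ _ H (@pairl U V)) -E.
Qed.

Lemma derive_slicer U V W (H : U * V -> W) w u v :
  'D_w (fun v => H (u, v)) v = 'D_(pairr U w) H (u, v).
Proof.
have E (x : V) : (u, x) = pairr U x + (u, 0) by rewrite /pairr; congr pair; rewrite /= ?addr0 ?add0r.
have -> : (fun v => H (u, v)) = (fun v => H (pairr U v + (u, 0))).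
  by apply/funext => x; rewrite -E.
by rewrite (@derive_prelin _ _ _ _ H (@pairr U V)) -E.
Qed.

End Products.

Section ManifoldCurves.
Context {R : realType} {n : nat} {E : topologicalType}.
Variables (A : charts E 'rV[R]_n) (hA : smooth_manifold A).
Implicit Types (a b : cidx A) (p : E).

Lemma chart_open a : open (cmap a @` cdom a).
Proof. by apply: (sm_open_map hA) => //; exact: sm_dom_open. Qed.

Lemma overlap_open a b : open (cmap a @` (cdom a `&` cdom b)).
Proof.
apply: (sm_open_map hA); last by move=> x [].
by apply: openI; exact: sm_dom_open.
Qed.

Lemma chart_inj a p q : cdom a p -> cdom a q -> cmap a p = cmap a q -> p = q.
Proof. by move=> ap aq; apply: (sm_inj hA); rewrite inE. Qed.

Lemma transition_chart a b p : cdom a p -> cdom b p ->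
  transition a b (cmap a p) = cmap b p.
Proof.
move=> ap bp; rewrite /transition; apply: xget_unique; first by exists p.
move=> y [q [aq bq E1 <-]]; by rewrite (chart_inj aq ap E1).
Qed.

Variable m : nat.
Implicit Types (gamma : 'rV[R]_m -> E) (t : 'rV[R]_m).

Definition immersion_at gamma t := {for t, continuous gamma} /\
  forall a, cdom a (gamma t) -> smooth_at t (cmap a \o gamma) /\
    injective ('d (cmap a \o gamma) t : 'rV[R]_m -> 'rV[R]_n).

Lemma smooth_at_diff (V W : normedModType R) (f : V -> W) x :
  smooth_at x f -> differentiable f x.
Proof. by move=> [ O [oO Ox] sf]; exact: smooth_diff sf Ox. Qed.

Lemma inj_diffP (V W : normedModType R) (f : V -> W) x : differentiable f x ->
  injective ('d f x : V -> W) <-> forall v, 'D_v f x = 0 -> v = 0.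
Proof.
move=> df; split=> [inj v|D0 v w E1].
  by rewrite deriveE // => E1; apply: inj; rewrite E1 linear0.
apply/eqP; rewrite -subr_eq0; apply/eqP; apply: D0.
by rewrite deriveE // linearB /= E1 subrr.
Qed.

Lemma immersion_at_translate gamma c t :
  immersion_at gamma (t + c) -> immersion_at (fun s => gamma (s + c)) t.
Proof.
move=> [cg ag]; have cs := @shift_continuous R _ c.
split.
  by apply: (@continuous_comp _ _ _ (fun s : 'rV[R]_m => s + c) gamma); [exact: cs|exact: cg].
move=> a /ag[[ O [oO Oc] sO] inj].
have sa : smooth_at t (cmap a \o (fun s => gamma (s + c))).
  exists ((fun s : 'rV[R]_m => s + c) @^-1` O).
    by split=> //; apply: open_comp => // x _; exact: cs.
  by apply: (@smooth_preaff _ _ _ _ O _ (cmap a \o gamma) idfun c) => // x; exact: cvg_id.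
have D0 := (inj_diffP (smooth_diff sO Oc)).1 inj.
split; first exact: sa.
apply/(inj_diffP (smooth_at_diff sa)) => v.
by rewrite (@derive_translate _ _ _ (cmap a \o gamma)) => /D0.
Qed.

Lemma near_open (T : topologicalType) (P : T -> Prop) x :
  (\near x, P x) -> exists O, [/\ open O, O x & forall y, O y -> P y].
Proof.
move=> nP; exists P°; split; [exact: open_interior|exact: nP|].
by move=> y; exact: interior_subset.
Qed.

Lemma immersion_local gamma a : immersion_near0 A gamma -> cdom a (gamma 0) ->
  exists O, [/\ open O, O 0, smooth_on O (cmap a \o gamma) &
    forall t, O t -> [/\ cdom a (gamma t), immersion_at gamma t &
      immersion_near0 A (fun s => gamma (s + t))]].
Proof.
move=> /near_open[ O1 [oO1 O10 H1]] a0.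
have [cg /(_ a a0) [[ O2 [oO2 O20] s2] _]] := H1 0 O10.
have : nbhs (0 : 'rV[R]_m) (gamma @^-1` cdom a).
  by apply: cg; apply: open_nbhs_nbhs; split=> //; exact: sm_dom_open.
move=> /near_open[ O4 [oO4 O40 H4]].
exists (O1 `&` O2 `&` O4); split.
- by apply: openI => //; exact: openI.
- by [].
- by apply: smooth_sub s2 => x [[]].
move=> t [[ O1t O2t] O4t]; split; [exact: H4|exact: H1|].
have oP : open [set s : 'rV[R]_m | O1 (s + t)].
  by apply: (@open_comp _ _ (fun s : 'rV[R]_m => s + t)) => // x _; exact: shift_continuous.
have P0 : [set s : 'rV[R]_m | O1 (s + t)] 0 by rewrite /= add0r.
apply: filterS (open_nbhs_nbhs (conj oP P0)) => s O1s.
by apply: immersion_at_translate; exact: H1.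
Qed.

(** A curve in the coordinates of the chart a, as a curve in the manifold; the
point p only matters where g is outside of the image of the chart. *)
Definition chart_lift p a (g : 'rV[R]_m -> 'rV[R]_n) t : E :=
  xget p [set q | cdom a q /\ cmap a q = g t].

Lemma chart_liftP p a g t : (cmap a @` cdom a) (g t) ->
  cdom a (chart_lift p a g t) /\ cmap a (chart_lift p a g t) = g t.
Proof. move=> [q aq E1].
exact: (@xgetPex _ p [set q | cdom a q /\ cmap a q = g t] (ex_intro _ q (conj aq E1))). Qed.

Lemma chart_lift_continuous p a g t : {for t, continuous g} ->
  (\forall s \near t, (cmap a @` cdom a) (g s)) -> {for t, continuous (chart_lift p a g)}.
Proof.
move=> cg ng B nB.
have /near_open[B' [oB' B't sB]] : nbhs (chart_lift p a g t) B := nB.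
have [at_ E1] := chart_liftP p (nbhs_singleton ng).
have oI : open (cmap a @` (B' `&` cdom a)).
  apply: (sm_open_map hA); last by move=> x [].
  by apply: openI => //; exact: sm_dom_open.
have : nbhs (g t) (cmap a @` (B' `&` cdom a)).
  by apply: open_nbhs_nbhs; split=> //; exists (chart_lift p a g t).
move=> /cg; apply: filterS2 ng => s ns [q [B'q aq] E2]; apply: sB.
have [as_ E3] := chart_liftP p ns.
by rewrite (chart_inj as_ aq) // E3 -E2.
Qed.

Lemma smooth_mxcomp (U : normedModType R) (p q p' q' : nat) (O : set U) (O' : set 'M[R]_(p, q))
    (g : U -> 'M[R]_(p, q)) (f : 'M[R]_(p, q) -> 'M[R]_(p', q')) : open O -> open O' ->
  (forall x, O x -> O' (g x)) -> smooth_on O g -> smooth_on O' f ->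
  smooth_on O (fun x => f (g x)).
Proof.
move=> oO oO' OO sg sf; apply: smooth_mx => // a b.
by apply: (@smooth_comp _ U p q O O' g (fun y => f y a b)) => //; exact: smooth_coord.
Qed.

(** In another chart b the lifted curve is psi o g, with psi the transition map,
and its differential is injective because the inverse transition map sends
psi o g back to g. *)
Lemma chart_lift_immersion p a g O t : open O -> smooth_on O g ->
  (forall s, O s -> (cmap a @` cdom a) (g s)) ->
  (forall s v, O s -> 'D_v g s = 0 -> v = 0) -> O t -> immersion_at (chart_lift p a g) t.
Proof.
move=> oO sg Og inj Ot.
have cg s : O s -> {for s, continuous (chart_lift p a g)}.
  move=> Os; apply: chart_lift_continuous.
    exact/differentiable_continuous/(smooth_diff sg).
  by apply: filterS (open_nbhs_nbhs (conj oO Os)) => y; exact: Og.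
split; first exact: cg.
move=> b bt.
have : nbhs t (O `&` (chart_lift p a g) @^-1` cdom b).
  apply: filterI; first exact: open_nbhs_nbhs.
  by apply: (cg _ Ot); apply: open_nbhs_nbhs; split=> //; exact: sm_dom_open.
move=> /near_open[ O' [oO' O't H]].
have Og' s : O' s -> (cmap a @` (cdom a `&` cdom b)) (g s).
  move=> /H[Os bs]; have [as_ E1] := chart_liftP p (Og _ Os).
  by exists (chart_lift p a g s).
have E1 s : O' s -> transition a b (g s) = (cmap b \o chart_lift p a g) s.
  move=> /H[Os bs]; have [as_ E1] := chart_liftP p (Og _ Os).
  by rewrite -E1 /= transition_chart.
have E2 s : O' s -> transition b a ((cmap b \o chart_lift p a g) s) = g s.
  move=> /H[Os bs]; have [as_ E2] := chart_liftP p (Og _ Os).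
  by rewrite /= transition_chart.
have sg' : smooth_on O' g by apply: smooth_sub sg => y /H[].
have sl : smooth_on O' (cmap b \o chart_lift p a g).
  apply: (smooth_eq oO' E1).
  apply: (@smooth_mxcomp _ _ _ _ _ O' _ g (transition a b) oO' _ Og' sg').
    exact: overlap_open.
  exact: (sm_transition hA).
have sat : smooth_at t (cmap b \o chart_lift p a g) by exists O'.
split; first exact: sat.
apply/(inj_diffP (smooth_at_diff sat)) => v Dv.
apply: (inj t v Ot); rewrite -(derive_on_eq v oO' O't E2).
rewrite (@derive_comp _ _ _ _ (cmap b \o chart_lift p a g) (transition b a)).
- by rewrite Dv derive0.
- exact: (smooth_at_diff sat).
- apply: smooth_diff (sm_transition hA b a) _.
  have [Ott bt'] := H _ O't; have [at_ _] := chart_liftP p (Og _ Ott).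
  by exists (chart_lift p a g t).
Qed.

End ManifoldCurves.

(** * The charts of the frame bundles *)

Section JetFamily.
Context {R : realType} {n m k : nat}.
Notation JC := (jcoords R n m k).

(** For g of k-jet u0 at 0, this family of curves, smooth in (u, t), has k-jet u
at 0 and is g for u = u0. *)
Definition perturb (g : 'rV[R]_m -> 'rV[R]_n) (u0 : JC) (x : JC * 'rV[R]_m) : 'rV[R]_n :=
  g x.2 + jet_poly (x.1 - u0) x.2.

Lemma smooth_perturb O g u0 : open O -> smooth_on O g ->
  smooth_on [set x : JC * 'rV[R]_m | O x.2] (perturb g u0).
Proof.
move=> oO sg; have oD : open [set x : JC * 'rV[R]_m | O x.2].
  by apply: (@open_comp _ _ (@snd JC 'rV[R]_m)) => // x _; exact: snd_continuous.
have s2 (f : 'rV[R]_m -> R) : smooth_on O f ->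
    smooth_on [set x : JC * 'rV[R]_m | O x.2] (fun x => f x.2).
  by move=> sf; apply: (@smooth_prelin _ _ _ _ O _ f (@snd JC 'rV[R]_m)) => //; exact: snd_continuous.
have s1 al c : smooth_on [set x : JC * 'rV[R]_m | O x.2] (fun x => x.1 al c).
  apply: (@smooth_prelin _ _ _ _ setT _ (fun u : JC => u al c) (@fst JC 'rV[R]_m)) => //.
    exact: fst_continuous.
  by apply: smooth_coord; [exact: openT|exact: smooth_id].
apply: smooth_mx => // a al.
apply: (@smooth_eq _ _ _ _ (fun x : JC * 'rV[R]_m => g x.2 a al + \sum_(c : mindex m k)
    (x.1 al (enum_rank c) + - u0 al (enum_rank c)) *
      ((@monomial_coef R m (mseq (mval c)))^-1 * monomial (mseq (mval c)) x.2))) => //.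
  move=> x _; rewrite /perturb !mxE; congr (_ + _); apply: eq_bigr => c _.
  by rewrite !mxE.
apply: smooth_add => //; first by apply: (s2 (fun t => g t a al)); exact: smooth_coord.
apply: smooth_sum => // c _; apply: smooth_mul => //.
  by apply: smooth_add => //; exact: smooth_cst.
apply: smooth_mul => //; first exact: smooth_cst.
by apply: s2; exact: smooth_monomial.
Qed.

Lemma perturb0 g u0 t : perturb g u0 (u0, t) = g t.
Proof.
rewrite /perturb /= subrr; apply/rowP => al; rewrite !mxE big1 ?addr0 // => c _.
by rewrite !mxE mul0r.
Qed.

Lemma Jk_perturb O g u : open O -> O 0 -> smooth_on O g ->
  Jk k (fun t => perturb g (Jk k g 0) (u, t)) 0 = u.
Proof.
move=> oO O0 sg; set u0 := Jk k g 0.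
rewrite (@Jk_eq _ _ _ O _ _ (fun t => 1 *: jet_poly (u - u0) t + g t)) //; last first.
  by move=> y _; rewrite /perturb scale1r addrC.
rewrite (@Jk_linear _ _ _ O) //; last exact: smooth_jet_poly.
by rewrite Jk_jet_poly scale1r subrK.
Qed.

End JetFamily.

Section Injectivity.
Context {R : realType}.

Lemma derive_lin_sum (m : nat) (U W : normedModType R) (f : U -> W)
    (L : {linear 'rV[R]_m -> U}) x v : differentiable f x ->
  'D_(L v) f x = \sum_i v 0 i *: 'D_(L 'e_i) f x.
Proof.
move=> df; rewrite deriveE // {1}[v]row_sum_delta !linear_sum.
by apply: eq_bigr => i _; rewrite linearZ_LR linearZ_LR deriveE.
Qed.

Lemma smooth_det (V : normedModType R) (p : nat) (O : set V) (M : V -> 'M[R]_p) :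
  open O -> (forall i j, smooth_on O (fun x => M x i j)) ->
  smooth_on O (fun x => \det (M x)).
Proof.
move=> oO sM; rewrite /determinant; apply: smooth_sum => // s _.
by apply: smooth_mul => //; [exact: smooth_cst|exact: smooth_prod].
Qed.

(** The Jacobian matrix has a right inverse at x0, and its product with this fixed
matrix keeps a nonzero determinant near x0. *)
Lemma inj_open (m n : nat) (U : normedModType R) (D : set U)
    (G : U -> 'rV[R]_n) (L : {linear 'rV[R]_m -> U}) x0 :
  open D -> D x0 -> smooth_on D G -> (forall v, 'D_(L v) G x0 = 0 -> v = 0) ->
  exists D', [/\ open D', D' x0, D' `<=` D &
    forall x v, D' x -> 'D_(L v) G x = 0 -> v = 0].
Proof.
move=> oD Dx0 sG inj.
pose J x : 'M[R]_(m, n) := \matrix_(i, al) 'D_(L 'e_i) G x 0 al.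
have EJ x v : D x -> 'D_(L v) G x = v *m J x.
  move=> Dx; rewrite derive_lin_sum; last exact: smooth_diff Dx.
  apply/rowP => al; rewrite !mxE summxE; apply: eq_bigr => i _.
  by rewrite !mxE.
have /row_freeP[B JB] : row_free (J x0).
  apply/row_freeP; have : kermx (J x0) = 0.
    apply/row_matrixP => i; rewrite row0; apply: inj; rewrite EJ //.
    by rewrite -row_mul mulmx_ker row0.
  by move/eqP; rewrite kermx_eq0 => /row_freeP.
(* As B is constant, d is smooth and d(x0) = 1; J x is injective where d is nonzero. *)
pose d x := \det (J x *m B).
have sJ i al : smooth_on D (fun x => J x i al).
  apply: (@smooth_eq _ _ _ _ (fun x => 'D_(L 'e_i) G x 0 al)) => // [x _|].
    by rewrite mxE.
  by apply: smooth_coord => //; exact: smooth_derive.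
have sd : smooth_on D d.
  apply: smooth_det => // i j.
  apply: (@smooth_eq _ _ _ _ (fun x => \sum_al J x i al * B al j)) => // [x _|].
    by rewrite [RHS]mxE.
  by apply: smooth_sum => // al _; apply: smooth_mul => //; exact: smooth_cst.
have d0 : d x0 != 0 by rewrite /d JB det1 oner_neq0.
have cd : {for x0, continuous d} := sd 0%N x0 Dx0.
have nd : \forall x \near x0, d x != 0 by apply: cvgr_neq0 d0; exact: cd.
have /near_open[D' [oD' D'0 H]] : \forall x \near x0, D x /\ d x != 0.
  by apply: filterI => //; exact: open_nbhs_nbhs.
exists D'; split=> // [x /H[]//|x v /H[Dx dx]].
rewrite EJ // => vJ.
have uJB : J x *m B \in unitmx by rewrite unitmxE unitfE.
by rewrite -[v](mulmxK uJB) mulmxA vJ !mul0mx.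
Qed.

End Injectivity.

Section Frames.
Context {R : realType} {n : nat} {E : topologicalType}.
Variables (A : charts E 'rV[R]_n) (hA : smooth_manifold A) (m k : nat).
Implicit Types (a b : cidx A) (gamma delta : 'rV[R]_m -> E).
Notation JC := (jcoords R n m k).

Lemma jet_coordsE a gamma : jet_coords a k gamma = Jk k (cmap a \o gamma) 0.
Proof. by []. Qed.

(** Smooth families of immersions through all jets near a given one: the curves
[perturb] stay in U and stay immersions for (u, t) near (u0, 0). *)
Lemma jet_family a gamma (U : set 'rV[R]_n) :
  immersion_near0 A gamma -> cdom a (gamma 0) -> open U ->
  U `<=` cmap a @` cdom a -> U (cmap a (gamma 0)) ->
  exists (N : set JC) (O : set 'rV[R]_m),
    [/\ open N /\ N (jet_coords a k gamma), open O /\ O 0,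
        smooth_on O (cmap a \o gamma),
        (forall u t, N u -> O t -> U (perturb (cmap a \o gamma) (jet_coords a k gamma) (u, t))) &
        forall u, N u -> exists delta, [/\ immersion_near0 A delta,
          jet_coords a k delta = u &
          forall t, O t -> cdom a (delta t) /\
            cmap a (delta t) = perturb (cmap a \o gamma) (jet_coords a k gamma) (u, t)]].
Proof.
move=> ig a0 oU sU U0; have [ O1 [oO1 O10 sg HO1]] := immersion_local hA ig a0.
set g := cmap a \o gamma; set u0 := jet_coords a k gamma.
pose D := [set x : JC * 'rV[R]_m | O1 x.2].
have oD : open D.
  by apply: (@open_comp _ _ (@snd JC 'rV[R]_m)) => // x _; exact: snd_continuous.
have sG : smooth_on D (perturb g u0) by exact: smooth_perturb.
have D0 : D (u0, 0) by [].
have inj0 v : 'D_(pairr _ v) (perturb g u0) (u0, 0) = 0 -> v = 0.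
  rewrite -derive_slicer.
  have -> : (fun t => perturb g u0 (u0, t)) = g by apply/funext => t; exact: perturb0.
  have [_ [_ /(_ a a0)[sa ia]] _] := HO1 _ O10.
  exact: ((inj_diffP (smooth_at_diff sa)).1 ia v).
have [D1 [oD1 D10 sD1 inj]] := inj_open oD D0 sG inj0.
have : nbhs ((u0, 0) : JC * 'rV[R]_m) (D1 `&` perturb g u0 @^-1` U).
  apply: filterI; first exact: open_nbhs_nbhs.
  have cG : {for (u0, 0), continuous (perturb g u0)} := sG 0%N _ D0.
  by apply: cG; apply: open_nbhs_nbhs; split=> //; rewrite perturb0.
move=> /near_open[D2 [oD2 D20 HD2]].
have [N [ O [oN Nu0 oO O0 NO]]] := open_prod_sub oD2 D20.
exists N, O; split=> //.
- move=> j; apply: class_C_sub (sg j) => t Ot.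
  by have [/sD1] := HD2 _ (NO _ _ Nu0 Ot).
- by move=> u t Nu Ot; have [] := HD2 _ (NO _ _ Nu Ot).
move=> u Nu; pose h t := perturb g u0 (u, t).
have sh : smooth_on O h.
  have E1 t : h t = perturb g u0 (pairr _ t + (u, 0)).
    by rewrite /h /pairr; congr (perturb _ _ (_, _)); rewrite /= ?add0r ?addr0.
  apply: (@smooth_eq _ _ _ _ (fun t => perturb g u0 (pairr JC t + (u, 0)))) => //.
  apply: (smooth_preaff (@pairr_continuous R JC 'rV[R]_m) _ sG) => t Ot.
  have [/sD1 + _] := HD2 _ (NO _ _ Nu Ot).
  by rewrite /D /= addr0.
have hU t : O t -> (cmap a @` cdom a) (h t).
  by move=> Ot; apply: sU; have [] := HD2 _ (NO _ _ Nu Ot).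
have hinj t v : O t -> 'D_v h t = 0 -> v = 0.
  move=> Ot; rewrite /h derive_slicer; apply: inj.
  by have [] := HD2 _ (NO _ _ Nu Ot).
exists (chart_lift (gamma 0) a h).
have L t : O t -> cdom a (chart_lift (gamma 0) a h t) /\ cmap a (chart_lift (gamma 0) a h t) = h t.
  by move=> Ot; apply: chart_liftP; exact: hU.
split=> //.
  apply: filterS (open_nbhs_nbhs (conj oO O0)) => t Ot.
  exact: (chart_lift_immersion hA (gamma 0) oO sh hU hinj Ot).
rewrite jet_coordsE (@Jk_eq _ _ _ O _ _ h) //; last by move=> t /L[].
by rewrite /h /u0 jet_coordsE (Jk_perturb _ oO1).
Qed.

(** Contact of order k does not depend on the chart, since composition with the
transition map preserves it ([agree_comp]). *)
Lemma same_chart_jet a b gamma delta :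
  immersion_near0 A gamma -> immersion_near0 A delta ->
  cdom a (gamma 0) -> cdom a (delta 0) ->
  jet_coords a k gamma = jet_coords a k delta ->
  gamma 0 = delta 0 /\ (cdom b (gamma 0) -> jet_coords b k gamma = jet_coords b k delta).
Proof.
move=> ig id ag ad Ej.
have [ O1 [oO1 O10 s1 H1]] := immersion_local hA ig ag.
have [ O2 [oO2 O20 s2 H2]] := immersion_local hA id ad.
have oO : open (O1 `&` O2) by exact: openI.
have O0 : (O1 `&` O2) 0 by [].
have s1' : smooth_on (O1 `&` O2) (cmap a \o gamma) by apply: smooth_sub s1 => x [].
have s2' : smooth_on (O1 `&` O2) (cmap a \o delta) by apply: smooth_sub s2 => x [].
have /(Jk_agree k oO O0 s1' s2') ag_ := Ej.
have E0 : gamma 0 = delta 0.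
  apply: (chart_inj hA ag ad); apply/rowP => al.
  exact: (ag_ al [::] isT).
split=> // bg.
have [ O3 [oO3 O30 s3 H3]] := immersion_local hA ig bg.
have bd : cdom b (delta 0) by rewrite -E0.
have [ O4 [oO4 O40 s4 H4]] := immersion_local hA id bd.
pose O := O1 `&` O2 `&` (O3 `&` O4).
have oO' : open O by apply: openI => //; exact: openI.
have O'0 : O 0 by [].
have HO t : O t -> [/\ cdom a (gamma t), cdom a (delta t), cdom b (gamma t) & cdom b (delta t)].
  by move=> [[/H1[? _ _] /H2[? _ _]] [/H3[? _ _] /H4[? _ _]]].
have sO f : smooth_on (O1 `&` O2) f -> smooth_on O (f : _ -> 'rV[R]_n).
  by apply: smooth_sub => x [].
have sg3 : smooth_on O (cmap b \o gamma) by apply: smooth_sub s3 => x [_ []].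
have sg4 : smooth_on O (cmap b \o delta) by apply: smooth_sub s4 => x [_ []].
rewrite !jet_coordsE; apply/(Jk_agree k oO' O'0 sg3 sg4) => al.
have tr := sm_transition hA a b.
have Eg (d : 'rV[R]_m -> E) : (forall t, O t -> cdom a (d t) /\ cdom b (d t)) -> forall t, O t ->
   transition a b ((cmap a \o d) t) 0 al = (cmap b \o d) t 0 al.
  by move=> Hd t /Hd[ad' bd']; rewrite /= transition_chart.
apply: (agree_eq oO' O'0 (Eg gamma _) (Eg delta _)).
- by move=> t /HO[].
- by move=> t /HO[].
apply: (@agree_comp R m O n (cmap a @` (cdom a `&` cdom b)) k 0
  (fun y => transition a b y 0 al) (cmap a \o gamma) (cmap a \o delta)) => //.
- exact: sO.
- exact: sO.
- by apply: smooth_coord => //; exact: overlap_open.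
- by move=> t /HO[? _ ? _]; exists (gamma t).
- by move=> t /HO[_ ? _ ?]; exists (delta t).
Qed.

Lemma jet_eqP gamma delta : Defs.jet A k gamma = Defs.jet A k delta ->
  immersion_near0 A gamma -> same_jet A k delta gamma.
Proof.
move=> E1 ig; have : Defs.jet A k gamma gamma by split.
by rewrite E1 => -[].
Qed.

Lemma frame_cmap a gamma : immersion_near0 A gamma -> cdom a (gamma 0) ->
  @cmap _ _ (frame_bundle A m k) a (Defs.jet A k gamma) = jet_coords a k gamma.
Proof.
move=> ig ag /=; apply: xget_unique; first by exists gamma.
move=> y [delta [id Ej ->]].
by have [_ /(_ a ag)] := jet_eqP (esym Ej) id.
Qed.

Lemma frame_cdom a gamma : immersion_near0 A gamma -> cdom a (gamma 0) ->
  @cdom _ _ (frame_bundle A m k) a (Defs.jet A k gamma).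
Proof. by move=> ig ag; exists gamma. Qed.

Lemma frame_point a p : @cdom _ _ (frame_bundle A m k) a p ->
  exists gamma, [/\ immersion_near0 A gamma, cdom a (gamma 0), p = Defs.jet A k gamma &
    @cmap _ _ (frame_bundle A m k) a p = jet_coords a k gamma].
Proof. by move=> [gamma [ig ag ->]]; exists gamma; split=> //; exact: frame_cmap. Qed.

Lemma frame_point2 a b p : @cdom _ _ (frame_bundle A m k) a p ->
  @cdom _ _ (frame_bundle A m k) b p ->
  exists gamma, [/\ immersion_near0 A gamma, cdom a (gamma 0), cdom b (gamma 0) &
    p = Defs.jet A k gamma].
Proof.
move=> [gamma [ig ag ->]] [delta [id bd Ej]]; exists gamma; split=> //.
by have [<- _] := jet_eqP Ej ig.
Qed.

Lemma frame_imageP a u : (@cmap _ _ (frame_bundle A m k) a @` @cdom _ _ (frame_bundle A m k) a) u <->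
  exists gamma, [/\ immersion_near0 A gamma, cdom a (gamma 0) & u = jet_coords a k gamma].
Proof.
split=> [[p /frame_point[gamma [ig ag -> ->]] <-]|[gamma [ig ag ->]]].
  by exists gamma.
by exists (Defs.jet A k gamma); [exact: frame_cdom|exact: frame_cmap].
Qed.

Lemma frame_open a : open (@cmap _ _ (frame_bundle A m k) a @` @cdom _ _ (frame_bundle A m k) a).
Proof.
rewrite openE => u /frame_imageP[gamma [ig ag ->]].
have U0 : (cmap a @` cdom a) (cmap a (gamma 0)) by exists (gamma 0).
have [N [ O [[oN Nu] [oO O0] _ _ H]]] :=
  jet_family ig ag (@chart_open _ _ _ _ hA a) (@subset_refl _ _) U0.
apply: filterS (open_nbhs_nbhs (conj oN Nu)) => v /H[delta [id Ed Hd]].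
apply/frame_imageP; exists delta; split=> //.
by have [] := Hd _ O0.
Qed.

Lemma frame_transition a b gamma : immersion_near0 A gamma ->
  cdom a (gamma 0) -> cdom b (gamma 0) ->
  @transition _ _ (frame_bundle A m k) a b (jet_coords a k gamma) = jet_coords b k gamma.
Proof.
move=> ig ag bg; rewrite /transition; apply: xget_unique.
  by exists (Defs.jet A k gamma); split; rewrite ?frame_cmap //; exact: frame_cdom.
move=> y [p [ap bp E1 <-]].
have [delta [id ad bd Ep]] := frame_point2 ap bp; subst p.
rewrite frame_cmap // in E1; rewrite frame_cmap //.
by have [E0 /(_ bg)] := same_chart_jet b ig id ag ad (esym E1).
Qed.

End Frames.

(** * Differentials of the changes of coordinates of frame bundles *)

Section Push.
Context {R : realType} {m n : nat}.

Lemma pushE (U : set 'rV[R]_n) (psi : 'rV[R]_n -> 'rV[R]_n) (v x : 'rV[R]_n) be :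
  smooth_on U psi -> U x -> ('D_v psi x) 0 be =
    \sum_al v 0 al * 'D_('e_al) (fun y => psi y 0 be) x.
Proof.
move=> sp Ux; have dp := smooth_diff sp Ux.
rewrite -derive_coord // derive_dir_sum ?big_ord1 //.
apply: (@differentiable_comp _ _ _ _ psi (fun y : 'rV[R]_n => y 0 be)) => //.
exact: differentiable_coord.
Qed.

Lemma smooth_push (O : set 'rV[R]_m) (U : set 'rV[R]_n) (psi : 'rV[R]_n -> 'rV[R]_n)
    (g xi : 'rV[R]_m -> 'rV[R]_n) : open O -> open U -> smooth_on U psi ->
  smooth_on O g -> smooth_on O xi -> (forall t, O t -> U (g t)) ->
  smooth_on O (fun t => 'D_(xi t) psi (g t)).
Proof.
move=> oO oU sp sg sx OU; apply: smooth_mx => // a be; rewrite (ord1 a).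
apply: (@smooth_eq _ _ _ _ (fun t => \sum_al xi t 0 al * 'D_('e_al) (fun y => psi y 0 be) (g t))) => //.
  by move=> t Ot; rewrite (pushE _ _ sp) //; exact: OU.
apply: smooth_sum => // al _; apply: smooth_mul => //; first exact: smooth_coord.
apply: (@smooth_comp _ _ _ _ O U g ('D_('e_al) (fun y => psi y 0 be))) => //.
by apply: smooth_derive; exact: smooth_coord.
Qed.

(** The components of dpsi(g) xi are sums of products of components of xi with
functions of g. *)
Lemma Jk_push k (O : set 'rV[R]_m) (U : set 'rV[R]_n) (psi : 'rV[R]_n -> 'rV[R]_n)
    (g xi xi' : 'rV[R]_m -> 'rV[R]_n) t : open O -> O t -> open U -> smooth_on U psi ->
  smooth_on O g -> smooth_on O xi -> smooth_on O xi' -> (forall t, O t -> U (g t)) ->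
  Jk k xi t = Jk k xi' t ->
  Jk k (fun t => 'D_(xi t) psi (g t)) t = Jk k (fun t => 'D_(xi' t) psi (g t)) t.
Proof.
move=> oO Ot oU sp sg sx sx' OU /(Jk_agree k oO Ot sx sx') ag.
apply/(Jk_agree k oO Ot (smooth_push oO oU sp sg sx OU) (smooth_push oO oU sp sg sx' OU)) => be.
have Eq (z : 'rV[R]_m -> 'rV[R]_n) : forall y, O y -> \sum_al z y 0 al * 'D_('e_al) (fun y => psi y 0 be) (g y) =
   ('D_(z y) psi (g y)) 0 be.
  by move=> y Oy; rewrite (pushE _ _ sp) //; exact: OU.
apply: (agree_eq oO Ot (Eq xi) (Eq xi')).
have sc (z : 'rV[R]_m -> 'rV[R]_n) al : smooth_on O z -> smooth_on O (fun y => z y 0 al).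
  by move=> sz; exact: smooth_coord.
have sD al : smooth_on O (fun y => 'D_('e_al) (fun y => psi y 0 be) (g y)).
  apply: (@smooth_comp _ _ _ _ O U g ('D_('e_al) (fun y => psi y 0 be))) => //.
  by apply: smooth_derive; exact: smooth_coord.
apply: (agree_sum _ oO Ot) => al.
- by apply: smooth_mul => //; exact: sc.
- by apply: smooth_mul => //; exact: sc.
by apply: (agree_mul oO Ot) => //; exact: sc.
Qed.

End Push.

Section PartialDerivativesWithParameters.
Context {R : realType} {m : nat} {V : normedModType R}.
Implicit Types (h : V * 'rV[R]_m -> R) (D : set (V * 'rV[R]_m)).

Definition pdV (s : seq 'I_m) h : V * 'rV[R]_m -> R :=
  foldr (fun i (g : V * 'rV[R]_m -> R) x => 'D_(pairr V 'e_i) g x) h s.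

Lemma pd_slice s h u t : pd s (fun t => h (u, t)) t = pdV s h (u, t).
Proof.
elim: s t => [//|i s IH] t /=.
have -> : pd s (fun t => h (u, t)) = fun t => pdV s h (u, t) by exact/funext.
exact: derive_slicer.
Qed.

Lemma smooth_pdV D s h : smooth_on D h -> smooth_on D (pdV s h).
Proof. by move=> sf; elim: s => //= i s IH; exact: smooth_derive. Qed.

Lemma pdV_derive D s h w x : open D -> D x -> smooth_on D h ->
  'D_w (pdV s h) x = pdV s ('D_w h) x.
Proof.
move=> oD Dx sh; elim: s x Dx => [//|i s IH] x Dx /=.
rewrite (smooth_Schwarz _ _ oD Dx (smooth_pdV s sh)).
by apply: (derive_on_eq _ oD Dx) => y Dy; exact: IH.
Qed.

End PartialDerivativesWithParameters.

Section FrameTransition.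
Context {R : realType} {n : nat} {E : topologicalType}.
Variables (A : charts E 'rV[R]_n) (hA : smooth_manifold A) (m k : nat).
Notation JC := (jcoords R n m k).

(** Along [jet_family], the change of coordinates sends u to the k-jet at 0 of
psi o perturb(u, .), which is smooth in u; in its derivative in u, the partial
derivatives in t may be taken last, as derivatives in u and t commute. *)
Lemma frame_transition_diff (a b : cidx A) (gamma : 'rV[R]_m -> E) :
  immersion_near0 A gamma -> cdom a (gamma 0) -> cdom b (gamma 0) ->
  differentiable (@transition _ _ (frame_bundle A m k) a b) (jet_coords a k gamma) /\
  forall v : JC, 'D_v (@transition _ _ (frame_bundle A m k) a b) (jet_coords a k gamma) =
    Jk k (fun t => 'D_(jet_poly v t) (transition a b) (cmap a (gamma t))) 0.
Proof.
move=> ig ag bg; set T := transition _ _; set u0 := jet_coords _ _ _.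
have U0 : (cmap a @` (cdom a `&` cdom b)) (cmap a (gamma 0)) by exists (gamma 0).
have sU : cmap a @` (cdom a `&` cdom b) `<=` cmap a @` cdom a.
  by move=> x [p [ap _] <-]; exists p.
have [N [ O [[oN Nu0] [oO O0] sg HU Hd]]] :=
  jet_family hA k ig ag (@overlap_open _ _ _ _ hA a b) sU U0.
set g := cmap a \o gamma in sg HU Hd; rewrite -/u0 in Nu0 HU Hd.
pose H be (x : JC * 'rV[R]_m) : R := transition a b (perturb g u0 x) 0 be.
pose D := [set x : JC * 'rV[R]_m | N x.1 /\ O x.2].
have oD : open D by exact: open_prod.
have tr := sm_transition hA a b.
have oU := @overlap_open _ _ _ _ hA a b.
have sG : smooth_on D (perturb g u0).
  by apply: smooth_sub (smooth_perturb u0 oO sg) => x [].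
have sH be : smooth_on D (H be).
  apply: (@smooth_comp _ _ _ _ D (cmap a @` (cdom a `&` cdom b)) (perturb g u0) (fun y => transition a b y 0 be) oD _ sG).
    by move=> [u t] [/= Nu Ot]; exact: HU.
  by apply: smooth_coord.
have ET u be c : N u -> T u be c = pdV (mseq (mval (enum_val c))) (H be) (u, 0).
  move=> Nu; have [delta [id Ed Hdt]] := Hd _ Nu.
  have dab t : O t -> [/\ cdom a (delta t), cdom b (delta t) &
      cmap a (delta t) = perturb g u0 (u, t)].
    move=> Ot; have [ad E1] := Hdt _ Ot; split=> //.
    have [q [aq bq] E2] := HU _ _ Nu Ot.
    by rewrite (chart_inj hA ad aq) // E1 E2.
  have [ad bd _] := dab 0 O0.
  have -> : T u = jet_coords b k delta by rewrite /T -Ed (frame_transition hA k id ad bd).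
  rewrite mxE partialE.
  rewrite (@pd_eq _ _ O _ _ (fun t => H be (u, t))) ?pd_slice //.
  by move=> t /dab[ad' bd' E1]; rewrite /H -E1 transition_chart.
have sT : smooth_on N T.
  apply: smooth_mx => // be c.
  apply: (@smooth_eq _ _ _ _ (fun u => pdV (mseq (mval (enum_val c))) (H be) (pairl _ u))) => //.
    by move=> u Nu; rewrite ET.
  apply: (smooth_prelin (@pairl_continuous R JC 'rV[R]_m) _ (smooth_pdV _ (sH be))).
  by move=> u Nu.
have dT : differentiable T u0 by exact: smooth_diff sT Nu0.
split=> // v; apply/matrixP => be c; rewrite -derive_coord // mxE partialE.
rewrite (derive_on_eq (g := fun u => pdV (mseq (mval (enum_val c))) (H be) (u, 0)) v oN Nu0); last first.
  by move=> u Nu; exact: ET.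
rewrite derive_slicel (pdV_derive _ _ oD _ (sH be)) // -pd_slice.
apply: (pd_eq _ oO O0) => t Ot.
rewrite -derive_slicel -derive_coord; last first.
  by apply: (smooth_diff tr); have := HU _ _ Nu0 Ot; rewrite perturb0.
pose L := (fun u : JC => jet_poly u t).
have lL : linear L by move=> x u u'; exact: jet_poly_linear.
pose LL : {linear JC -> 'rV[R]_n} := HB.pack L (GRing.isLinear.Build _ _ _ _ L lL).
have E1 : (fun u => H be (u, t)) = fun u => (fun y => transition a b y 0 be) (LL u + (g t - LL u0)).
  apply/funext => u; rewrite /H /perturb /=; congr (transition a b _ 0 be).
  have EL : jet_poly (u - u0) t = jet_poly u t - jet_poly u0 t.
    by have := lL (-1) u0 u; rewrite !scaleN1r /L (addrC (- u0)) => ->; rewrite addrC.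
  by rewrite EL addrCA.
rewrite E1 (@derive_prelin _ _ _ _ (fun y : 'rV[R]_n => transition a b y 0 be) LL).
by rewrite [LL u0 + _]addrC subrK.
Qed.

(** By [Jk_push], the polynomial map in [frame_transition_diff] may be replaced by
any xi with the same jet. *)
Lemma frame_transition_push (a b : cidx A) (gamma : 'rV[R]_m -> E) O xi :
  immersion_near0 A gamma -> cdom a (gamma 0) -> cdom b (gamma 0) ->
  open O -> O 0 -> smooth_on O xi ->
  'd (@transition _ _ (frame_bundle A m k) a b) (jet_coords a k gamma) (Jk k xi 0) =
  Jk k (fun t => 'D_(xi t) (transition a b) (cmap a (gamma t))) 0.
Proof.
move=> ig ag bg oO O0 sx.
have [dT DT] := frame_transition_diff ig ag bg.
rewrite -(@deriveE _ _ _ _ _ (Jk k xi 0) dT) DT.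
have [ O1 [oO1 O10 s1 H1]] := immersion_local hA ig ag.
have [ O2 [oO2 O20 s2 H2]] := immersion_local hA ig bg.
pose O' := O `&` O1 `&` O2.
have oO' : open O' by apply: openI => //; exact: openI.
apply: (@Jk_push R m n k O' (cmap a @` (cdom a `&` cdom b)) (transition a b) (cmap a \o gamma)) => //.
- exact: overlap_open.
- exact: sm_transition.
- by apply: smooth_sub s1 => x [[]].
- exact: smooth_jet_poly.
- by apply: smooth_sub sx => x [[]].
- by move=> t [[_ /H1[at_ _ _]] /H2[bt _ _]]; exists (gamma t).
- exact: Jk_jet_poly.
Qed.

End FrameTransition.

(** * Leibniz' rule for multilinear functions *)

Section SubstAt.
Variables (r : nat) (V : Type).
Implicit Types (v : 'I_r -> V) (x y : V).

Lemma subst_at_eq v l x : subst_at v l x l = x.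
Proof. by rewrite /subst_at eqxx. Qed.

Lemma subst_at_neq v l x j : j != l -> subst_at v l x j = v j.
Proof. by rewrite /subst_at => /negbTE ->. Qed.

Lemma subst_at_id v l : subst_at v l (v l) = v.
Proof. by apply/funext => j; rewrite /subst_at; case: eqP => [->|]. Qed.

Lemma subst_at_at v l x y : subst_at (subst_at v l x) l y = subst_at v l y.
Proof. by apply/funext => j; rewrite /subst_at; case: (j == l). Qed.

Lemma subst_atC v l l' x y : l != l' ->
  subst_at (subst_at v l x) l' y = subst_at (subst_at v l' y) l x.
Proof.
move=> ll'; apply/funext => j; rewrite /subst_at.
by case: (eqVneq j l') => [->|//]; rewrite eq_sym (negbTE ll').
Qed.

Lemma subst_at_map (W : Type) (f : V -> W) v l x :
  (fun j => f (subst_at v l x j)) = subst_at (fun j => f (v j)) l (f x).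
Proof. by apply/funext => j; rewrite /subst_at; case: ifP. Qed.

End SubstAt.

Section Multilinear.
Context {R : realType} {p q r : nat}.
Notation V := 'M[R]_(p, q).

Definition multilinear (f : ('I_r -> V) -> R) := forall v l x y z,
  f (subst_at v l (x *: y + z)) = x * f (subst_at v l y) + f (subst_at v l z).

Lemma multilinear_sum f v l (I : Type) (s : seq I) (a : I -> R) (y : I -> V) :
  multilinear f ->
  f (subst_at v l (\sum_(i <- s) a i *: y i)) = \sum_(i <- s) a i * f (subst_at v l (y i)).
Proof.
move=> mf; elim: s => [|i s IH]; last by rewrite !big_cons mf IH.
rewrite !big_nil; have := mf v l 1 0 0; rewrite scaler0 addr0 mul1r.
by move=> /(congr1 (fun z => z - f (subst_at v l 0))); rewrite addrK subrr.
Qed.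

Lemma multilinear0 f v l : multilinear f -> v l = 0 -> f v = 0.
Proof.
move=> mf vl; rewrite -(subst_at_id v l) vl.
by have := @multilinear_sum f v l 'I_0 [::] (fun _ => 0) (fun _ => 0) mf; rewrite !big_nil.
Qed.

Lemma multilinear_swap f (v : 'I_r -> V) (j l : 'I_r) (x y : V) : multilinear f -> j != l ->
  (forall v, v j = v l -> f v = 0) ->
  f (subst_at (subst_at v j x) l y) + f (subst_at (subst_at v j y) l x) = 0.
Proof.
move=> mf jl af.
have Z z : f (subst_at (subst_at v j z) l z) = 0.
  by apply: af; rewrite subst_at_neq // !subst_at_eq.
have mD (u : 'I_r -> V) (i : 'I_r) (y1 y2 : V) : f (subst_at u i (y1 + y2)) = f (subst_at u i y1) + f (subst_at u i y2).
  by have := mf u i 1 y1 y2; rewrite scale1r mul1r.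
have := Z (x + y).
rewrite mD !(subst_atC _ _ _ jl) !mD.
by rewrite -!(subst_atC _ _ _ jl) !Z add0r addr0 addrC.
Qed.

Lemma matrix_sum_delta1 (M : V) :
  M = \sum_(ij : 'I_p * 'I_q) M ij.1 ij.2 *: delta_mx ij.1 ij.2.
Proof. by rewrite {1}(matrix_sum_delta M) pair_bigA. Qed.

Lemma multilinear_expand f v l x : multilinear f ->
  f (subst_at v l x) =
    \sum_(ij : 'I_p * 'I_q) x ij.1 ij.2 * f (subst_at v l (delta_mx ij.1 ij.2)).
Proof. by move=> mf; rewrite {1}(matrix_sum_delta1 x) multilinear_sum. Qed.

Lemma derive_sumf (U : normedModType R) (I : Type) (s : seq I) (f : I -> U -> R) w x :
  (forall i, differentiable (f i) x) ->
  'D_w (fun x => \sum_(i <- s) f i x) x = \sum_(i <- s) 'D_w (f i) x.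
Proof.
move=> df.
suff [] : differentiable (fun x => \sum_(i <- s) f i x) x /\
  'D_w (fun x => \sum_(i <- s) f i x) x = \sum_(i <- s) 'D_w (f i) x by [].
elim: s => [|i s [IH1 IH2]].
  have -> : (fun x => \sum_(i <- [::]) f i x) = fun _ => 0.
    by apply/funext => y; rewrite big_nil.
  by rewrite big_nil derive_cst; split=> //; exact: differentiable_cst.
have -> : (fun x => \sum_(i <- i :: s) f i x) = f i + fun x => \sum_(i <- s) f i x.
  by apply/funext => y; rewrite big_cons.
rewrite big_cons deriveD ?IH2; first by split=> //; exact: differentiableD.
  exact: diff_derivable.
exact: diff_derivable.
Qed.

Variables (U : normedModType R) (O : set V) (O' : set U).
Variables (w : V -> ('I_r -> V) -> R) (c : U -> V) (X : 'I_r -> U -> V).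
Hypotheses (oO : open O) (oO' : open O') (cO : forall t, O' t -> O (c t)).
Hypotheses (mw : forall x, O x -> multilinear (w x)).
Hypotheses (sw : forall v, smooth_on O (fun x => w x v)).
Hypotheses (sc : smooth_on O' c) (sX : forall j, smooth_on O' (X j)).

Let mix (s : seq 'I_r) (v : 'I_r -> V) t := fun j => if j \in s then X j t else v j.

Let mix_cons s v l t : mix (l :: s) v t = subst_at (mix s v t) l (X l t).
Proof.
apply/funext => j; rewrite /mix /subst_at inE.
by case: eqP => [->|].
Qed.

Let mix_subst s v l y t : l \notin s -> subst_at (mix s v t) l y = mix s (subst_at v l y) t.
Proof.
move=> ls; apply/funext => j; rewrite /mix /subst_at.
by case: eqP => [->|]; rewrite ?(negbTE ls).
Qed.

(** The arguments of index in s move with t and the others are fixed.  Each step of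
the induction sets one more argument in motion, which is expanded in the standard
basis: its coefficients come out by linearity and the product rule applies. *)
Lemma Leibniz_mix s v : uniq s ->
  smooth_on O' (fun t => w (c t) (mix s v t)) /\
  forall e t, O' t -> 'D_e (fun t => w (c t) (mix s v t)) t =
    'D_('D_e c t) (fun x => w x (mix s v t)) (c t) +
    \sum_(l <- s) w (c t) (subst_at (mix s v t) l ('D_e (X l) t)).
Proof.
elim: s v => [|l s IH] v.
  move=> _; split; first exact: (@smooth_comp _ _ _ _ O' O c (fun x => w x v)).
  move=> e t Ot; rewrite big_nil addr0.
  by rewrite (@derive_comp _ _ _ _ c (fun x => w x v)) //;
    [exact: smooth_diff sc Ot|exact: smooth_diff (sw v) (cO Ot)].
move=> /= /andP[ls us].
pose d (ij : 'I_p * 'I_q) : V := delta_mx ij.1 ij.2.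
have Es t x : O x -> w x (mix (l :: s) v t) =
    \sum_(ij : 'I_p * 'I_q) X l t ij.1 ij.2 * w x (mix s (subst_at v l (d ij)) t).
  move=> Ox; rewrite mix_cons multilinear_expand; last exact: mw.
  by apply: eq_bigr => ij _; rewrite mix_subst.
have sXc ij : smooth_on O' (fun t => X l t ij.1 ij.2) by exact: smooth_coord.
have sT ij : smooth_on O' (fun t => X l t ij.1 ij.2 * w (c t) (mix s (subst_at v l (d ij)) t)).
  by apply: smooth_mul => //; have [] := IH (subst_at v l (d ij)) us.
split.
  apply: (@smooth_eq _ _ _ _ (fun t => \sum_(ij : 'I_p * 'I_q)
    X l t ij.1 ij.2 * w (c t) (mix s (subst_at v l (d ij)) t))) => //.
    by move=> t Ot; rewrite (Es t) //; exact: cO.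
  by apply: smooth_sum => // ij _.
move=> e t Ot; have Oct := cO Ot.
rewrite (derive_on_eq (g := fun t => \sum_(ij : 'I_p * 'I_q)
    X l t ij.1 ij.2 * w (c t) (mix s (subst_at v l (d ij)) t)) e oO' Ot); last first.
  by move=> y Oy; apply: Es; exact: cO.
rewrite derive_sumf; last by move=> ij; exact: smooth_diff (sT ij) Ot.
rewrite (derive_on_eq (g := fun x => \sum_(ij : 'I_p * 'I_q)
    X l t ij.1 ij.2 * w x (mix s (subst_at v l (d ij)) t)) _ oO Oct); last first.
  by move=> y Oy; exact: Es.
have dw u : differentiable (fun x => w x u) (c t) by exact: smooth_diff (sw u) Oct.
rewrite derive_sumf; last first.
  by move=> ij; apply: (@differentiableZ _ _ _ (fun x => w x _)).
rewrite big_cons mix_cons subst_at_at.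
rewrite [w (c t) (subst_at (mix s v t) l _)]multilinear_expand; last exact: mw.
under [X in _ + (_ + X)]eq_big_seq => l' l's.
  have ll' : l != l' by apply: contraNneq ls => ->.
  rewrite (subst_atC _ _ _ ll') multilinear_expand; last exact: mw.
  over.
rewrite exchange_big -!big_split /=; apply: eq_bigr => ij _.
rewrite (@deriveM _ _ (fun t => X l t ij.1 ij.2) (fun t => w (c t) (mix s (subst_at v l (d ij)) t))).
- have [_ ->] := IH (subst_at v l (d ij)) us => //.
  rewrite (@deriveZ _ _ _ (fun x => w x (mix s (subst_at v l (d ij)) t))); last exact: diff_derivable.
  rewrite derive_coord; last exact: smooth_diff (sX l) Ot.
  rewrite /GRing.scale /= mulrDr -!addrA; congr (_ + _).
  rewrite addrC mix_subst // [w _ _ * _]mulrC; congr (_ + _).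
  rewrite mulr_sumr; apply: eq_big_seq => l' l's.
  have ll' : l != l' by apply: contraNneq ls => ->.
  by rewrite -(subst_atC _ _ _ ll') [subst_at (mix s v t) l _]mix_subst.
- exact/diff_derivable/(smooth_diff (sXc ij)).
- by have [sm _] := IH (subst_at v l (d ij)) us; exact/diff_derivable/(smooth_diff sm).
Qed.

Lemma smooth_multilinear : smooth_on O' (fun t => w (c t) (X^~ t)).
Proof.
have [+ _] := Leibniz_mix (fun _ => 0) (enum_uniq 'I_r).
by apply: smooth_eq => // t _; congr w; apply/funext => j; rewrite /mix mem_enum.
Qed.

Lemma Leibniz_multilinear e t : O' t ->
  'D_e (fun t => w (c t) (X^~ t)) t =
    'D_('D_e c t) (fun x => w x (X^~ t)) (c t) +
    \sum_(l < r) w (c t) (subst_at (X^~ t) l ('D_e (X l) t)).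
Proof.
move=> Ot; have [_ H] := Leibniz_mix (fun _ => 0) (enum_uniq 'I_r).
have E y : mix (enum 'I_r) (fun _ => 0) y = X^~ y.
  by apply/funext => j; rewrite /mix mem_enum.
have := H e t Ot; rewrite E big_enum /= => <-; congr (derive _ t e).
by apply/funext => y; rewrite E.
Qed.

End Multilinear.

(** * Forms evaluated along curves *)

Section FormsOnFrames.
Context {R : realType} {n : nat} {E : topologicalType}.
Variables (A : charts E 'rV[R]_n) (hA : smooth_manifold A) (m r : nat).
Implicit Types (a b : cidx A) (gamma : 'rV[R]_m -> E).
Implicit Types (g : 'rV[R]_m -> 'rV[R]_n) (xi : 'I_r -> 'rV[R]_m -> 'rV[R]_n).
Local Notation FB k := (frame_bundle A m k).

Definition frame_image a k : set (jcoords R n m k) :=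
  @cmap _ _ (FB k) a @` @cdom _ _ (FB k) a.

Lemma frame_image_open a k : open (@frame_image a k).
Proof. exact: frame_open. Qed.

Lemma frame_image_jet a k gamma : immersion_near0 A gamma -> cdom a (gamma 0) ->
  @frame_image a k (jet_coords a k gamma).
Proof. by move=> ig ag; apply/frame_imageP; exists gamma. Qed.

Lemma jtrunc_jet a k l gamma : (l <= k)%N ->
  jtrunc l (jet_coords a k gamma) = jet_coords a l gamma.
Proof. by move=> lk; rewrite !jet_coordsE jtrunc_Jk. Qed.

Lemma frame_image_trunc a k l u : (l <= k)%N -> @frame_image a k u -> @frame_image a l (jtrunc l u).
Proof.
move=> lk /frame_imageP[gamma [ig ag ->]].
by rewrite jtrunc_jet //; exact: frame_image_jet.
Qed.

Lemma form_multilinear k (w : sform A m r k) a u :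
  is_form w -> @frame_image a k u -> multilinear (w a u).
Proof. by move=> fw [p ap <-] v l x y z; exact: form_linear. Qed.

Lemma form_alt k (w : sform A m r k) a u v (j l : 'I_r) :
  is_form w -> @frame_image a k u -> j != l -> v j = v l -> w a u v = 0.
Proof. by move=> fw [p ap <-]; exact: form_alternating. Qed.

(** Curves in a chart all of whose jets are jets of immersions, so that forms on
all jet bundles can be evaluated along them. *)
Definition good_curve a g (O : set 'rV[R]_m) :=
  [/\ open O, smooth_on O g & forall k t, O t -> @frame_image a k (Jk k g t)].

Lemma jet_coords_translate a k gamma t :
  jet_coords a k (fun s => gamma (s + t)) = Jk k (cmap a \o gamma) t.
Proof. by rewrite jet_coordsE -[in RHS](add0r t) -(Jk_translate k (cmap a \o gamma)). Qed.

Lemma good_curve_chart a gamma : immersion_near0 A gamma -> cdom a (gamma 0) ->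
  exists O, O 0 /\ good_curve a (cmap a \o gamma) O.
Proof.
move=> ig ag; have [ O [oO O0 sO HO]] := immersion_local hA ig ag.
exists O; split=> //; split=> // k t Ot; have [at_ _ it] := HO t Ot.
by rewrite -jet_coords_translate; apply: frame_image_jet => //; rewrite add0r.
Qed.

Definition ev k (w : sform A m r k) a g xi (t : 'rV[R]_m) : R :=
  w a (Jk k g t) (fun j => Jk k (xi j) t).

Lemma ev_smooth k (w : sform A m r k) a g xi O : is_form w -> good_curve a g O ->
  (forall j, smooth_on O (xi j)) -> smooth_on O (ev w a g xi).
Proof.
move=> fw [oO sg HO] sx.
apply: (@smooth_multilinear R n _ r _ (@frame_image a k) O (w a) (Jk k g) (fun j t => Jk k (xi j) t)) => //.
- exact: frame_image_open.
- exact: HO.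
- by move=> x; exact: form_multilinear.
- by move=> v; exact: form_smooth.
- exact: smooth_Jk.
- by move=> j; exact: smooth_Jk.
Qed.

Lemma total_deriv_funE k i (f : jcoords R n m k -> R) u :
  differentiable f (jtrunc k u) ->
  total_deriv_fun i f u = 'D_(jshift i u) f (jtrunc k u).
Proof.
move=> df; rewrite derive_dir_sum //; apply: eq_bigr => al _.
rewrite [RHS](reindex (@enum_rank (mindex m k))) /=; last first.
  exact/onW_bij/enum_rank_bij.
by apply: eq_bigr => c _; rewrite mxE enum_rankK.
Qed.

(** Leibniz' rule along the curve of jets: the derivative in t_i of a k-jet is the
shift of the (k+1)-jet by 1_i, as in the definition of d_i. *)
Lemma ev_total k (w : sform A m r k) i a g xi O t : is_form w ->
  good_curve a g O -> (forall j, smooth_on O (xi j)) -> O t ->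
  ev (total_deriv i w) a g xi t = 'D_('e_i) (ev w a g xi) t.
Proof.
move=> fw [oO sg HO] sx Ot.
rewrite (@Leibniz_multilinear R n _ r _ (@frame_image a k) O (w a) (Jk k g) (fun j t => Jk k (xi j) t)) //; last 6 first.
- exact: frame_image_open.
- exact: HO.
- by move=> x; exact: form_multilinear.
- by move=> v; exact: form_smooth.
- exact: smooth_Jk.
- by move=> j; exact: smooth_Jk.
have Ej : (fun j => jtrunc k (Jk k.+1 (xi j) t)) = (fun j => Jk k (xi j) t).
  by apply/funext => j; rewrite jtrunc_Jk.
rewrite /ev /total_deriv Ej jtrunc_Jk //; congr (_ + _).
  have E1 : jtrunc k (Jk k.+1 g t) = Jk k g t by rewrite jtrunc_Jk.
  rewrite total_deriv_funE E1; first by rewrite (derive_Jk _ _ oO Ot sg).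
  exact: smooth_diff (form_smooth fw a (fun j => Jk k (xi j) t)) (HO k t Ot).
by apply: eq_bigr => l _; rewrite (derive_Jk _ _ oO Ot (sx l)).
Qed.

Lemma ev_pull k l (w : sform A m r l) a g xi t : (l <= k)%N ->
  ev (pull k w) a g xi t = ev w a g xi t.
Proof.
move=> lk; rewrite /ev /pull jtrunc_Jk //; congr w; apply/funext => j.
by rewrite jtrunc_Jk.
Qed.

Lemma ev_subst k (w : sform A m r k) a g xi l (z : 'rV[R]_m -> 'rV[R]_n) t :
  ev w a g (subst_at xi l z) t =
  w a (Jk k g t) (subst_at (fun j => Jk k (xi j) t) l (Jk k z t)).
Proof. by rewrite /ev (subst_at_map (fun f => Jk k f t)). Qed.

Lemma ev_linear k (w : sform A m r k) a g xi O l x (y z : 'rV[R]_m -> 'rV[R]_n) t :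
  is_form w -> good_curve a g O -> O t -> smooth_on O y -> smooth_on O z ->
  ev w a g (subst_at xi l (fun t => x *: y t + z t)) t =
  x * ev w a g (subst_at xi l y) t + ev w a g (subst_at xi l z) t.
Proof.
move=> fw [oO sg HO] Ot sy sz; rewrite !ev_subst (Jk_linear _ _ oO Ot) //.
exact/(form_multilinear fw)/HO.
Qed.

Definition mulx (i : 'I_m) (z : 'rV[R]_m -> 'rV[R]_n) (t : 'rV[R]_m) := t 0 i *: z t.

Lemma smooth_mulx O i z : open O -> smooth_on O z -> smooth_on O (mulx i z).
Proof.
move=> oO sz; apply: smooth_scalem => //.
by apply: smooth_coord => //; exact: smooth_id.
Qed.

(** At the parameter t, the endomorphism S^i multiplies a vector field by x_i - t_i
([vertS_Jk]); the constant t_i comes out by linearity, once for each argument. *)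
Lemma ev_vert k (w : sform A m r k) i a g xi O t : is_form w ->
  good_curve a g O -> (forall j, smooth_on O (xi j)) -> O t ->
  ev (vert i w) a g xi t =
  \sum_(l < r) ev w a g (subst_at xi l (mulx i (xi l))) t - r%:R * (t 0 i * ev w a g xi t).
Proof.
move=> fw gc sx Ot; have [oO sg HO] := gc.
have -> : r%:R * (t 0 i * ev w a g xi t) = \sum_(l < r) t 0 i * ev w a g xi t.
  by rewrite sumr_const card_ord mulr_natl.
rewrite -sumrB {1}/ev /vert; apply: eq_bigr => l _.
rewrite (vertS_Jk _ _ oO Ot (sx l)) -ev_subst.
have -> : subst_at xi l (fun y : 'rV[R]_m => (y 0 i - t 0 i) *: xi l y) =
    subst_at xi l (fun y => (- t 0 i) *: xi l y + mulx i (xi l) y).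
  by congr subst_at; apply/funext => y; rewrite /mulx -scalerDl addrC.
rewrite (ev_linear _ _ _ fw gc Ot (sx l) (smooth_mulx i oO (sx l))) subst_at_id.
by rewrite mulNr addrC.
Qed.

Section Change.
Variables (a b : cidx A) (gamma : 'rV[R]_m -> E).
Hypotheses (ig : immersion_near0 A gamma) (ag : cdom a (gamma 0)) (bg : cdom b (gamma 0)).

(** The expression in the chart b of a vector field along gamma given in the chart a. *)
Definition push (z : 'rV[R]_m -> 'rV[R]_n) t : 'rV[R]_n :=
  'D_(z t) (transition a b) (cmap a (gamma t)).

Lemma common_curve : exists O, [/\ O 0, good_curve a (cmap a \o gamma) O,
  good_curve b (cmap b \o gamma) O &
  forall t, O t -> [/\ cdom a (gamma t), cdom b (gamma t) &
    immersion_near0 A (fun s => gamma (s + t))]].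
Proof.
have [ O1 HO1] := immersion_local hA ig ag; have [ O2 HO2] := immersion_local hA ig bg.
have [ O3 [ O30 [oO3 s3 H3]]] := good_curve_chart ig ag.
have [ O4 [ O40 [oO4 s4 H4]]] := good_curve_chart ig bg.
have [oO1 O10 s1 H1] := HO1; have [oO2 O20 s2 H2] := HO2.
have oO : open (O1 `&` O2 `&` (O3 `&` O4)) by apply: openI; exact: openI.
exists (O1 `&` O2 `&` (O3 `&` O4)); split.
- by [].
- split=> //; first by apply: smooth_sub s1 => x [[]].
  by move=> k t [_ [/H3]].
- split=> //; first by apply: smooth_sub s2 => x [[]].
  by move=> k t [_ [_ /H4]].
- by move=> t [[/H1[? _ ?] /H2[? _ _]] _].
Qed.

Lemma smooth_push_curve O z : open O -> smooth_on O (cmap a \o gamma) ->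
  (forall t, O t -> cdom a (gamma t) /\ cdom b (gamma t)) ->
  smooth_on O z -> smooth_on O (push z).
Proof.
move=> oO sg Hab sz.
apply: (@smooth_push R m n O (cmap a @` (cdom a `&` cdom b)) (transition a b) (cmap a \o gamma)) => //.
- exact: overlap_open.
- exact: sm_transition.
- by move=> t /Hab[? ?]; exists (gamma t).
Qed.

Lemma frame_push k O z t : open O -> O t -> smooth_on O z ->
  cdom a (gamma t) -> cdom b (gamma t) -> immersion_near0 A (fun s => gamma (s + t)) ->
  'd (@transition _ _ (FB k) a b) (Jk k (cmap a \o gamma) t) (Jk k z t) = Jk k (push z) t.
Proof.
move=> oO Ot sz at_ bt it.
have oP : open [set s : 'rV[R]_m | O (s + t)].
  by apply: (@open_comp _ _ (fun s : 'rV[R]_m => s + t)) => // x _; exact: shift_continuous.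
have sz' : smooth_on [set s : 'rV[R]_m | O (s + t)] (fun s => z (s + t)).
  apply: (@smooth_preaff _ _ _ _ O _ z idfun t) => //.
  by move=> x; exact: cvg_id.
have P0 : [set s : 'rV[R]_m | O (s + t)] 0 by rewrite /= add0r.
have at0 : cdom a ((fun s => gamma (s + t)) 0) by rewrite add0r.
have bt0 : cdom b ((fun s => gamma (s + t)) 0) by rewrite add0r.
have := frame_transition_push hA k it at0 bt0 oP P0 sz'.
rewrite jet_coords_translate (Jk_translate k z) add0r => ->.
by rewrite (Jk_translate k (push z)) add0r.
Qed.

(** The compatibility of w with the change of charts of the jet bundle, whose
differential is known on jets of vector fields by [frame_push]. *)
Lemma ev_change k (w : sform A m r k) xi O t : is_form w -> open O -> O t ->
  (forall j, smooth_on O (xi j)) ->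
  cdom a (gamma t) -> cdom b (gamma t) -> immersion_near0 A (fun s => gamma (s + t)) ->
  ev w a (cmap a \o gamma) xi t = ev w b (cmap b \o gamma) (fun j => push (xi j)) t.
Proof.
move=> fw oO Ot sx at_ bt it.
have at0 : cdom a ((fun s => gamma (s + t)) 0) by rewrite add0r.
have bt0 : cdom b ((fun s => gamma (s + t)) 0) by rewrite add0r.
have := form_compat fw (frame_cdom k it at0) (frame_cdom k it bt0).
rewrite !frame_cmap // !jet_coords_translate => H.
rewrite /ev H; congr w; apply/funext => j.
exact: frame_push (sx j) at_ bt it.
Qed.

Lemma jtrunc_transition k l v : (l <= k)%N ->
  jtrunc l ('d (@transition _ _ (FB k) a b) (jet_coords a k gamma) v) =
  'd (@transition _ _ (FB l) a b) (jet_coords a l gamma) (jtrunc l v).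
Proof.
move=> lk; have oT : open (setT : set 'rV[R]_m) := openT.
have sP : smooth_on setT (jet_poly v) by exact: smooth_jet_poly.
rewrite -{1}[v]Jk_jet_poly (frame_transition_push hA k ig ag bg oT _ sP) //.
rewrite jtrunc_Jk // -{2}[v]Jk_jet_poly jtrunc_Jk //.
by rewrite (frame_transition_push hA l ig ag bg oT _ sP).
Qed.

(** By [vertS_Jk], S^i is a multiplication by a coordinate of the parameter, which
commutes with the linear map dpsi(g). *)
Lemma vertS_transition k i v :
  vertS i ('d (@transition _ _ (FB k) a b) (jet_coords a k gamma) v) =
  'd (@transition _ _ (FB k) a b) (jet_coords a k gamma) (vertS i v).
Proof.
have oT : open (setT : set 'rV[R]_m) := openT.
have sP : smooth_on setT (jet_poly v) by exact: smooth_jet_poly.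
have [ O [ O0 [oO sg HO] _ Hab]] := common_curve.
have sPO : smooth_on O (jet_poly v) by exact: smooth_jet_poly.
have Hab' t : O t -> cdom a (gamma t) /\ cdom b (gamma t) by move=> /Hab[].
have sp := smooth_push_curve oO sg Hab' sPO.
have smx : smooth_on O (fun y : 'rV[R]_m => (y 0 i - (0 : 'rV[R]_m) 0 i) *: jet_poly v y).
  by apply: smooth_scalem => //; exact: smooth_coordm.
rewrite -{1}[v]Jk_jet_poly (frame_transition_push hA k ig ag bg oT _ sP) //.
rewrite (@vertS_Jk _ _ _ O) // -{2}[v]Jk_jet_poly (@vertS_Jk _ _ _ O) //.
rewrite (frame_transition_push hA k ig ag bg oO O0 smx).
apply: (Jk_eq _ oO O0) => y Oy; have [ay by_] := Hab' _ Oy.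
have dtr : differentiable (transition a b) (cmap a (gamma y)).
  by apply: smooth_diff (sm_transition hA a b) _; exists (gamma y).
by rewrite (@deriveE _ _ _ _ _ (jet_poly v y) dtr) (@deriveE _ _ _ _ _ (_ *: _) dtr) linearZ_LR.
Qed.

End Change.

Lemma form_zero k : is_form ((fun _ _ _ => 0) : sform A m r k).
Proof.
split=> //.
- by move=> *; rewrite mulr0 addr0.
- by move=> a v; exact: smooth_cst.
Qed.

Lemma form_lin k x (w w' : sform A m r k) : is_form w -> is_form w' ->
  is_form ((fun a u v => x * w a u v + w' a u v) : sform A m r k).
Proof.
move=> fw fw'; split.
- move=> a p ap v l y z z'; rewrite (form_linear fw) // (form_linear fw') //; ring.
- move=> a p ap v j l jl vjl.
  by rewrite (form_alternating fw ap jl vjl) (form_alternating fw' ap jl vjl) mulr0 addr0.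
- move=> a v; apply: smooth_add; [exact: frame_image_open| |exact: form_smooth].
  by apply: smooth_mul; [exact: frame_image_open|exact: smooth_cst|exact: form_smooth].
- by move=> a b p ap bp v; rewrite (form_compat fw ap bp) (form_compat fw' ap bp).
Qed.

Lemma form_congr k (w w' : sform A m r k) : form_eq w w' -> is_form w -> is_form w'.
Proof.
move=> E1 fw; split.
- by move=> a p ap v l y z z'; rewrite -!E1 // (form_linear fw).
- by move=> a p ap v j l jl vjl; rewrite -E1 // (form_alternating fw ap jl vjl).
- move=> a v; apply: (smooth_eq (@frame_image_open a k)) (form_smooth fw a v).
  by move=> _ [p ap <-]; rewrite E1.
- by move=> a b p ap bp v; rewrite -!E1 // (form_compat fw ap bp).
Qed.

Lemma form_sum k (I : Type) (s : seq I) (P : pred I) (x : I -> R) (w : I -> sform A m r k) :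
  (forall i, P i -> is_form (w i)) ->
  is_form ((fun a u v => \sum_(i <- s | P i) x i * w i a u v) : sform A m r k).
Proof.
move=> fw; elim: s => [|i s IH].
  apply: form_congr (@form_zero k) => a p v ap.
  by rewrite big_nil.
case Pi : (P i); last first.
  by apply: form_congr IH => a p v ap; rewrite big_cons Pi.
apply: form_congr (form_lin (x i) (fw i Pi) IH) => a p v ap.
by rewrite big_cons Pi.
Qed.

Lemma form_pull k l (w : sform A m r l) : (l <= k)%N -> is_form w -> is_form (pull k w).
Proof.
move=> lk fw.
have sub v i x : (fun j => jtrunc l (subst_at v i x j)) =
    subst_at (fun j => jtrunc l (v j : jcoords R n m k)) i (jtrunc l x).
  exact: subst_at_map.
split.
- move=> a p ap v i x y z; rewrite /pull !sub jtrunc_linear.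
  apply: (form_multilinear fw); apply: (frame_image_trunc lk).
  by exists p.
- move=> a p ap v j i ji vji; apply: (form_alt fw _ ji); last by rewrite vji.
  by apply: (frame_image_trunc lk); exists p.
- move=> a v.
  have lL : linear (fun u : jcoords R n m k => jtrunc l u : jcoords R n m l).
    by move=> x y z; exact: jtrunc_linear.
  pose LL : {linear jcoords R n m k -> jcoords R n m l} :=
    HB.pack (fun u : jcoords R n m k => jtrunc l u : jcoords R n m l) (GRing.isLinear.Build _ _ _ _ _ lL).
  apply: (@smooth_prelin _ _ _ _ (@frame_image a l) _ (fun u => w a u (fun j => jtrunc l (v j))) LL).
  + exact: linear_mx_continuous.
  + by move=> u; exact: frame_image_trunc.
  + exact: form_smooth.
- move=> a b p ap bp v.
  have [gamma [ig ag bg Ep]] := frame_point2 ap bp; subst p.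
  rewrite /pull !frame_cmap // !jtrunc_jet //.
  have := form_compat fw (frame_cdom l ig ag) (frame_cdom l ig bg).
  rewrite !frame_cmap // => ->; congr w; apply/funext => j.
  by rewrite (jtrunc_transition ig ag bg).
Qed.

Lemma form_vert k i (w : sform A m r k) : is_form w -> is_form (vert i w).
Proof.
move=> fw; split.
- move=> a p ap v l x y z; have mw := form_multilinear fw (imageP (cmap (c := FB k) a) ap).
  rewrite /vert mulr_sumr -big_split; apply: eq_bigr => l' _ /=.
  have [<-|ll'] := eqVneq l l'.
    by rewrite !subst_at_eq !subst_at_at vertS_linear mw.
  by rewrite !(subst_at_neq _ _ (_ : l' != l)) 1?eq_sym // !(subst_atC _ _ _ ll') mw.
- move=> a p ap v j l jl vjl; have Fp := imageP (cmap (c := FB k) a) ap.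
  have mw := form_multilinear fw Fp.
  move: (cmap a p) Fp mw => u Fp mw.
  (* The terms other than j and l vanish; these two cancel by alternation. *)
  have e1 : subst_at v j (vertS i (v j)) = subst_at (subst_at v j (vertS i (v j))) l (v j).
    rewrite vjl -[in LHS](subst_at_id (subst_at v j _) l) subst_at_neq //.
    by rewrite eq_sym.
  have e2 : subst_at v l (vertS i (v l)) = subst_at (subst_at v j (v j)) l (vertS i (v j)).
    by rewrite subst_at_id vjl.
  rewrite /vert (bigD1 j) // (bigD1 l) 1?eq_sym // big1 => [|l' /andP[l'j l'l]].
    rewrite /= addr0 e1 e2.
    exact: (multilinear_swap v (vertS i (v j)) (v j) mw jl (fun v => form_alt fw Fp jl)).
  by apply: (form_alt fw Fp jl); rewrite !subst_at_neq // eq_sym.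
- move=> a v; apply: smooth_sum; first exact: frame_image_open.
  by move=> l _; exact: form_smooth.
- move=> a b p ap bp v; apply: eq_bigr => l _.
  have [gamma [ig ag bg Ep]] := frame_point2 ap bp; subst p.
  rewrite (form_compat fw ap bp); congr w.
  rewrite (subst_at_map ('d (@transition _ _ (FB k) a b) _)); congr subst_at.
  by rewrite frame_cmap // (vertS_transition ig ag bg).
Qed.

(** By [ev_total], d_i w at the jet of a curve is a derivative of values of w along
the curve, for any vector fields with the given jets at 0 (polynomial ones, or
their images under a change of chart).  Linearity, alternation and compatibility
are inherited by the derivative; smoothness is clear on the formula. *)
Lemma form_total k i (w : sform A m r k) : is_form w -> is_form (total_deriv i w).
Proof.
move=> fw; have oT : open (setT : set 'rV[R]_m) := openT.
have sP (v : jcoords R n m k.+1) O : open O -> smooth_on O (jet_poly v).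
  by move=> oO; exact: smooth_jet_poly.
have K a gamma O v : immersion_near0 A gamma -> cdom a (gamma 0) ->
    O 0 -> good_curve a (cmap a \o gamma) O ->
    forall xi, (forall j, smooth_on O (xi j)) -> (forall j, Jk k.+1 (xi j) 0 = v j) ->
    total_deriv i w a (jet_coords a k.+1 gamma) v = 'D_('e_i) (ev w a (cmap a \o gamma) xi) 0.
  move=> ig ag O0 gc xi sx Ex; rewrite -(ev_total i fw gc sx O0) /ev jet_coordsE.
  by congr total_deriv; apply/funext => j.
have sub O (v : 'I_r -> jcoords R n m k.+1) l z : open O -> smooth_on O z ->
    forall j, smooth_on O (subst_at (fun j => jet_poly (v j)) l z j).
  by move=> oO sz j; rewrite /subst_at; case: ifP => // _; exact: sP.
have subJ (v : 'I_r -> jcoords R n m k.+1) l z y : Jk k.+1 z 0 = y ->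
    forall j, Jk k.+1 (subst_at (fun j => jet_poly (v j)) l z j) 0 = subst_at v l y j.
  by move=> Ez j; rewrite /subst_at; case: ifP => // _; exact: Jk_jet_poly.
split.
- move=> a p ap v l x y z.
  have [gamma [ig ag _ ->]] := frame_point ap.
  have [ O [ O0 gc]] := good_curve_chart ig ag; have [oO sg HO] := gc.
  have sy : smooth_on O (jet_poly y) by exact: sP.
  have sz : smooth_on O (jet_poly z) by exact: sP.
  have sxyz : smooth_on O (fun t => x *: jet_poly y t + jet_poly z t).
    apply: smooth_add => //.
    by apply: smooth_scalem => //; exact: smooth_cst.
  rewrite (K a gamma O _ ig ag O0 gc _ (sub O v l _ oO sy) (subJ v l _ _ (Jk_jet_poly y))).
  rewrite (K a gamma O (subst_at v l z) ig ag O0 gc _ (sub O v l _ oO sz) (subJ v l _ _ (Jk_jet_poly z))).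
  have Exyz : Jk k.+1 (fun t => x *: jet_poly y t + jet_poly z t) 0 = x *: y + z.
    by rewrite (Jk_linear _ _ oO O0) // !Jk_jet_poly.
  rewrite (K a gamma O (subst_at v l (x *: y + z)) ig ag O0 gc _ (sub O v l _ oO sxyz) (subJ v l _ _ Exyz)).
  have sy' := ev_smooth fw gc (sub O v l _ oO sy).
  have sz' := ev_smooth fw gc (sub O v l _ oO sz).
  rewrite (derive_on_eq _ oO O0 (fun t Ot => ev_linear _ l x fw gc Ot sy sz)).
  have dy := @diff_derivable _ _ _ _ 0 'e_i (smooth_diff sy' O0).
  have dz := @diff_derivable _ _ _ _ 0 'e_i (smooth_diff sz' O0).
  rewrite (@deriveD _ _ _ (fun t => x * ev w a _ _ t)) //; last exact: derivableZ.
  by rewrite (@deriveZ _ _ _ (ev w a _ _)).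
- move=> a p ap v j l jl vjl.
  have [gamma [ig ag _ ->]] := frame_point ap.
  have [ O [ O0 gc]] := good_curve_chart ig ag; have [oO sg HO] := gc.
  rewrite (K a gamma O _ ig ag O0 gc (fun j => jet_poly (v j))) => [|j'|j']; [|exact: sP|exact: Jk_jet_poly].
  rewrite (derive_on_eq (g := fun _ => 0) _ oO O0) ?derive_cst // => t Ot.
  by apply: (form_alt fw (HO k t Ot) jl); rewrite vjl.
- move=> a v; have oF := @frame_image_open a k.+1.
  have lL : linear (fun u : jcoords R n m k.+1 => jtrunc k u : jcoords R n m k).
    by move=> x y z; exact: jtrunc_linear.
  pose LL : {linear jcoords R n m k.+1 -> jcoords R n m k} :=
    HB.pack (fun u : jcoords R n m k.+1 => jtrunc k u : jcoords R n m k) (GRing.isLinear.Build _ _ _ _ _ lL).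
  have st (f : jcoords R n m k -> R) : smooth_on (@frame_image a k) f ->
      smooth_on (@frame_image a k.+1) (fun u => f (jtrunc k u)).
    apply: (@smooth_prelin _ _ _ _ (@frame_image a k) _ f LL); first exact: linear_mx_continuous.
    by move=> u; exact: frame_image_trunc.
  apply: smooth_add => //; last first.
    apply: smooth_sum => // l _.
    exact: (st (fun u => w a u _) (form_smooth fw a _)).
  apply: smooth_sum => // al _; apply: smooth_sum => // c _.
  apply: smooth_mul => //; last first.
    apply: (st ('D_(delta_mx al (enum_rank c)) (fun u => w a u (fun j => jtrunc k (v j))))).
    apply: smooth_derive; exact: form_smooth.
  have lJ : linear (fun u : jcoords R n m k.+1 => jentry u al (madd1 (mval c) i)).
    by move=> x y z; exact: jentry_linear.
  pose LJ : {linear jcoords R n m k.+1 -> R} :=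
    HB.pack (fun u : jcoords R n m k.+1 => jentry u al (madd1 (mval c) i)) (GRing.isLinear.Build _ _ _ _ _ lJ).
  by apply: (@smooth_lin _ _ _ _ LJ); exact: linear_mx_continuous.
- move=> a b p ap bp v.
  have [gamma [ig ag bg Ep]] := frame_point2 ap bp; subst p.
  rewrite !frame_cmap //.
  have [ O [ O0 gca gcb Hab]] := common_curve ig ag bg; have [oO sg HO] := gca.
  have Hab' t : O t -> cdom (a : cidx A) (gamma t) /\ cdom (b : cidx A) (gamma t) by move=> /Hab[].
  rewrite (K a gamma O _ ig ag O0 gca (fun j => jet_poly (v j))) => [|j'|j']; [|exact: sP|exact: Jk_jet_poly].
  rewrite (K b gamma O _ ig bg O0 gcb (fun j => push a b gamma (jet_poly (v j)))); first last.
  + move=> j; have [a0 b0 i0] := Hab _ O0.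
    rewrite -(frame_push k.+1 oO O0 (sP (v j) O oO) a0 b0 i0) Jk_jet_poly.
    by rewrite jet_coordsE.
  + by move=> j; apply: smooth_push_curve => //; exact: sP.
  apply: (derive_on_eq _ oO O0) => t Ot; have [at_ bt it] := Hab _ Ot.
  by apply: (ev_change fw oO Ot _ at_ bt it) => j; exact: sP.
Qed.

End FormsOnFrames.

(** * The homotopy formula as a consequence of commutation rules *)

Section HomotopyAlgebra.
Context {R : realType} {V : lmodType R} {m : nat}.
Variables (good : V -> Prop) (D S : 'I_m -> V -> V) (r : nat).
Hypothesis r_gt0 : (0 < r)%N.
Hypothesis good0 : good 0.
Hypothesis goodL : forall x u v, good u -> good v -> good (x *: u + v).
Hypothesis goodD : forall i u, good u -> good (D i u).
Hypothesis goodS : forall i u, good u -> good (S i u).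
Hypothesis DL : forall i x u v, good u -> good v ->
  D i (x *: u + v) = x *: D i u + D i v.
Hypothesis SL : forall i x u v, S i (x *: u + v) = x *: S i u + S i v.
Hypothesis DC : forall i j u, good u -> D i (D j u) = D j (D i u).
Hypothesis SC : forall i j u, good u -> S i (S j u) = S j (S i u).
Hypothesis SD : forall i j u, good u ->
  S i (D j u) = D j (S i u) + ((i == j) * r)%:R *: u.

Lemma D_zero i : D i 0 = 0.
Proof.
have := DL i 1 good0 good0; rewrite !scale1r addr0 => /eqP.
by rewrite -subr_eq0 opprD addNKr oppr_eq0 => /eqP.
Qed.

Lemma S_zero i : S i 0 = 0.
Proof.
have := SL i 1 0 0; rewrite !scale1r addr0 => /eqP.
by rewrite -subr_eq0 opprD addNKr oppr_eq0 => /eqP.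
Qed.

Lemma goodZ x u : good u -> good (x *: u).
Proof. by move=> gu; rewrite -[x *: u]addr0; exact: goodL. Qed.

Lemma goodA u v : good u -> good v -> good (u + v).
Proof. by move=> gu gv; rewrite -[u]scale1r; exact: goodL. Qed.

Lemma DZ i x u : good u -> D i (x *: u) = x *: D i u.
Proof. by move=> gu; rewrite -[x *: u]addr0 DL // D_zero addr0. Qed.

Lemma DA i u v : good u -> good v -> D i (u + v) = D i u + D i v.
Proof. by move=> gu gv; rewrite -[u in LHS]scale1r DL // scale1r. Qed.

Lemma good_sum (I : Type) (s : seq I) (P : pred I) (f : I -> V) :
  (forall i, P i -> good (f i)) -> good (\sum_(i <- s | P i) f i).
Proof. by move=> gf; apply: big_ind => // u v; exact: goodA. Qed.

Lemma D_sum (I : Type) (s : seq I) (P : pred I) (f : I -> V) i :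
  (forall i, P i -> good (f i)) ->
  D i (\sum_(j <- s | P j) f j) = \sum_(j <- s | P j) D i (f j).
Proof.
move=> gf; elim: s => [|j s IH]; first by rewrite !big_nil D_zero.
rewrite !big_cons; case: ifP => // Pj.
by rewrite DA ?IH //; [exact: gf|exact: good_sum].
Qed.

(** This is Q_n = sum_(|J| = n) (n! / J!) D_J S^J, by [Q_multinomial]. *)
Fixpoint Q n u : V := if n is n'.+1 then \sum_i D i (Q n' (S i u)) else u.

Lemma goodQ n u : good u -> good (Q n u).
Proof.
elim: n u => [//|n IH] u gu /=.
by apply: good_sum => i _; apply/goodD/IH/goodS.
Qed.

Lemma QL n x u v : good u -> good v -> Q n (x *: u + v) = x *: Q n u + Q n v.
Proof.
elim: n u v => [//|n IH] u v gu gv /=.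
rewrite scaler_sumr -big_split; apply: eq_bigr => i _ /=.
rewrite SL IH; [|exact: goodS|exact: goodS].
by rewrite DL //; exact/goodQ/goodS.
Qed.

Lemma Q_zero n : Q n 0 = 0.
Proof.
elim: n => [//|n IH] /=; rewrite big1 // => i _.
by rewrite S_zero IH D_zero.
Qed.

Lemma QZ n x u : good u -> Q n (x *: u) = x *: Q n u.
Proof. by move=> gu; rewrite -[x *: u]addr0 QL // Q_zero addr0. Qed.

Lemma QA n u v : good u -> good v -> Q n (u + v) = Q n u + Q n v.
Proof. by move=> gu gv; rewrite -[u in LHS]scale1r QL // scale1r. Qed.

Lemma sum_delta i (F : 'I_m -> V) : \sum_j ((j == i) * r)%:R *: F j = r%:R *: F i.
Proof.
rewrite (bigD1 i) //= eqxx mul1n big1 ?addr0 // => j /negbTE ->.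
by rewrite mul0n scale0r.
Qed.

(** Moving D_i to the left across S_j in D_j Q_(n-1) S_j adds r D_i Q_(n-1) when
j = i, and this happens n times. *)
Lemma QD n i u : good u ->
  Q n (D i u) = D i (Q n u) + (r * n)%:R *: D i (Q n.-1 u).
Proof.
elim: n i u => [|n IH] i u gu; first by rewrite muln0 scale0r addr0.
have E j : D j (Q n (S j (D i u))) =
    D i (D j (Q n (S j u))) + (r * n)%:R *: D i (D j (Q n.-1 (S j u))) +
    ((j == i) * r)%:R *: D j (Q n u).
  have gS := goodS j gu.
  rewrite SD // QA; [|exact: goodD|exact: goodZ].
  rewrite IH // QZ // DA; first last.
  - by apply: goodZ; exact: goodQ.
  - by apply: goodA; [|apply: goodZ]; apply: goodD; exact: goodQ.
  rewrite DA; first last.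
  - by apply: goodZ; apply: goodD; exact: goodQ.
  - by apply: goodD; exact: goodQ.
  rewrite !DZ; [|exact: goodQ|by apply: goodD; exact: goodQ].
  by rewrite !(DC j i) //; exact: goodQ.
rewrite [LHS]/= (eq_bigr _ (fun j _ => E j)) !big_split /=.
have gDQ k j : good (D j (Q k (S j u))) by apply: goodD; apply: goodQ; exact: goodS.
rewrite -(D_sum _ _ (fun j _ => gDQ n j)) -addrA; congr (_ + _).
rewrite -scaler_sumr -(D_sum _ _ (fun j _ => gDQ n.-1 j)).
rewrite sum_delta.
have -> : (r * n)%:R *: D i (\sum_j D j (Q n.-1 (S j u))) = (r * n)%:R *: D i (Q n u).
  by case: n {IH E} => [|n] //; rewrite muln0 !scale0r.
by rewrite -scalerDl -natrD mulnS addnC.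
Qed.

Lemma Q_nil n u : good u -> (forall s, size s = n -> foldr S u s = 0) -> Q n u = 0.
Proof.
elim: n u => [|n IH] u gu nil; first exact: (nil [::]).
rewrite /= big1 // => i _; rewrite IH ?D_zero //; first exact: goodS.
by move=> s sn; rewrite -foldr_rcons nil // size_rcons sn.
Qed.

(** The coefficient of Q_n S_j in P^j_(s), where p = m - s. *)
Definition bcoef p n : R := (-1) ^+ n * p`!%:R / (r%:R ^+ n.+1 * (p + n).+1`!%:R).

Let r0 : r%:R != 0 :> R. Proof. by rewrite pnatr_eq0 -lt0n. Qed.
Let f0 k : k`!%:R != 0 :> R. Proof. by rewrite pnatr_eq0 -lt0n fact_gt0. Qed.

Let n0 k : k.+1%:R != 0 :> R. Proof. by rewrite pnatr_eq0. Qed.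

Lemma bcoef0 p : (r * p.+1)%:R * bcoef p 0 = 1.
Proof.
rewrite /bcoef expr0 mul1r expr1 addn0 factS !natrM.
move: (n0 p) (f0 p) r0; move: (p.+1%:R : R) (p`!%:R : R) (r%:R : R) => x y z x0 y0 z0.
by field; rewrite x0 y0 z0.
Qed.

Lemma bcoefS p n : bcoef p n = - (r * (p + n).+2)%:R * bcoef p n.+1.
Proof.
rewrite /bcoef addnS [(p + n).+2`!]factS; move: (f0 (p + n).+1).
move: ((p + n).+1`!) => F F0; rewrite !exprS !natrM.
move: (n0 (p + n).+1) F0 r0 (expf_neq0 n r0).
move: ((p + n).+2%:R : R) (F%:R : R) (r%:R ^+ n : R) (r%:R : R) => x y q z x0 y0 z0 q0.
by field; rewrite x0 y0 z0 q0.
Qed.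

Lemma bcoef_shift p n :
  bcoef p n + (r * n.+1)%:R * bcoef p n.+1 = bcoef p.+1 n.
Proof.
rewrite /bcoef addnS addSn [(p + n).+2`!]factS [p.+1`!]factS; move: (f0 (p + n).+1).
move: ((p + n).+1`!) => F F0; rewrite !exprS !natrM.
have := n0 (p + n).+1; have -> : (p + n).+2%:R = p.+1%:R + n.+1%:R :> R.
  by rewrite -natrD addSn addnS.
move: F0 r0 (expf_neq0 n r0).
move: (p.+1%:R : R) (n.+1%:R : R) (F%:R : R) (r%:R ^+ n : R) (r%:R : R) => x x' y q z y0 z0 q0 x0.
by field; rewrite x0 y0 z0 q0.
Qed.

(** This is P^j_(s), for p = m - s, on forms annihilated by products of more than N of the S_i. *)
Definition Popr p N j u : V := \sum_(n < N) bcoef p n *: Q n (S j u).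

Lemma goodP p N j u : good u -> good (Popr p N j u).
Proof. by move=> gu; apply: good_sum => n _; apply: goodZ; apply: goodQ; exact: goodS. Qed.

Lemma PoprL p N j x u v : good u -> good v ->
  Popr p N j (x *: u + v) = x *: Popr p N j u + Popr p N j v.
Proof.
move=> gu gv; rewrite /Popr scaler_sumr -big_split; apply: eq_bigr => n _ /=.
rewrite SL QL; [|exact: goodS|exact: goodS].
by rewrite scalerDr !scalerA mulrC.
Qed.

Lemma Popr_zero p N j : Popr p N j 0 = 0.
Proof. by rewrite /Popr big1 // => n _; rewrite S_zero Q_zero scaler0. Qed.

Definition nilS K u := forall s, (K < size s)%N -> foldr S u s = 0.

Lemma nilS_Q K n u : good u -> nilS K u -> (K < n)%N -> Q n u = 0.
Proof. by move=> gu nil Kn; apply: Q_nil => // s sn; apply: nil; rewrite sn. Qed.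

Lemma nilS_QS K n j u : good u -> nilS K u -> (K <= n)%N -> Q n (S j u) = 0.
Proof.
move=> gu nil Kn; apply: Q_nil; first exact: goodS.
by move=> s sn; rewrite -foldr_rcons nil // size_rcons sn.
Qed.

(** As sum_j S_j D_j = sum_j D_j S_j + r m, the sum over j of Q_n S_j D_j is
Q_(n+1) + r (n + m) Q_n.  The terms Q_(n+1) are absorbed by the recurrence
[bcoefS], starting from r (p + 1) b_0 = 1; the remaining coefficient of b_n Q_n
is r (m - p - 1) = r s. *)
Lemma sum_PD p s K L u : good u -> nilS K u -> (K < L)%N -> (p + s).+1 = m ->
  \sum_j Popr p L j (D j u) = u + (r * s)%:R *: \sum_(n < L) bcoef p n *: Q n u.
Proof.
move=> gu nil KL pm.
have gQS n j : good (Q n (S j u)) by apply: goodQ; exact: goodS.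
have E n : \sum_j Q n (S j (D j u)) = Q n.+1 u + (r * (n + m))%:R *: Q n u.
  have E1 j : Q n (S j (D j u)) = D j (Q n (S j u)) +
      (r * n)%:R *: D j (Q n.-1 (S j u)) + r%:R *: Q n u.
    rewrite SD // eqxx mul1n QA; [|exact/goodD/goodS|exact: goodZ].
    by rewrite QD ?QZ //; exact: goodS.
  rewrite (eq_bigr _ (fun j _ => E1 j)) !big_split /= -addrA; congr (_ + _).
  rewrite sumr_const card_ord -scaler_sumr -[_ *+ m]scaler_nat scalerA -natrM.
  have -> : (r * n)%:R *: \sum_j D j (Q n.-1 (S j u)) = (r * n)%:R *: Q n u.
    by case: n {E1} => [|n] //; rewrite muln0 !scale0r.
  by rewrite -scalerDl -natrD mulnDr [(m * r)%N]mulnC.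
rewrite /Popr exchange_big /=; under eq_bigr do rewrite -scaler_sumr E.
case: L KL => // L KL.
suff -> : \sum_(n < L.+1) bcoef p n *: (Q n.+1 u + (r * (n + m))%:R *: Q n u) =
    u + (r * s)%:R *: (\sum_(n < L.+1) bcoef p n *: Q n u) + bcoef p L *: Q L.+1 u.
  by rewrite (nilS_Q gu nil KL) scaler0 addr0.
elim: L {KL} => [|L IH].
  rewrite !big_ord1 add0n scalerDr addrC; congr (_ + _).
  rewrite /= !scalerA -{2}[u]scale1r -scalerDl; congr (_ *: _).
  rewrite mulrC -[X in _ = X + _](bcoef0 p) -mulrDl -natrD -mulnDr; congr ((_ * _)%:R * _).
  by rewrite -pm addSn.
rewrite big_ord_recr IH /= [in RHS]big_ord_recr /= scalerDr -!addrA; congr (_ + _).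
rewrite scalerDr -addrA; congr (_ + _).
rewrite addrCA [RHS]addrC; congr (_ + _).
rewrite !scalerA -scalerDl; congr (_ *: _).
rewrite (bcoefS p L) [bcoef p L.+1 * _]mulrC -mulrDl; congr (_ * _).
rewrite addrC; apply/eqP; rewrite subr_eq -natrD -mulnDr; apply/eqP.
congr ((_ * _)%:R); lia.
Qed.

(** Moving D_i to the left across S_j and Q_n gives, besides the term in delta_ij,
b_n(p) D_i Q_n S_j and r n b_n(p) D_i Q_(n-1) S_j, which are collected by
[bcoef_shift]. *)
Lemma comm_PD p K L i j u : good u -> nilS K u -> (K < L)%N ->
  Popr p L j (D i u) = D i (Popr p.+1 K j u) +
    ((j == i) * r)%:R *: \sum_(n < L) bcoef p n *: Q n u.
Proof.
move=> gu nil KL.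
have gQS n : good (Q n (S j u)) by apply: goodQ; exact: goodS.
have -> : D i (Popr p.+1 K j u) = \sum_(n < K) bcoef p.+1 n *: D i (Q n (S j u)).
  rewrite /Popr D_sum => [|n _]; last exact: goodZ.
  by apply: eq_bigr => n _; rewrite DZ.
rewrite /Popr.
have E n : Q n (S j (D i u)) = D i (Q n (S j u)) +
    (r * n)%:R *: D i (Q n.-1 (S j u)) + ((j == i) * r)%:R *: Q n u.
  rewrite SD // QA; [|exact/goodD/goodS|exact: goodZ].
  by rewrite QD ?QZ //; exact: goodS.
under eq_bigr do rewrite E scalerDr.
rewrite big_split /= scaler_sumr; congr (_ + _); last first.
  by apply: eq_bigr => n _; rewrite !scalerA mulrC.
case: L KL => // L; rewrite ltnS => KL.
have -> : \sum_(n < L.+1) bcoef p n *: (D i (Q n (S j u)) + (r * n)%:R *: D i (Q n.-1 (S j u))) =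
    \sum_(n < L) bcoef p.+1 n *: D i (Q n (S j u)) + bcoef p L *: D i (Q L (S j u)).
  elim: L {KL} => [|L IH].
    by rewrite big_ord1 big_ord0 muln0 scale0r addr0 add0r.
  rewrite big_ord_recr IH /= [in RHS]big_ord_recr /= -!addrA; congr (_ + _).
  by rewrite scalerDr addrCA addrC scalerA -scalerDl mulrC -bcoef_shift [(r * _)%:R * _]mulrC.
rewrite (nilS_QS j gu nil KL) D_zero scaler0 addr0.
rewrite -(subnKC KL) big_split_ord /= [X in _ + X]big1 ?addr0 // => n _.
by rewrite (nilS_QS j gu nil) ?leq_addr // D_zero scaler0.
Qed.

(** Here u is the coefficient of indices c_0, ..., c_(s-1) of a form, and w l j is
the coefficient with c_l deleted and j added in front. *)
Lemma homotopy p s K L (c : 'I_s -> 'I_m) u (w : 'I_s -> 'I_m -> V) :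
  good u -> (forall l j, good (w l j)) -> nilS K u ->
  (forall l j, nilS K (w l j)) -> (K < L)%N -> (p + s).+1 = m ->
  (forall l, w l (c l) = (-1) ^+ l *: u) ->
  \sum_j Popr p L j (D j u) +
  \sum_(l < s) (-1) ^+ l.+1 *: \sum_j Popr p L j (D (c l) (w l j)) +
  \sum_(l < s) (-1) ^+ l *: D (c l) (\sum_j Popr p.+1 K j (w l j)) = u.
Proof.
move=> gu gw nu nw KL pm wc; rewrite (sum_PD gu nu KL pm).
have E l : (-1) ^+ (l : 'I_s).+1 *: (\sum_j Popr p L j (D (c l) (w l j))) =
    - ((-1) ^+ l *: D (c l) (\sum_j Popr p.+1 K j (w l j))) -
    r%:R *: \sum_(n < L) bcoef p n *: Q n u.
  under eq_bigr do rewrite (comm_PD _ _ _ (gw _ _) (nw _ _) KL).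
  rewrite big_split /= -(D_sum _ _ (fun j _ => goodP _ _ _ (gw l j))).
  rewrite (sum_delta (c l) (fun j => \sum_(n < L) bcoef p n *: Q n (w l j))).
  rewrite wc exprS mulN1r scaleNr scalerDr opprD; congr (_ - _).
  rewrite scalerA mulrC -scalerA; congr (_ *: _).
  rewrite scaler_sumr; apply: eq_bigr => n _.
  rewrite QZ // scalerA mulrC -scalerA; congr (_ *: _).
  by rewrite scalerA -expr2 sqrr_sign scale1r.
rewrite (eq_bigr _ (fun l _ => E l)) big_split /= sumrN sumrN.
rewrite sumr_const card_ord -[_ *+ s]scaler_nat scalerA -natrM [(s * r)%N]mulnC.
rewrite [- _ - _]addrC addrA addrK addrNK.
by [].
Qed.

Lemma good_foldr_D s u : good u -> good (foldr D u s).
Proof. by move=> gu; elim: s => //= i s; exact: goodD. Qed.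

Lemma good_foldr_S s u : good u -> good (foldr S u s).
Proof. by move=> gu; elim: s => //= i s; exact: goodS. Qed.

Lemma foldr_perm (F : 'I_m -> V -> V) : (forall i u, good u -> good (F i u)) ->
  (forall i j u, good u -> F i (F j u) = F j (F i u)) ->
  forall s s' u, good u -> perm_eq s s' -> foldr F u s = foldr F u s'.
Proof.
move=> gF CF.
have gf s u : good u -> good (foldr F u s) by move=> gu; elim: s => //= i s; exact: gF.
have rem1 i s u : good u -> i \in s -> foldr F u s = F i (foldr F u (rem i s)).
  move=> gu; elim: s => [//|j s IH]; rewrite inE /= [j == i]eq_sym.
  have [<-//|_ /= ins] := eqVneq i j.
  by rewrite IH //= CF //; exact: gf.
elim=> [|i s IH] s' u gu pss; first by have := perm_size pss; case: s' {pss}.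
have is' : i \in s' by rewrite -(perm_mem pss) mem_head.
rewrite (rem1 i s') //= (IH (rem i s')) // -(perm_cons i).
by apply: perm_trans pss _; exact: perm_to_rem.
Qed.

Lemma mfact_madd1 (J : {ffun 'I_m -> nat}) i : mfact (madd1 J i) = ((J i).+1 * mfact J)%N.
Proof.
rewrite /mfact (bigD1 i) //= [in RHS](bigD1 i) //= ffunE eqxx addn1 factS -mulnA.
congr (_ * (_ * _))%N; apply: eq_bigr => j ji.
by rewrite ffunE (negbTE ji) addn0.
Qed.

Lemma mfact_neq0 (J : {ffun 'I_m -> nat}) : (mfact J)%:R != 0 :> R.
Proof. by rewrite pnatr_eq0 -lt0n prodn_gt0 // => i; exact: fact_gt0. Qed.

Definition word (J : {ffun 'I_m -> nat}) u := foldr D (foldr S u (mseq J)) (mseq J).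

(** The recursion of Q_n adds to the multi-index J one unit in position i; the
multi-index I of degree n+1 is reached from all i with weight I(i) n! / I!, and
the I(i) add up to n+1. *)
Lemma Q_multinomial K n u : good u -> (n <= K)%N ->
  Q n u = \sum_(J : mindex m K | mdeg (mval J) == n)
    (n`!%:R / (mfact (mval J))%:R) *: word (mval J) u.
Proof.
elim: n u => [|n IH] u gu nK.
  pose J0 : {ffun 'I_m -> nat} := [ffun _ => 0%N].
  have J00 : mdeg J0 = 0%N by rewrite /mdeg big1 // => i _; rewrite ffunE.
  have [c cJ] : exists c : mindex m K, mval c = J0 by apply: mval_onto; rewrite J00.
  rewrite (big_pred1 c) => [|c' /=].
    rewrite cJ /word; have -> : mseq J0 = [::].
      by apply/eqP; rewrite -size_eq0 size_mseq J00.
    rewrite /= [mfact _]big1 ?divr1 ?scale1r // => i _; by rewrite ffunE.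
  rewrite -(inj_eq (@mval_inj m K)) cJ; apply/eqP/eqP => [|->//].
  rewrite /mdeg => /eqP; rewrite sum_nat_eq0 => /forallP J'0.
  by apply/ffunP => i; rewrite [RHS]ffunE; apply/eqP; have := J'0 i.
pose G i (I : {ffun 'I_m -> nat}) := ((n`! * I i)%:R / (mfact I)%:R : R) *: word I u.
have step i : D i (Q n (S i u)) =
    \sum_(I : mindex m K | mdeg (mval I) == n.+1) G i (mval I).
  rewrite IH; [|exact: goodS|exact: ltnW].
  rewrite D_sum; last first.
    by move=> J _; apply: goodZ; apply: good_foldr_D; apply: good_foldr_S; exact: goodS.
  transitivity (\sum_(J : mindex m K | mdeg (mval J) == n)
      \sum_(I : mindex m K | mval I == madd1 (mval J) i) G i (mval I)).
    apply: eq_bigr => J /eqP Jn.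
    have [I EI] : exists I : mindex m K, mval I = madd1 (mval J) i.
      by apply: mval_onto; rewrite mdeg_madd1 Jn.
    rewrite (big_pred1 I) => [|I' /=]; last by rewrite -EI (inj_eq (@mval_inj m K)).
    rewrite DZ; last by apply: good_foldr_D; apply: good_foldr_S; exact: goodS.
    rewrite /G EI mfact_madd1 ffunE eqxx addn1; congr (_ *: _).
      rewrite !natrM; field.
      by rewrite mfact_neq0 addrC natr1 pnatr_eq0.
    rewrite /word -foldr_rcons.
    rewrite -[D i _]/(foldr D _ (i :: mseq (mval J))).
    have pi : perm_eq (i :: mseq (mval J)) (mseq (madd1 (mval J) i)).
      by rewrite perm_sym; exact: mseq_madd1.
    rewrite (foldr_perm goodD DC _ pi); last by apply: good_foldr_S.
    congr foldr; apply: (foldr_perm goodS SC) => //.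
    by rewrite perm_rcons.
  rewrite (exchange_big_dep (fun I : mindex m K => mdeg (mval I) == n.+1)) /=; last first.
    by move=> J I /eqP Jn /eqP ->; rewrite mdeg_madd1 Jn.
  apply: eq_bigr => I /eqP In.
  have [Ii|Ii] := posnP (mval I i).
    by rewrite /G Ii muln0 mul0r scale0r big1.
  pose J : {ffun 'I_m -> nat} := [ffun j => (mval I j - (j == i))%N].
  have EI : mval I = madd1 J i.
    apply/ffunP => j; rewrite !ffunE subnK //; by case: eqP => [->|]; rewrite ?ffunE // in Ii *.
  have Jn : mdeg J = n by apply: succn_inj; rewrite -(mdeg_madd1 J i) -EI.
  have [c cJ] : exists c : mindex m K, mval c = J by apply: mval_onto; rewrite Jn ltnW.
  rewrite (big_pred1 c) // => c' /=.
  rewrite EI (inj_eq (@madd1_inj m i)) -cJ (inj_eq (@mval_inj m K)) [c == c']eq_sym.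
  by case: (c' =P c) => [->|]; rewrite ?andbF // cJ Jn eqxx.
rewrite /= (eq_bigr _ (fun i _ => step i)) exchange_big /=.
apply: eq_bigr => I /eqP In; rewrite -scaler_suml -mulr_suml; congr ((_ / _) *: _).
by rewrite -natr_sum -big_distrr /= -/(mdeg (mval I)) In factS mulnC.
Qed.

Lemma Popr_multinomial p K j u : good u ->
  Popr p K j u = \sum_(J : mindex m K.-1 | (mdeg (mval J) < K)%N)
    (bcoef p (mdeg (mval J)) * ((mdeg (mval J))`!%:R / (mfact (mval J))%:R)) *:
      foldr D (foldr S u (mseq (madd1 (mval J) j))) (mseq (mval J)).
Proof.
move=> gu; case: K => [|K]; first by rewrite /Popr big_ord0 big_pred0.
rewrite /Popr [RHS](partition_big (fun J : mindex m K => inord (mdeg (mval J)) : 'I_K.+1) predT) //=.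
apply: eq_bigr => n _.
rewrite (@Q_multinomial K) //; [|exact: goodS|by rewrite -ltnS].
rewrite scaler_sumr; apply: eq_big => [J|J /eqP Jn].
  rewrite ltnS mdeg_mval /= -[RHS]val_eqE /= inordK // ltnS.
  exact: mdeg_mval.
rewrite scalerA Jn; congr (_ *: _); rewrite /word -foldr_rcons; congr foldr.
apply: (foldr_perm goodS SC) => //.
by rewrite perm_rcons perm_sym; exact: mseq_madd1.
Qed.

End HomotopyAlgebra.

(** * Forms as functionals of vector fields along a curve *)

Section Nilpotency.
Context {R : realType} {n : nat} {E : topologicalType}.
Variables (A : charts E 'rV[R]_n) (m r k : nat).

Definition order_ge d (v : jcoords R n m k) :=
  forall al I, (mdeg I < d)%N -> jentry v al I = 0.

Lemma vertS_order d i v : order_ge d v -> order_ge d.+1 (vertS i v).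
Proof.
move=> dv al I Id.
have [Ik|kI] := leqP (mdeg I) k; last by rewrite jentry_large.
have [I0|I0] := posnP (I i); first by rewrite jentry_vertS0.
pose J : {ffun 'I_m -> nat} := [ffun j => (I j - (j == i))%N].
have EI : I = madd1 J i.
  by apply/ffunP => j; rewrite !ffunE subnK //; case: eqP => [->|].
move: Id Ik; rewrite EI mdeg_madd1 => Jd Jk.
by rewrite jentry_vertS_add // dv // mulr0.
Qed.

Lemma order_ge_eq0 d v : (k < d)%N -> order_ge d v -> v = 0.
Proof.
move=> kd dv; apply: jcoordsP => al I Ik.
rewrite dv ?(leq_ltn_trans Ik) //; apply/esym.
by rewrite /jentry big1 // => c _; rewrite mxE.
Qed.

(** Each S^i raises by one the order of one of the r arguments, and tangent vectors
of order greater than k vanish. *)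
Lemma vert_nilpotent (w : sform A m r k) (a : cidx A) u : multilinear (w a u) ->
  forall s (d : 'I_r -> nat) v, (forall j, order_ge (d j) (v j)) ->
  (r * k < \sum_j d j + size s)%N -> foldr (fun i w' => vert i w') w s a u v = 0.
Proof.
move=> mw; elim=> [|i s IH] d v dv rk; last first.
  rewrite /= /vert big1 // => l _.
  apply: (IH (fun j => if j == l then (d j).+1 else d j)) => [j|].
    by rewrite /subst_at; case: eqP => [->|_]; [exact: vertS_order|exact: dv].
  apply: (leq_trans rk); rewrite /= addnS -addSn leq_add2r.
  rewrite (bigD1 l) //= [X in (_ <= X)%N](bigD1 l) //= eqxx addSn ltnS leq_add2l.
  by rewrite leq_eqVlt; apply/orP; left; apply/eqP/eq_bigr => j /negbTE ->.
have [j kdj] : exists j, (k < d j)%N.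
  apply: contrapT => H; move: rk; rewrite /= addn0 ltnNge => /negP; apply.
  rewrite -[r in (r * k)%N]card_ord -sum_nat_const; apply: leq_sum => j _.
  by rewrite leqNgt; apply/negP => kd; apply: H; exists j.
by apply: (multilinear0 (l := j)) => //; exact: order_ge_eq0 kdj (dv j).
Qed.

End Nilpotency.

Section Functionals.
Context {R : realType} {n : nat} {E : topologicalType}.
Variables (A : charts E 'rV[R]_n) (hA : smooth_manifold A) (m r : nat).
Variables (a : cidx A) (g : 'rV[R]_m -> 'rV[R]_n) (O : set 'rV[R]_m).
Hypothesis gc : good_curve a g O.

Let oO : open O. Proof. by have [] := gc. Qed.

Definition field_along := {z : 'rV[R]_m -> 'rV[R]_n | smooth_on O z}.

Definition mulX i (z : field_along) : field_along :=
  exist _ (mulx i (sval z)) (smooth_mulx i oO (svalP z)).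

Lemma mulXC i j z : mulX i (mulX j z) = mulX j (mulX i z).
Proof.
apply: eq_exist; apply/funext => t /=.
by rewrite /mulx !scalerA mulrC.
Qed.

(** The values of a form along the curve, as functions of r vector fields and of a
parameter; [R^o] provides the pointwise operations.  Outside of O they are set
to 0, so that equality means equality of the values along the curve. *)
Definition functional : lmodType R := (('I_r -> field_along) * 'rV[R]_m)%type -> R^o.
Implicit Types (u : functional).

Definition good u := forall x, smooth_on O (fun t => u (x, t) : R) /\
  forall t, ~ O t -> u (x, t) = 0.

Definition Dop i u : functional := fun xt =>
  if `[< O xt.2 >] then 'D_('e_i) (fun t => u (xt.1, t) : R) xt.2 else 0.

Definition Mop i u : functional := fun xt =>
  \sum_(l < r) u (subst_at xt.1 l (mulX i (xt.1 l)), xt.2).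

Definition Sop i u : functional := fun xt =>
  Mop i u xt - r%:R * (xt.2 0 i * u xt).

Definition evf k (w : sform A m r k) : functional := fun xt =>
  if `[< O xt.2 >] then ev w a g (fun j => sval (xt.1 j)) xt.2 else 0.

Lemma good0 : good 0.
Proof. by move=> x; split=> //; exact: smooth_cst. Qed.

Lemma goodL x u v : good u -> good v -> good (x *: u + v).
Proof.
move=> gu gv y; have [su u0] := gu y; have [sv v0] := gv y; split.
  apply: (smooth_add oO) => //; apply: smooth_mul => //; exact: smooth_cst.
move=> t nO; rewrite -[LHS]/(x * u (y, t) + v (y, t)).
by rewrite u0 // v0 // mulr0 addr0.
Qed.

Lemma goodD i u : good u -> good (Dop i u).
Proof.
move=> gu x; have [su u0] := gu x; split.
  apply: (@smooth_eq _ _ _ _ ('D_('e_i) (fun t => u (x, t) : R))) => //.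
    by move=> t Ot; rewrite /Dop asboolT.
  exact: smooth_derive.
by move=> t nO; rewrite /Dop asboolF.
Qed.

Lemma goodS i u : good u -> good (Sop i u).
Proof.
move=> gu x; have [su u0] := gu x; split.
  apply: (@smooth_eq _ _ _ _ (fun t : 'rV[R]_m =>
    \sum_(l < r) (u (subst_at x l (mulX i (x l)), t) : R) + (- r%:R) * (t 0 i * (u (x, t) : R)))) => //.
    by move=> t _; rewrite mulNr.
  apply: smooth_add => //.
    by apply: smooth_sum => // l _; have [] := gu (subst_at x l (mulX i (x l))).
  apply: smooth_mul => //; first exact: smooth_cst.
  by apply: smooth_mul => //; apply: smooth_coord => //; exact: smooth_id.
move=> t nO; rewrite /Sop /Mop /= u0 // !mulr0 subr0 big1 // => l _.
by have [_ ->] := gu (subst_at x l (mulX i (x l))).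
Qed.

Lemma DL i x u v : good u -> good v ->
  Dop i (x *: u + v) = x *: Dop i u + Dop i v.
Proof.
move=> gu gv; apply/funext => -[y t]; rewrite -[RHS]/(x * Dop i u (y, t) + Dop i v (y, t)).
rewrite /Dop /=; case: asboolP => Ot; last by rewrite mulr0 addr0.
have [su _] := gu y; have [sv _] := gv y.
have du := @diff_derivable _ _ _ _ t 'e_i (smooth_diff su Ot).
have dv := @diff_derivable _ _ _ _ t 'e_i (smooth_diff sv Ot).
rewrite (@deriveD _ _ _ (fun t => x * (u (y, t) : R)) (fun t => v (y, t) : R)) //; last exact: derivableZ.
by rewrite (@deriveZ _ _ _ (fun t => u (y, t) : R)).
Qed.

Lemma SL i x u v : Sop i (x *: u + v) = x *: Sop i u + Sop i v.
Proof.
apply/funext => -[y t]; rewrite -[RHS]/(x * Sop i u (y, t) + Sop i v (y, t)).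
rewrite /Sop /Mop /=.
have -> : \sum_(l < r) (x *: u + v) (subst_at y l (mulX i (y l)), t) =
    x * (\sum_(l < r) u (subst_at y l (mulX i (y l)), t)) +
    \sum_(l < r) v (subst_at y l (mulX i (y l)), t) :> R.
  by rewrite mulr_sumr -big_split.
rewrite -[(x *: u + v) (y, t)]/(x * u (y, t) + v (y, t)).
move: (\sum_(l < r) u _) (\sum_(l < r) v _) (u (y, t)) (v (y, t)) => b c d e.
ring.
Qed.

Lemma DC i j u : good u -> Dop i (Dop j u) = Dop j (Dop i u).
Proof.
move=> gu; apply/funext => -[x t]; rewrite /Dop /=; case: asboolP => Ot; last by [].
have [su _] := gu x.
have Ej j' : forall y, O y ->
   (if `[< O y >] then 'D_('e_j') (fun t => u (x, t) : R) y else 0) =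
   'D_('e_j') (fun t => u (x, t) : R) y by move=> y Oy; rewrite asboolT.
rewrite (derive_on_eq _ oO Ot (Ej j)) (derive_on_eq _ oO Ot (Ej i)).
exact: (smooth_Schwarz _ _ oO Ot su).
Qed.

Lemma subst_mulXC i j x (l l' : 'I_r) :
  subst_at (subst_at x l (mulX i (x l))) l' (mulX j (subst_at x l (mulX i (x l)) l')) =
  subst_at (subst_at x l' (mulX j (x l'))) l (mulX i (subst_at x l' (mulX j (x l')) l)).
Proof.
have [<-|ll'] := eqVneq l l'.
  by rewrite !subst_at_eq !subst_at_at mulXC.
rewrite (subst_at_neq _ _ ll') (subst_at_neq _ _ (_ : l' != l)); last by rewrite eq_sym.
exact: subst_atC.
Qed.

Lemma SC i j u : good u -> Sop i (Sop j u) = Sop j (Sop i u).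
Proof.
move=> _; apply/funext => -[x t]; rewrite /Sop /Mop /=.
rewrite !sumrB -!mulr_sumr exchange_big /=.
under eq_bigr do under eq_bigr do rewrite subst_mulXC.
set MM := \sum_(l < r) \sum_(l' < r) _.
set Mi := \sum_(l < r) u (subst_at x l (mulX i (x l)), t).
set Mj := \sum_(l < r) u (subst_at x l (mulX j (x l)), t).
move: MM Mi Mj (u (x, t)) => MM Mi Mj ux.
ring.
Qed.

(** Since D_j acts on the parameter alone, it commutes with the first term of S_i and
D_j (t_i u) = t_i D_j u + delta_ij u. *)
Lemma SD i j u : good u ->
  Sop i (Dop j u) = Dop j (Sop i u) + ((i == j) * r)%:R *: u.
Proof.
move=> gu; apply/funext => -[x t].
rewrite -[RHS]/(Dop j (Sop i u) (x, t) + ((i == j) * r)%:R * u (x, t)).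
have [su u0] := gu x.
rewrite {1}/Sop /Mop /Dop /=; case: asboolP => Ot; last first.
  by rewrite !mulr0 subr0 u0 // mulr0 addr0 big1.
have dl y : differentiable (fun t => u (y, t) : R) t.
  by have [sy _] := gu y; exact: smooth_diff Ot.
pose M (t : 'rV[R]_m) : R := \sum_(l < r) u (subst_at x l (mulX i (x l)), t).
pose T (t : 'rV[R]_m) : R := (t 0 i - 0) * u (x, t).
have dx : differentiable (fun t : 'rV[R]_m => t 0 i - 0) t.
  by apply: (smooth_diff (smooth_coordm i 0 oO)).
have dM : differentiable M t.
  apply: (smooth_diff (O := O)) => //; apply: smooth_sum => // l _.
  by have [] := gu (subst_at x l (mulX i (x l))).
have dT : differentiable T t by exact: differentiableM.
have -> : (fun t => Sop i u (x, t) : R) = M - (r%:R \*: T).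
  by apply/funext => y; rewrite -[RHS]/(M y - r%:R * T y) /M /T subr0.
rewrite (@deriveB _ _ _ M (r%:R \*: T)); first last.
- exact/derivableZ/diff_derivable.
- exact: diff_derivable.
rewrite (@deriveZ _ _ _ T); last exact: diff_derivable.
rewrite derive_sumf => [|l]; last exact: dl.
rewrite (@deriveM _ _ (fun t : 'rV[R]_m => t 0 i - 0) (fun t => u (x, t) : R)); first last.
- exact: diff_derivable.
- exact: diff_derivable.
rewrite derive_coordm subr0 /GRing.scale /= natrM.
move: (\sum_(l < r) _) ('D__ _ _) (u (x, t)) => b c d.
case: (i == j) => /=; ring.
Qed.

Lemma good_evf k (w : sform A m r k) : is_form w -> good (evf w).
Proof.
move=> fw x; split; last by move=> t nO; rewrite /evf asboolF.
apply: (@smooth_eq _ _ _ _ (ev w a g (fun j => sval (x j)))) => //.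
  by move=> t Ot; rewrite /evf asboolT.
by apply: (ev_smooth hA fw gc) => j; exact: svalP.
Qed.

Lemma evf_congr k (w w' : sform A m r k) : form_eq w w' -> evf w = evf w'.
Proof.
move=> E1; apply/funext => -[x t]; rewrite /evf /=; case: asboolP => Ot; last by [].
have [_ _ /(_ k t Ot)[p ap Ep]] := gc.
by rewrite /ev -Ep E1.
Qed.

Lemma evf_total k i (w : sform A m r k) : is_form w ->
  evf (total_deriv i w) = Dop i (evf w).
Proof.
move=> fw; apply/funext => -[x t]; rewrite /evf /Dop /=; case: asboolP => Ot; last by [].
rewrite (ev_total hA i fw gc _ Ot); last by move=> j; exact: svalP.
by apply: (derive_on_eq _ oO Ot) => y Oy; rewrite asboolT.
Qed.

Lemma evf_vert k i (w : sform A m r k) : is_form w ->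
  evf (vert i w) = Sop i (evf w).
Proof.
move=> fw; apply/funext => -[x t]; rewrite /evf /Sop /Mop /=; case: asboolP => Ot.
  rewrite (ev_vert i fw gc _ Ot); last by move=> j; exact: svalP.
  congr (_ - _); apply: eq_bigr => l _; congr (ev w a g _ t).
  by rewrite (subst_at_map (fun z : field_along => sval z)).
by rewrite big1 // !mulr0 subr0.
Qed.

Lemma evf_pull k l (w : sform A m r l) : (l <= k)%N -> evf (pull k w) = evf w.
Proof. by move=> lk; apply/funext => -[x t]; rewrite /evf ev_pull. Qed.

Lemma evf_lin k x (w w' : sform A m r k) :
  evf (fun b p q => x * w b p q + w' b p q) = x *: evf w + evf w'.
Proof.
apply/funext => -[y t]; rewrite -[RHS]/(x * evf w (y, t) + evf w' (y, t)).
by rewrite /evf; case: asboolP => // _; rewrite mulr0 addr0.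
Qed.

Lemma evf_zero k : evf ((fun _ _ _ => 0) : sform A m r k) = 0.
Proof. by apply/funext => -[y t]; rewrite /evf; case: asboolP. Qed.

Lemma evf_sum k (I : Type) (s : seq I) (P : pred I) (x : I -> R) (w : I -> sform A m r k) :
  evf (fun b p q => \sum_(i <- s | P i) x i * w i b p q) =
  \sum_(i <- s | P i) x i *: evf (w i).
Proof.
elim: s => [|i s IH].
  by rewrite big_nil -(@evf_zero k); congr evf; apply/funext => b; apply/funext => u; apply/funext => v; rewrite big_nil.
rewrite big_cons; case: ifP => Pi; rewrite -IH -?evf_lin; congr evf;
  by apply/funext => b; apply/funext => u; apply/funext => v; rewrite big_cons Pi.
Qed.

Lemma form_vert_seq k s (w : sform A m r k) : is_form w ->
  is_form (foldr (fun i w' => vert i w') w s).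
Proof. by move=> fw; elim: s => //= i s; exact: form_vert. Qed.

Lemma evf_vert_seq k s (w : sform A m r k) : is_form w ->
  evf (foldr (fun i w' => vert i w') w s) = foldr Sop (evf w) s.
Proof.
move=> fw; elim: s => //= i s IH.
by rewrite evf_vert ?IH //; exact: form_vert_seq.
Qed.

Lemma form_total_seq k s (w : sform A m r k) : is_form w -> is_form (@total_seq R n E A m r s k w).
Proof. by move=> fw; elim: s => //= i s; exact: form_total. Qed.

Lemma evf_total_seq k s (w : sform A m r k) : is_form w ->
  evf (@total_seq R n E A m r s k w) = foldr Dop (evf w) s.
Proof.
move=> fw; elim: s => //= i s IH.
by rewrite evf_total ?IH //; exact: form_total_seq.
Qed.

Lemma nilS_evf k (w : sform A m r k) : is_form w -> nilS Sop (r * k) (evf w).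
Proof.
move=> fw s rk; rewrite -evf_vert_seq //; apply/funext => -[x t].
rewrite /evf /=; case: asboolP => Ot; last by []; rewrite /ev.
have [_ _ /(_ k t Ot) FOt] := gc.
apply: (vert_nilpotent (form_multilinear fw FOt) (d := fun _ => 0%N)) => //.
by rewrite big1.
Qed.

Lemma PcoefE s (J : {ffun 'I_m -> nat}) :
  Pcoef r s J = bcoef r (m - s) (mdeg J) * ((mdeg J)`!%:R / (mfact J)%:R) :> R.
Proof.
rewrite /Pcoef /bcoef addn1 !natrM invfM !invfM; ring.
Qed.

Lemma pull_bound k (J : {ffun 'I_m -> nat}) : (mdeg J < r * k)%N ->
  (size (mseq J) + k <= (r.+1 * k).-1)%N.
Proof. by move=> Jrk; rewrite size_mseq mulSn; lia. Qed.

Lemma form_Pj k s j (w : sform A m r k) : is_form w -> is_form (Pj s j w).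
Proof.
move=> fw; apply: form_sum => // J Jrk; apply: form_pull => //; first exact: pull_bound.
by apply: form_total_seq; exact: form_vert_seq.
Qed.

Lemma evf_Pj k s j (w : sform A m r k) : is_form w ->
  evf (Pj s j w) = Popr Dop Sop r (m - s) (r * k) j (evf w).
Proof.
move=> fw; rewrite /Pj evf_sum.
rewrite (Popr_multinomial r good0 goodL goodD goodS DL DC SC _ _ _ (good_evf fw)).
apply: eq_bigr => J Jrk; rewrite PcoefE; congr (_ *: _).
rewrite evf_pull; last exact: pull_bound.
rewrite evf_total_seq; last exact: form_vert_seq.
by rewrite evf_vert_seq.
Qed.

End Functionals.

Arguments Dop {R n m r O} i u.
Arguments Sop {R n E A m r a g O} gc i u.
Arguments evf {R n E A m r} a g O {k} w.
Arguments good0 {R n m r O} x.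
Arguments DL {R n m r O} i x [u v].

Section FormEquality.
Context {R : realType} {n : nat} {E : topologicalType}.
Variables (A : charts E 'rV[R]_n) (hA : smooth_manifold A) (m r : nat).

(** Every point of the jet bundle is the jet at 0 of a curve, and every tangent
vector is the jet at 0 of a polynomial vector field. *)
Lemma form_eq_evf k (w w' : sform A m r k) :
  (forall (a : cidx A) g O, good_curve a g O ->
     evf a g O w = evf a g O w') -> form_eq w w'.
Proof.
move=> H a p v ap; have [gamma [ig ag _ ->]] := frame_point ap.
have [ O [ O0 gc]] := good_curve_chart hA ig ag; have [oO _ _] := gc.
pose x j : field_along O := exist _ (jet_poly (v j)) (smooth_jet_poly (v j) oO).
have := congr1 (fun f => f (x, 0)) (H _ _ _ gc).
rewrite /evf /= asboolT // /ev -jet_coordsE.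
have -> // : (fun j => Jk k (jet_poly (v j)) 0) = v.
by apply/funext => j; exact: Jk_jet_poly.
Qed.

End FormEquality.

(** * Vector-valued forms *)

Section DeletedTuples.
Variable T : Type.

Definition del_tnth s (l : 'I_s.+1) (i : s.+1.-tuple T) : s.-tuple T :=
  [tuple tnth i (lift l j) | j < s].

Lemma behead_del s (i : s.+1.-tuple T) : [tuple of behead i] = del_tnth ord0 i.
Proof. by apply: eq_from_tnth => j; rewrite tnth_behead tnth_mktuple; congr tnth; apply: val_inj; rewrite /= inordK ?ltnS. Qed.

Lemma del_cons0 s j (i : s.-tuple T) : del_tnth ord0 [tuple of j :: i] = i.
Proof. by apply: eq_from_tnth => l; rewrite tnth_mktuple tnthS. Qed.

Lemma cons_del s j (l : 'I_s.+1) (i : s.+1.-tuple T) :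
  [tuple of j :: del_tnth l i] = del_tnth (lift ord0 l) [tuple of j :: i].
Proof.
apply: eq_from_tnth => h; rewrite [RHS]tnth_mktuple.
case: (unliftP ord0 h) => [h' ->|->].
  rewrite !tnthS tnth_mktuple.
  have -> : lift (lift ord0 l) (lift ord0 h') = lift ord0 (lift l h').
    by apply: val_inj; rewrite /= /bump /=; lia.
  by rewrite tnthS.
have -> : lift (lift ord0 l) ord0 = ord0 by apply: val_inj.
by rewrite !tnth0.
Qed.

(** A permutation of s+1 letters is given by the image l of the first one and a
permutation of the s others. *)
Lemma sum_lift_perm (V : nmodType) s (F : 'S_s.+1 -> V) :
  \sum_sg F sg = \sum_l \sum_(ta : 'S_s) F (lift_perm ord0 l ta).
Proof.
rewrite (partition_big (fun sg : 'S_s.+1 => sg ord0) predT) //=.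
apply: eq_bigr => l _; rewrite (reindex (lift_perm ord0 l)) /=.
  by apply: eq_bigl => ta; rewrite lift_perm_id eqxx.
pose f (sg : 'S_s.+1) (k : 'I_s) := odflt k (unlift (sg ord0) (sg (lift ord0 k))).
have fK (sg : 'S_s.+1) k : lift (sg ord0) (f sg k) = sg (lift ord0 k).
  rewrite /f; have := neq_lift ord0 k.
  by rewrite -(can_eq (permK sg)) => /unlift_some[] ? ? ->.
have inj_f sg : injective (f sg).
  move=> k k' Ek; apply: (@lift_inj _ ord0); apply: (@perm_inj _ sg).
  by rewrite -!fK Ek.
exists (fun sg => perm (inj_f sg)) => [ta _|sg /eqP <-].
  apply/permP => k; rewrite permE; apply: (@lift_inj _ l).
  by rewrite -[X in lift X _ = _](lift_perm_id ord0 l ta) fK lift_perm_lift.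
apply/permP => k; case: (unliftP ord0 k) => [k' ->|->].
  by rewrite lift_perm_lift permE fK.
by rewrite lift_perm_id.
Qed.

End DeletedTuples.

Section ActionOnTuples.
Variable m : nat.

Lemma act_tupleM s (i : s.-tuple 'I_m) (sg ta : 'S_s) :
  act_tuple (act_tuple i sg) ta = act_tuple i (ta * sg)%g.
Proof. by apply: eq_from_tnth => l; rewrite !tnth_mktuple permM. Qed.

Lemma thead_act s (i : s.+1.-tuple 'I_m) l (ta : 'S_s) :
  thead (act_tuple i (lift_perm ord0 l ta)) = tnth i l.
Proof. by rewrite /thead tnth_mktuple lift_perm_id. Qed.

Lemma del_act s (i : s.+1.-tuple 'I_m) l (ta : 'S_s) :
  del_tnth ord0 (act_tuple i (lift_perm ord0 l ta)) = act_tuple (del_tnth l i) ta.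
Proof. by apply: eq_from_tnth => h; rewrite !tnth_mktuple lift_perm_lift. Qed.

Lemma cons_act s j (i : s.-tuple 'I_m) (sg : 'S_s) :
  [tuple of j :: act_tuple i sg] =
  act_tuple [tuple of j :: i] (lift_perm ord0 ord0 sg).
Proof.
apply: eq_from_tnth => h; rewrite [RHS]tnth_mktuple.
case: (unliftP ord0 h) => [h' ->|->].
  by rewrite tnthS tnth_mktuple lift_perm_lift tnthS.
by rewrite lift_perm_id !tnth0.
Qed.

Lemma cons_tnth_del s l (i : s.+1.-tuple 'I_m) :
  [tuple of tnth i l :: del_tnth l i] = act_tuple i (lift_perm ord0 l 1%g).
Proof.
apply: eq_from_tnth => h; rewrite [RHS]tnth_mktuple.
case: (unliftP ord0 h) => [h' ->|->].
  by rewrite tnthS tnth_mktuple lift_perm_lift perm1.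
by rewrite lift_perm_id !tnth0.
Qed.

End ActionOnTuples.

Section VectorForms.
Context {R : realType} {n : nat} {E : topologicalType}.
Variables (A : charts E 'rV[R]_n) (hA : smooth_manifold A) (m r : nat).

Lemma dTE s k (Phi : vform A m r s k) i :
  dT Phi i = fun a u v => \sum_(sg : 'S_s.+1) ((s.+1`!%:R)^-1 * (-1) ^+ sg) *
    total_deriv (thead (act_tuple i sg)) (Phi (del_tnth ord0 (act_tuple i sg))) a u v.
Proof.
apply/funext => a; apply/funext => u; apply/funext => v.
rewrite /dT /skew_part mulr_sumr; apply: eq_bigr => sg _.
by rewrite behead_del mulrA.
Qed.

Lemma opPE s k (Phi : vform A m r s.+1 k) i :
  opP Phi i = fun a u v => \sum_j s.+1%:R * Pj s.+1 j (Phi [tuple of j :: i]) a u v.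
Proof.
apply/funext => a; apply/funext => u; apply/funext => v.
by rewrite /opP mulr_sumr.
Qed.

Lemma skew_part_act s k (phi : vform A m r s k) i sg a u v :
  skew_part phi (act_tuple i sg) a u v = (-1) ^+ sg * skew_part phi i a u v.
Proof.
rewrite /skew_part mulrCA; congr (_ * _).
rewrite mulr_sumr [RHS](reindex_inj (mulIg sg)); apply: eq_bigr => ta _.
rewrite act_tupleM odd_permM signr_addb.
rewrite mulrA; congr (_ * _).
by rewrite mulrCA -expr2 sqrr_sign mulr1.
Qed.

Lemma vform_dT s k (Phi : vform A m r s k) : is_vform Phi -> is_vform (dT Phi).
Proof.
move=> [fP _]; split=> [i|i sg].
  rewrite dTE; apply: form_sum => // sg _; exact: form_total.
by move=> a p v _; rewrite /dT skew_part_act.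
Qed.

Lemma vform_zero s k : is_vform (vzero A m r s k).
Proof.
split=> [i|i sg]; first exact: form_zero.
by move=> a p v _; rewrite /vzero mulr0.
Qed.

Lemma total_zero k i : total_deriv i (fun _ _ _ => 0 : R) = (fun _ _ _ => 0) :> sform A m r k.+1.
Proof.
apply/funext => a; apply/funext => u; apply/funext => v.
rewrite /total_deriv /total_deriv_fun big1 ?add0r => [|al _]; first by rewrite big1.
by rewrite big1 // => I _; rewrite derive_cst mulr0.
Qed.

Lemma dT_zero s k : dT (vzero A m r s k) = vzero A m r s.+1 k.+1.
Proof.
apply/funext => i; rewrite dTE; apply/funext => a; apply/funext => u; apply/funext => v.
by rewrite big1 // => sg _; rewrite total_zero mulr0.
Qed.

Lemma opP_order0 s (Phi : vform A m r s 0) : opP Phi = vzero A m r _ _.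
Proof.
case: s Phi => // s Phi; apply/funext => i; rewrite opPE.
apply/funext => a; apply/funext => u; apply/funext => v.
rewrite big1 // => j _; rewrite /Pj big_pred0 ?mulr0 // => J.
by apply/negbTE; rewrite -leqNgt (leq_trans _ (leq0n _)) ?muln0.
Qed.

Lemma dTP_order0 s (Phi : vform A m r s 0) : dTP Phi = vzero A m r _ _.
Proof.
case: s Phi => // s Phi; apply/funext => i.
by rewrite /dTP /vpull opP_order0 dT_zero.
Qed.

Definition vlin s k x (Phi Psi : vform A m r s k) : vform A m r s k :=
  fun i a u v => x * Phi i a u v + Psi i a u v.

Lemma vform_vlin s k x (Phi Psi : vform A m r s k) :
  is_vform Phi -> is_vform Psi -> is_vform (vlin x Phi Psi).
Proof.
move=> [fP sP] [fQ sQ]; split=> [i|i sg a p v ap]; first exact: form_lin.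
by rewrite /vlin sP // sQ // mulrDr mulrCA.
Qed.

Section Evaluation.
Variables (a : cidx A) (g : 'rV[R]_m -> 'rV[R]_n) (O : set 'rV[R]_m).
Hypothesis gc : good_curve a g O.

Local Notation ev := (evf a g O).
Local Notation P p N j := (Popr Dop (Sop gc) r p N j).

Lemma evf_scale k x (w : sform A m r k) :
  ev (fun b p q => x * w b p q) = x *: ev w.
Proof.
apply/funext => -[y t]; rewrite -[RHS]/(x * ev w (y, t)).
by rewrite /evf; case: asboolP => // _; rewrite mulr0.
Qed.

Lemma evf_add k (w w' : sform A m r k) :
  ev (fun b p q => w b p q + w' b p q) = ev w + ev w'.
Proof.
apply/funext => -[y t]; rewrite -[RHS]/(ev w (y, t) + ev w' (y, t)).
by rewrite /evf; case: asboolP => // _; rewrite addr0.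
Qed.

Lemma evf_act s k (Phi : vform A m r s k) i sg : is_vform Phi ->
  ev (Phi (act_tuple i sg)) = (-1) ^+ sg *: ev (Phi i).
Proof. by move=> [_ sP]; rewrite (evf_congr gc (sP i sg)) evf_scale. Qed.

(** The s! permutations with the same image of the first index give equal terms, by
skew-symmetry of Phi. *)
Lemma evf_dT s k (Phi : vform A m r s k) i : is_vform Phi ->
  ev (dT Phi i) = (s.+1%:R)^-1 *:
    \sum_(l < s.+1) (-1) ^+ l *: Dop (tnth i l) (ev (Phi (del_tnth l i))).
Proof.
move=> vP; have [fP _] := vP; rewrite dTE evf_sum (sum_lift_perm (V := functional r O)) scaler_sumr.
apply: eq_bigr => l _.
have E1 (ta : 'S_s) :
    (s.+1`!%:R^-1 * (-1) ^+ lift_perm ord0 l ta) *: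
      ev (total_deriv (thead (act_tuple i (lift_perm ord0 l ta)))
           (Phi (del_tnth ord0 (act_tuple i (lift_perm ord0 l ta))))) =
    (s.+1`!%:R^-1 * (-1) ^+ l) *: Dop (tnth i l) (ev (Phi (del_tnth l i))).
  rewrite (evf_total hA gc) // thead_act del_act evf_act //.
  rewrite (DZ good0 DL); last exact: good_evf.
  rewrite scalerA -mulrA; congr ((_ * _) *: _).
  by rewrite odd_lift_perm /= signr_addb -mulrA -expr2 sqrr_sign mulr1 signr_odd.
rewrite (eq_bigr _ (fun ta _ => E1 ta)) sumr_const card_Sn -[_ *+ s`!]scaler_nat.
rewrite !scalerA; congr (_ *: _).
rewrite factS natrM; field.
rewrite !pnatr_eq0 -!lt0n fact_gt0 /= addrC natr1 pnatr_eq0; by [].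
Qed.

Lemma evf_opP s k (Phi : vform A m r s.+1 k) i : is_vform Phi ->
  ev (opP Phi i) = s.+1%:R *:
    \sum_j P (m - s.+1) (r * k) j (ev (Phi [tuple of j :: i])).
Proof.
move=> [fP _]; rewrite opPE evf_sum scaler_sumr; apply: eq_bigr => j _.
by rewrite (evf_Pj hA gc).
Qed.

End Evaluation.

Lemma vform_opP s k (Phi : vform A m r s k) : is_vform Phi -> is_vform (opP Phi).
Proof.
case: s Phi => [|s] Phi vP; first exact: vform_zero.
have [fP _] := vP; split=> [i|i sg].
  rewrite opPE; apply: form_sum => // j _; exact: form_Pj.
apply: (form_eq_evf hA) => a g O gc.
rewrite [RHS]evf_scale !(evf_opP gc) // scalerA mulrC -scalerA; congr (_ *: _).
rewrite scaler_sumr; apply: eq_bigr => j _.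
rewrite cons_act (evf_act gc) // odd_lift_perm.
have ge : good (evf a g O (Phi [tuple of j :: i])) by exact: good_evf.
rewrite /= -[X in Popr _ _ _ _ _ _ X = _]addr0.
rewrite (PoprL r good0 (goodL gc) (goodD gc) (goodS gc) DL (SL gc)) //; last exact: good0.
by rewrite (Popr_zero r good0 DL (SL gc)) addr0.
Qed.

Lemma dT_lin s k x (Phi Psi : vform A m r s k) : is_vform Phi -> is_vform Psi ->
  vform_eq (dT (vlin x Phi Psi)) (vlin x (dT Phi) (dT Psi)).
Proof.
move=> vP vQ i; have [[fP _] [fQ _]] := (vP, vQ).
apply: (form_eq_evf hA) => a g O gc.
rewrite /vlin evf_lin !(evf_dT gc) //; last exact: vform_vlin.
rewrite scalerA mulrC -scalerA -scalerDr; congr (_ *: _).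
rewrite scaler_sumr -big_split; apply: eq_bigr => l _ /=.
rewrite scalerA mulrC -scalerA -scalerDr evf_lin; congr (_ *: _).
by rewrite DL //; exact: good_evf.
Qed.

(** For k > 0 the factor 1/s of d_T and the factor s of P cancel; for k = 0 both
sides are 0.
The parameter p = m - s is written as a successor to match [homotopy]. *)
Lemma evf_dTP a g O (gc : good_curve a g O) s k (Phi : vform A m r s k) i :
  (s < m)%N -> is_vform Phi -> evf a g O (dTP Phi i) =
  \sum_(l < s) (-1) ^+ l *: Dop (tnth i l)
    (\sum_j Popr Dop (Sop gc) r (m - s.+1).+1 (r * k) j
      (evf a g O (Phi (del_tnth (lift ord0 l) [tuple of j :: i])))).
Proof.
move=> sm vP; case: k Phi vP => [|k] Phi vP.
  rewrite dTP_order0 evf_zero muln0 big1 // => l _.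
  rewrite big1 => [|j _]; last by rewrite /Popr big_ord0.
  by rewrite (D_zero good0 DL) scaler0.
case: s sm Phi vP i => [|s] sm Phi vP i; first by rewrite evf_zero big_ord0.
have [fP _] := vP.
rewrite /dTP /vpull evf_pull; last by rewrite mulnS; lia.
rewrite (evf_dT gc); last exact: vform_opP.
rewrite scaler_sumr; apply: eq_bigr => l _.
have gP j : good (evf a g O (Phi [tuple of j :: del_tnth l i])) by exact: good_evf.
rewrite (evf_opP gc) // (DZ good0 DL); last first.
  apply: (good_sum good0 (goodL gc)) => j _.
  exact: (goodP r good0 (goodL gc) (goodD gc) (goodS gc)).
rewrite !scalerA mulrAC mulVf ?mul1r ?pnatr_eq0 //; congr (_ *: Dop _ _).
apply: eq_bigr => j _; rewrite cons_del; congr (Popr _ _ _ _ _ _ _).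
by rewrite subnSK.
Qed.

(** The first sum is the term of d_T in which the derivative has the index j
introduced by P. *)
Lemma evf_opP_dT a g O (gc : good_curve a g O) s k (Phi : vform A m r s k) i :
  is_vform Phi -> evf a g O (opP (dT Phi) i) =
  let P j u := Popr Dop (Sop gc) r (m - s.+1) (r * k.+1) j u in
  \sum_j P j (Dop j (evf a g O (Phi i))) +
  \sum_(l < s) (-1) ^+ l.+1 *: \sum_j P j (Dop (tnth i l)
    (evf a g O (Phi (del_tnth (lift ord0 l) [tuple of j :: i])))).
Proof.
move=> vP; have [fP _] := vP; set P := fun j => _.
have gE j : good (evf a g O (Phi j)) by exact: good_evf.
have PD j x u v : good u -> good v -> P j (x *: u + v) = x *: P j u + P j v.
  exact: (PoprL r good0 (goodL gc) (goodD gc) (goodS gc) DL (SL gc)).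
have P0 j : P j 0 = 0 by exact: (Popr_zero r good0 DL (SL gc)).
have PZ j x u : good u -> P j (x *: u) = x *: P j u.
  by move=> gu; rewrite -[x *: u]addr0 PD ?P0 ?addr0 //; exact: good0.
have gDE h j : good (Dop h (evf a g O (Phi j))).
  exact: (goodD gc).
have gS s0 (H : 'I_s0 -> @functional R n m r O) : (forall l, good (H l)) ->
    forall x : 'I_s0 -> R, good (\sum_l x l *: H l).
  move=> gH x; apply: (good_sum good0 (goodL gc)) => l _.
  exact: (goodZ good0 (goodL gc)).
have PS j s0 (H : 'I_s0 -> @functional R n m r O) (x : 'I_s0 -> R) : (forall l, good (H l)) ->
    P j (\sum_l x l *: H l) = \sum_l x l *: P j (H l).
  elim: s0 H x => [|s0 IH] H x gH; first by rewrite !big_ord0 P0.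
  rewrite !big_ord_recl PD ?IH //; exact: gS.
rewrite (evf_opP gc); last exact: vform_dT.
under eq_bigr => j _.
  rewrite (evf_dT gc) // -/(P j _) PZ; last by apply: gS => l.
  rewrite PS // big_ord_recl tnth0 del_cons0 expr0 scale1r.
  under eq_bigr do rewrite tnthS.
  over.
rewrite -scaler_sumr scalerA mulfV ?pnatr_eq0 // scale1r big_split /=.
congr (_ + _); rewrite exchange_big; apply: eq_bigr => l _ /=.
by rewrite scaler_sumr.
Qed.

Lemma evf_homotopy a g O (gc : good_curve a g O) s k (Phi : vform A m r s k) i :
  (0 < r)%N -> (s < m)%N -> is_vform Phi ->
  evf a g O (dTP Phi i) + evf a g O (opP (dT Phi) i) =
  evf a g O (Phi i).
Proof.
move=> r_gt0 sm vP; have [fP _] := vP.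
rewrite (evf_dTP gc) // (evf_opP_dT gc) // addrC.
apply: (homotopy r_gt0 good0 (goodL gc) (goodD gc) (goodS gc) DL (SL gc) (DC gc) (SD gc)
  (c := fun l => tnth i l)
  (w := fun l j => evf a g O (Phi (del_tnth (lift ord0 l) [tuple of j :: i])))).
- exact: good_evf.
- by move=> l j; exact: good_evf.
- exact: nilS_evf.
- by move=> l j; exact: nilS_evf.
- by rewrite ltn_pmul2l.
- by rewrite -addnS subnK.
- case: s sm Phi vP fP i => [|s] sm Phi vP fP i [l ls] //.
  rewrite -cons_del cons_tnth_del (evf_act gc) // odd_lift_perm odd_perm1 addbF /=.
  by rewrite signr_odd.
Qed.

End VectorForms.

Theorem mainTheorem1 (R : realType) (n : nat) (E : topologicalType)
    (A : charts E 'rV[R]_n) (hA : smooth_manifold A)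
    (m r k s : nat) (hm : (1 <= m)%N) (hr : (1 <= r)%N) (hs : (s <= m.-1)%N) :
  (forall Phi : vform A m r s k, is_vform Phi ->
    [/\ (* d_T and P take values in the (globally defined) forms *)
        is_vform (dT Phi) /\ is_vform (opP Phi),
        (* the pseudo-homotopy formula *)
        vform_eq
          (vadd (vpull (r.+1 * k.+1).-1 (dTP Phi)) (opP (dT Phi)))
          (vpull (r.+1 * k.+1).-1 Phi),
        (* the conventional cases *)
        s = 0%N \/ k = 0%N ->
          vform_eq (opP Phi) (vzero A m r _ _) /\
          vform_eq (dTP Phi) (vzero A m r _ _)
      & (* exactness modulo pull-backs *)
        vform_eq (dT Phi) (vzero A m r _ _) ->
          vform_eq (dTP Phi) (vpull (r.+1 * k) Phi) /\
          (s = 0%N \/ k = 0%N -> vform_eq Phi (vzero A m r _ _))]) /\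
  (* exactness at the last two nonzero terms *)
  (s.+1 = m ->
    (forall Phi : vform A m r s.+1 k.+1, is_vform Phi ->
      (qclass Phi = qclass (vzero A m r s.+1 k.+1) <->
       exists2 Theta : vform A m r s k, is_vform Theta
         & vform_eq Phi (dT Theta))) /\
    (forall c, dT_quotient A m r s k c ->
      exists2 Phi : vform A m r s.+1 k.+1, is_vform Phi & qclass Phi = c)).
Proof.
have sm : (s < m)%N by rewrite -ltnS prednK in hs.
split=> [Phi vP|_].
  have conv : s = 0%N \/ k = 0%N ->
      vform_eq (opP Phi) (vzero A m r _ _) /\ vform_eq (dTP Phi) (vzero A m r _ _).
    move=> [s0|k0]; first by subst s.
    by subst k; rewrite opP_order0 dTP_order0.
  split=> //.
  - by split; [exact: vform_dT|exact: vform_opP].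
  - move=> i; apply: (form_eq_evf hA) => a g O gc.
    rewrite /vadd /vpull evf_add !evf_pull.
    + exact: evf_homotopy.
    + by rewrite !mulSn; lia.
    + by rewrite mulnS; lia.
  - move=> dP.
    have K i a g O (gc : good_curve a g O) :
        evf a g O (dTP Phi i) = evf a g O (Phi i).
      rewrite -[RHS](evf_homotopy hA gc) // (evf_opP hA gc); last exact: vform_dT.
      rewrite big1 ?scaler0 ?addr0 // => j _.
      rewrite (evf_congr gc (dP _)) evf_zero.
      exact: (Popr_zero r good0 DL (SL gc)).
    split=> [i|sk i].
      apply: (form_eq_evf hA) => a g O gc.
      rewrite (K _ _ _ _ gc) /vpull; apply/esym/evf_pull.
      by rewrite mulSn leq_addr.
    apply: (form_eq_evf hA) => a g O gc.
    by rewrite -(K _ _ _ _ gc) (evf_congr gc ((conv sk).2 i)) !evf_zero.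
split=> [Phi vP|c [Phi vP <-]]; last by exists Phi.
have [fP _] := vP.
split=> [EP | [ Theta vT ET]].
  have : qclass Phi Phi.
    split=> //; exists (vzero A m r s k); first exact: vform_zero.
    by rewrite dT_zero => i a p v _; rewrite /vsub subrr.
  rewrite EP => -[_ [ Theta vT ET]]; exists Theta => // i a p v ap.
  by rewrite -ET // /vsub subr0.
apply/seteqP; split=> Psi [vQ [Th vTh ETh]]; split=> //.
  exists (vlin 1 Th Theta); first exact: vform_vlin.
  move=> i a p v ap; rewrite (dT_lin hA 1 vTh vT _ v ap) /vlin -ETh // -ET // /vsub /vzero.
  by rewrite mul1r subr0 subrK.
exists (vlin (-1) Theta Th); first exact: vform_vlin.
move=> i a p v ap; rewrite (dT_lin hA (-1) vT vTh _ v ap) /vlin -ETh // -ET // /vsub /vzero.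
by rewrite mulN1r subr0 addrC.
Qed.
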